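(* Let $E$ be a directed graph and let $F$ be a desingularization of $E$. Then $C^*(E)$ is isomorphic to a full corner of $C^*(F)$. Consequently, $C^*(E)$ and $C^*(F)$ are Morita equivalent.
   Context: A (directed) graph $E=(E^0,E^1,r,s)$ consists of countable sets $E^0$ of vertices and $E^1$ of edges, and maps $r,s:E^1\to E^0$ (range and source). A vertex $v$ is a sink if $|s^{-1}(v)|=0$ and an infinite-emitter if $|s^{-1}(v)|=\infty$; $v$ is singular if it is a sink or an infinite-emitter. A Cuntz-Krieger $E$-family consists of mutually orthogonal projections $\{p_v : v\in E^0\}$ and partial isometries $\{s_e : e\in E^1\}$ with orthogonal ranges satisfying: (1) $s_e^*s_e=p_{r(e)}$ for every $e\in E^1$; (2) $s_es_e^*\le p_{s(e)}$ for every $e\in E^1$; (3) $p_v=\sum_{\{e : s(e)=v\}}s_es_e^*$ for every $v\in E^0$ that is not a singular vertex. The graph algebra $C^*(E)$ is the $C^*$-algebra generated by a universal Cuntz-Krieger $E$-family. Adding a tail to a singular vertex $v_0$: add new vertices $v_1,v_2,\ldots$ and new edges $e_1,e_2,\ldots$ with $s(e_n)=v_{n-1}$, $r(e_n)=v_n$. If $v_0$ is a sink nothing else is done. If $v_0$ is an infinite-emitter, list the edges of $s^{-1}(v_0)$ as $g_1,g_2,g_3,\ldots$, remove these edges, and for every $j\ge 1$ add an edge $f_j$ with $s(f_j)=v_{j-1}$ and $r(f_j)=r(g_j)$. A desingularization of $E$ is a graph $F$ obtained by adding a tail at every singular vertex of $E$ (with a separate tail for each singular vertex and some choice of listing at each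 infinite-emitter). A corner of a $C^*$-algebra $A$ is a subalgebra $pAp$ with $p$ a projection in the multiplier algebra $M(A)$; it is full if it is not contained in any proper closed two-sided ideal of $A$. *)

(* Defs.v *)
From HB Require Import structures.
From mathcomp Require Import all_boot all_order all_algebra.
From mathcomp Require Import complex.
From mathcomp Require Import all_classical all_reals all_analysis.

Set Implicit Arguments.
Unset Strict Implicit.
Unset Printing Implicit Defensive.
Import Order.TTheory GRing.Theory Num.Theory.
Import numFieldNormedType.Exports.
Local Open Scope classical_set_scope.
Local Open Scope ring_scope.

(** * C*-algebras (complex, not necessarily unital)

    MathComp rings are unital, so the product is a separate operation [amul].
    Over the field [R[i]], the norm of a [completeNormedModType R[i]] takes its
    values in the nonnegative reals of [R[i]], and [a^*] is the conjugate. *)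

HB.mixin Record CompleteNormedModule_isCStarAlgebra (R : realType) A
    of CompleteNormedModule R[i] A := {
  amul : A -> A -> A;
  astar : A -> A;
  amulA : associative amul;
  amulDl : left_distributive amul +%R;
  amulDr : right_distributive amul +%R;
  amulZl : forall (a : R[i]) (x y : A), amul (a *: x) y = a *: amul x y;
  amulZr : forall (a : R[i]) (x y : A), amul x (a *: y) = a *: amul x y;
  astarK : involutive astar;
  astarD : {morph astar : x y / x + y};
  astarZ : forall (a : R[i]) (x : A), astar (a *: x) = a^* *: astar x;
  astarM : forall x y : A, astar (amul x y) = amul (astar y) (astar x);
  ler_norm_amul : forall x y : A, `|amul x y| <= `|x| * `|y|;
  norm_astar_amul : forall x : A, `|amul (astar x) x| = `|x| ^+ 2
}.

#[short(type="cstarAlgType")]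
HB.structure Definition CStarAlgebra (R : realType) :=
  { A of CompleteNormedModule R[i] A
       & CompleteNormedModule_isCStarAlgebra R A }.

Declare Scope cstar_scope.
Delimit Scope cstar_scope with cstar.
Local Open Scope cstar_scope.
Notation "x ⋅ y" := (amul x y) (at level 40, left associativity) : cstar_scope.
Notation "x ^☆" := (astar x) (at level 2, format "x ^☆") : cstar_scope.

Section CStar.
Context {R : realType}.
Implicit Types A B : cstarAlgType R.

Definition star_hom A B (phi : A -> B) : Prop :=
  [/\ linear phi,
      forall x y, phi (x ⋅ y) = phi x ⋅ phi y
    & forall x, phi (x^☆) = (phi x)^☆].

Definition positive A (x : A) : Prop := exists y : A, x = y^☆ ⋅ y.

Definition cstar_le A (x y : A) : Prop := positive (y - x).

Definition projection A (p : A) : Prop := p ⋅ p = p /\ p^☆ = p.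

Definition partial_isometry A (s : A) : Prop := s ⋅ s^☆ ⋅ s = s.

Definition closed_subspace (V : normedModType R[i]) (S : set V) : Prop :=
  [/\ closed S, S 0, forall x y, S x -> S y -> S (x + y)
    & forall (a : R[i]) x, S x -> S (a *: x)].

Definition cstar_subalgebra A (S : set A) : Prop :=
  [/\ closed_subspace S, forall x y, S x -> S y -> S (x ⋅ y)
    & forall x, S x -> S (x^☆)].

Definition generates A (G : set A) : Prop :=
  forall S : set A, cstar_subalgebra S -> G `<=` S -> S = setT.

Definition closed_ideal A (I : set A) : Prop :=
  closed_subspace I /\ forall x y, I x -> I (x ⋅ y) /\ I (y ⋅ x).

(** * Multiplier algebra and corners

    [M(A)] is the algebra of double centralizers: the pair [m] stands for the
    multiplier acting by [m ⋅ a = m.1 a] and [a ⋅ m = m.2 a]. *)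

Definition multiplier A (m : (A -> A) * (A -> A)) : Prop :=
  [/\ linear m.1 /\ continuous m.1,
      linear m.2 /\ continuous m.2,
      forall a b, m.1 (a ⋅ b) = m.1 a ⋅ b,
      forall a b, m.2 (a ⋅ b) = a ⋅ m.2 b
    & forall a b, m.2 a ⋅ b = a ⋅ m.1 b].

Definition multiplier_mul A (m n : (A -> A) * (A -> A)) :
    (A -> A) * (A -> A) :=
  (m.1 \o n.1, n.2 \o m.2).

Definition multiplier_star A (m : (A -> A) * (A -> A)) :
    (A -> A) * (A -> A) :=
  (fun a => (m.2 a^☆)^☆, fun a => (m.1 a^☆)^☆).

Definition multiplier_projection A (p : (A -> A) * (A -> A)) : Prop :=
  [/\ multiplier p, multiplier_mul p p = p & multiplier_star p = p].

Definition corner A (p : (A -> A) * (A -> A)) : set A :=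
  [set p.2 (p.1 a) | a in [set: A]].

Definition full A (S : set A) : Prop :=
  forall I : set A, closed_ideal I -> S `<=` I -> I = setT.

Definition isomorphic_to_full_corner A B : Prop :=
  exists p : (B -> B) * (B -> B),
    [/\ multiplier_projection p, full (corner p)
      & exists phi : A -> B,
          star_hom phi /\ set_bij [set: A] (corner p) phi].

(** * Morita equivalence, by means of imprimitivity bimodules *)

Definition left_hilbert_module A (X : completeNormedModType R[i])
    (act : A -> X -> X) (ip : X -> X -> A) : Prop :=
  [/\ (forall a, linear (act a)) /\ (forall x, linear (act ^~ x)),
      forall a b x, act (a ⋅ b) x = act a (act b x),
      (forall y, linear (ip ^~ y)) /\
        (forall a x y, ip (act a x) y = a ⋅ ip x y),
      forall x y, (ip x y)^☆ = ip y x
    & forall x, positive (ip x x) /\ `|ip x x| = `|x| ^+ 2].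

Definition right_hilbert_module B (X : completeNormedModType R[i])
    (act : X -> B -> X) (ip : X -> X -> B) : Prop :=
  [/\ (forall b, linear (act ^~ b)) /\ (forall x, linear (act x)),
      forall x a b, act x (a ⋅ b) = act (act x a) b,
      (forall x, linear (ip x)) /\
        (forall x y b, ip x (act y b) = ip x y ⋅ b),
      forall x y, (ip x y)^☆ = ip y x
    & forall x, positive (ip x x) /\ `|ip x x| = `|x| ^+ 2].

Definition full_inner_product A (X : Type) (ip : X -> X -> A) : Prop :=
  forall S : set A, closed_subspace S -> (forall x y, S (ip x y)) -> S = setT.

(* The two Hilbert module norms of an imprimitivity bimodule coincide, so both
   are required to be the norm of the carrier. *)
Record imprimitivity_bimodule A B := ImprimitivityBimodule {
  ib_carrier :> completeNormedModType R[i];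
  lact : A -> ib_carrier -> ib_carrier;
  ract : ib_carrier -> B -> ib_carrier;
  lip : ib_carrier -> ib_carrier -> A;
  rip : ib_carrier -> ib_carrier -> B;
  lactA : forall a x b, ract (lact a x) b = lact a (ract x b);
  ib_left : left_hilbert_module lact lip;
  ib_right : right_hilbert_module ract rip;
  ib_left_full : full_inner_product lip;
  ib_right_full : full_inner_product rip;
  rip_lact : forall a x y, rip (lact a x) y = rip x (lact a^☆ y);
  lip_ract : forall b x y, lip (ract x b) y = lip x (ract y b^☆);
  lip_rip : forall x y z, lact (lip x y) z = ract x (rip y z)
}.

Definition morita_equivalent A B : Prop := inhabited (imprimitivity_bimodule A B).

End CStar.

(** * Directed graphs *)

Record graph := Graph {
  vertex : countType;
  edge : countType;
  rng : edge -> vertex;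
  src : edge -> vertex
}.

Definition out_edges (E : graph) (v : vertex E) : set (edge E) :=
  [set e | src e = v].

Definition sink (E : graph) (v : vertex E) : bool := `[< out_edges v = set0 >].

Definition infinite_emitter (E : graph) (v : vertex E) : bool :=
  `[< infinite_set (out_edges v) >].

Definition singular (E : graph) (v : vertex E) : bool :=
  sink v || infinite_emitter v.

(** * Cuntz-Krieger families and graph algebras *)

Definition cuntz_krieger_family (R : realType) (E : graph)
    (A : cstarAlgType R) (p : vertex E -> A) (s : edge E -> A) : Prop :=
  [/\ (forall v, projection (p v)) /\
        (forall v w, v <> w -> p v ⋅ p w = 0),
      (forall e, partial_isometry (s e)) /\
        (forall e f, e <> f -> (s e ⋅ (s e)^☆) ⋅ (s f ⋅ (s f)^☆) = 0),
      forall e, (s e)^☆ ⋅ s e = p (rng e),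
      forall e, cstar_le (s e ⋅ (s e)^☆) (p (src e))
    & forall v, ~~ singular v ->
        p v = \sum_(e \in out_edges v) (s e ⋅ (s e)^☆)].

(* [C*(E)] is determined up to isomorphism by this universal property:
   [is_graph_algebra p s] says that the C*-algebra [A], together with the
   family [(p, s)], is the graph algebra of [E]. *)
Definition is_graph_algebra (R : realType) (E : graph)
    (A : cstarAlgType R) (p : vertex E -> A) (s : edge E -> A) : Prop :=
  [/\ cuntz_krieger_family p s,
      generates ([set p v | v in [set: vertex E]] `|`
                 [set s e | e in [set: edge E]])
    & forall (B : cstarAlgType R) (q : vertex E -> B) (t : edge E -> B),
        cuntz_krieger_family q t ->
        exists phi : A -> B,
          [/\ star_hom phi, forall v, phi (p v) = q v
            & forall e, phi (s e) = t e]].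

(** * Desingularization *)

(* Listings [g_1, g_2, ...] (here indexed from 0) without repetition of the
   edges leaving each infinite emitter. *)
Record listing (E : graph) := Listing {
  nth_edge :> {v : vertex E | infinite_emitter v} -> nat -> edge E;
  nth_edge_bij : forall v,
    set_bij [set: nat] (out_edges (val v)) (nth_edge v)
}.

Section Desingularization.
Variables (E : graph) (g : listing E).

Let singular_vertex := {v : vertex E | singular v}.
Let emitter := {v : vertex E | infinite_emitter v}.

Lemma emitter_singular (v : vertex E) : infinite_emitter v -> singular v.
Proof. by rewrite /singular => ->; rewrite orbT. Qed.

Definition singular_of_emitter (w : emitter) : singular_vertex :=
  exist _ (val w) (emitter_singular (valP w)).

(* [inr (v, n)] is the vertex [v_{n+1}] of the tail added at [v]. *)
Definition desing_vertex : countType := (vertex E + singular_vertex * nat)%type.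

Definition tail_vertex (v : singular_vertex) (n : nat) : desing_vertex :=
  if n is m.+1 then inr (v, m) else inl (val v).

(* [kept_edge e] is an edge of [E] which does not leave an infinite emitter,
   [tail_edge v n] is [e_{n+1}] on the tail at [v], and [new_edge w n] is the
   edge [f_{n+1}] which replaces [g_{n+1}] at [w]. *)
Definition desing_edge : countType :=
  ({e : edge E | ~~ infinite_emitter (src e)}
   + (singular_vertex * nat + emitter * nat))%type.

Notation kept_edge e := (inl e).
Notation tail_edge v n := (inr (inl (v, n))).
Notation new_edge w n := (inr (inr (w, n))).

Definition desing_src (e : desing_edge) : desing_vertex :=
  match e with
  | kept_edge e => inl (src (val e))
  | tail_edge v n => tail_vertex v n
  | new_edge w n => tail_vertex (singular_of_emitter w) n
  end.

Definition desing_rng (e : desing_edge) : desing_vertex :=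
  match e with
  | kept_edge e => inl (rng (val e))
  | tail_edge v n => tail_vertex v n.+1
  | new_edge w n => inl (rng (g w n))
  end.

Definition desingularization : graph :=
  @Graph desing_vertex desing_edge desing_rng desing_src.

End Desingularization.

Definition graph_isomorphic (E F : graph) : Prop :=
  exists (fv : vertex E -> vertex F) (fe : edge E -> edge F),
    [/\ bijective fv, bijective fe, forall e, rng (fe e) = fv (rng e)
      & forall e, src (fe e) = fv (src e)].

(* The new vertices and edges are arbitrary objects, so a desingularization is
   only determined up to the names of its vertices and edges. *)
Definition is_desingularization (E F : graph) : Prop :=
  exists g : listing E, graph_isomorphic (desingularization g) F.

(* Main.v *)
From HB Require Import structures.
Require Import Defs.
From mathcomp Require Import all_boot all_order all_algebra.
From mathcomp Require Import complex.
From mathcomp Require Import all_classical all_reals all_analysis.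
From mathcomp Require Import ring lra.

(** The idea is that of Drinen and Tomforde. Let [D] be the desingularization.
    In a Cuntz-Krieger family [(q, t)] of [D], the path that follows the tail
    at an infinite emitter up to its [n]-th vertex and leaves it there behaves
    like the [n]-th listed edge of [E]. Together with the [q v] for [v] a
    vertex of [E] these paths form a Cuntz-Krieger family of [E]
    ([contracted_family]), hence a homomorphism [phi : C*(E) -> C*(D)].

    [phi] is isometric: conversely, a family [(p, s)] of [E] is dilated to one
    of [D] on infinite matrices ([desing_family]). The [n]-th tail vertex at [v]
    receives, in the diagonal position [n], the projection obtained from [p v]
    by removing the ranges of the first [n] listed edges. The homomorphism
    which this family defines on [C*(D)] carries [phi a] to the matrix with the
    single entry [a], whose norm is that of [a] ([nrm_phi]).

    The range of [phi] is the corner of the multiplier projection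
    [Q = sum_(v in E^0) q v]. Every vertex [u] of [D] has a path [T u] from
    [Q] to [u], so that [(T u)^* T u = q u]. The elements [a] for which all
    compressions [T u a (T w)^*] lie in the range of [phi] form a C*-algebra
    that contains the generators, and for [u] and [w] in [E^0] the compressions
    are the [q u a q w], whose sums converge to [Q a Q] ([compression_range],
    [corner_range]). The corner is full because every [q u] factors through
    [Q]. The imprimitivity bimodule is [Q C*(D)], with left inner product
    [phi^-1 (x y^* )].

    The matrices over a C*-algebra [A] act on the Hilbert module of square
    summable sequences over the multiplier algebra of [A]; the multiplier
    algebra is itself the algebra of adjointable operators of the Hilbert
    module [A]. Both rest on one construction of a C*-algebra of adjointable
    operators. The Cauchy-Schwarz inequality for sequences, the absorption of
    smaller projections, the contractivity of homomorphisms and the positivity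
    of the left inner product need the elementary theory of positive elements.
    It is developed without spectra: [x] is positive when [|t - x| <= t] for
    some [t >= 0], and square roots come from the iteration
    [f |-> (u + f ^ 2) / 2] ([pos_sqrt]). The positivity of [z^* z] is
    [pos_star_mul]. *)

Set Implicit Arguments.
Unset Strict Implicit.
Unset Printing Implicit Defensive.
Import Order.TTheory GRing.Theory Num.Theory.
Import numFieldNormedType.Exports.
Local Open Scope classical_set_scope.
Local Open Scope ring_scope.
Local Open Scope cstar_scope.

Local Notation "r %:C" := (real_complex _ r) : ring_scope.

(** * Real-valued norms and sequential limits *)

Section Modulus.
Context {R : realType}.
Implicit Types (a : R[i]) (r : R).

(** The modulus as an element of [R]: the norm of [R[i]] takes its values in
    the nonnegative reals of [R[i]], while estimates are carried out in [R],
    which is totally ordered. *)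
Definition mag a : R := complex.Re `|a|.

Lemma magE a : `|a| = (mag a)%:C.
Proof. by rewrite /mag RRe_real // normr_real. Qed.

Lemma mag_ge0 a : 0 <= mag a.
Proof. by rewrite -lecR -magE normr_ge0. Qed.

Lemma mag0 : mag 0 = 0 :> R. Proof. by rewrite /mag normr0. Qed.

Lemma magN1 : mag (-1) = 1 :> R. Proof. by rewrite /mag normrN normr1. Qed.

Lemma mag_real r : mag r%:C = `|r|.
Proof. by rewrite /mag normc_def /= expr0n addr0 sqrtr_sqr. Qed.

Lemma mag_gt0 a : a != 0 -> 0 < mag a.
Proof. by rewrite -ltcR -magE normr_gt0. Qed.

End Modulus.

Section RealNorm.
Context {R : realType} {V : normedModType R[i]}.
Implicit Types (x y : V) (u v : nat -> V) (r e : R).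

Definition nrm x : R := complex.Re `|x|.

Lemma nrmE x : `|x| = (nrm x)%:C.
Proof. by rewrite /nrm RRe_real // normr_real. Qed.

Lemma nrm_ge0 x : 0 <= nrm x.
Proof. by rewrite -ler0c -nrmE. Qed.
Hint Resolve nrm_ge0 : core.

Lemma nrm0 : nrm 0 = 0.
Proof. by rewrite /nrm normr0. Qed.

Lemma nrm_eq0 x : nrm x = 0 -> x = 0.
Proof. by move=> x0; apply/normr0_eq0; rewrite nrmE x0. Qed.

Lemma nrm_triangle x y : nrm (x + y) <= nrm x + nrm y.
Proof. by rewrite -lecR rmorphD /= -!nrmE ler_normD. Qed.

Lemma nrmN x : nrm (- x) = nrm x.
Proof. by rewrite /nrm normrN. Qed.

Lemma nrmB x y : nrm (x - y) = nrm (y - x).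
Proof. by rewrite -nrmN opprB. Qed.

Lemma nrmZ (a : R[i]) x : nrm (a *: x) = mag a * nrm x.
Proof.
by apply: complexI; rewrite rmorphM /= -!nrmE -magE normrZ.
Qed.

Lemma nrmZr r x : nrm (r%:C *: x) = `|r| * nrm x.
Proof. by rewrite nrmZ mag_real. Qed.

Lemma nrm_split z x y : nrm (x - y) <= nrm (x - z) + nrm (z - y).
Proof.
by rewrite (le_trans _ (nrm_triangle _ _)) // addrA addrNK.
Qed.

Definition tends u x := forall e : R, 0 < e ->
  exists N, forall n, (N <= n)%N -> nrm (u n - x) <= e.

Definition is_cauchy u := forall e : R, 0 < e ->
  exists N, forall m n, (N <= m)%N -> (N <= n)%N -> nrm (u m - u n) <= e.

Lemma tends_cst x : tends (fun=> x) x.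
Proof. by move=> e e0; exists 0%N => n _; rewrite subrr nrm0 ltW. Qed.

Lemma tends_ev u x N : (forall n, (N <= n)%N -> u n = x) -> tends u x.
Proof.
by move=> h e e0; exists N => n /h ->; rewrite subrr nrm0 ltW.
Qed.

Lemma tends_ext u v x : (forall n, u n = v n) -> tends u x -> tends v x.
Proof. by move=> /funext ->. Qed.

Lemma tends_cauchy u x : tends u x -> is_cauchy u.
Proof.
move=> ux e e0; have [N hN] := ux (e / 2) ltac:(lra).
exists N => m n /hN hm /hN hn; rewrite (le_trans (nrm_split x _ _)) //.
by rewrite (nrmB x); lra.
Qed.

Lemma tendsD u v x y : tends u x -> tends v y -> tends (fun n => u n + v n) (x + y).
Proof.
move=> ux vy e e0.
have [N hN] := ux (e / 2) ltac:(lra); have [M hM] := vy (e / 2) ltac:(lra).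
exists (maxn N M) => n; rewrite geq_max => /andP[/hN ? /hM ?].
by rewrite opprD addrACA (le_trans (nrm_triangle _ _)) //; lra.
Qed.

Lemma tendsZ (a : R[i]) u x : tends u x -> tends (fun n => a *: u n) (a *: x).
Proof.
move=> ux e e0; have a0 := mag_ge0 a.
have [N hN] := ux (e / (mag a + 1)) ltac:(apply: divr_gt0 => //; lra).
exists N => n /hN hn; rewrite -scalerBr nrmZ.
have /(ler_wpM2l a0) := hn; move/le_trans; apply.
rewrite mulrCA ger_pMr //.
by rewrite ler_pdivrMr; lra.
Qed.

Lemma tendsN u x : tends u x -> tends (fun n => - u n) (- x).
Proof.
by move=> ux e /ux[N hN]; exists N => n /hN; rewrite -opprD nrmN.
Qed.

Lemma tendsB u v x y : tends u x -> tends v y -> tends (fun n => u n - v n) (x - y).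
Proof. by move=> ux /tendsN; exact: tendsD. Qed.

Lemma tends_sum (I : Type) (s : seq I) (F : I -> nat -> V) (G : I -> V) :
  (forall i, tends (F i) (G i)) ->
  tends (fun n => \sum_(i <- s) F i n) (\sum_(i <- s) G i).
Proof.
move=> FG; elim: s => [|i s IH].
  by rewrite big_nil; apply: (tends_ev (N := 0)) => n _; rewrite big_nil.
rewrite big_cons; apply: tends_ext (tendsD (FG i) IH) => n.
by rewrite big_cons.
Qed.

Lemma tends_le u x (c : R) N : tends u x ->
  (forall n, (N <= n)%N -> nrm (u n) <= c) -> nrm x <= c.
Proof.
move=> ux uc; apply/ler_addgt0Pr => e e0; have [M hM] := ux e e0.
have := uc (maxn N M) (leq_maxl _ _); have := hM (maxn N M) (leq_maxr _ _).
set w := u _ => h1 h2; rewrite -[x](subrK w) (le_trans (nrm_triangle _ _)) //.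
by rewrite nrmB; lra.
Qed.

Lemma tends_uniq u x y : tends u x -> tends u y -> x = y.
Proof.
move=> ux uy; apply/eqP; rewrite -subr_eq0; apply/eqP/nrm_eq0/eqP.
rewrite eq_le nrm_ge0 andbT; have h := tendsB ux uy.
by apply: (tends_le (N := 0) h) => n _; rewrite subrr nrm0.
Qed.

Lemma ball_nrm x y e : ball x e%:C y <-> nrm (x - y) < e.
Proof. by rewrite -ball_normE /ball_ /= nrmE ltcR. Qed.

Lemma pos_complex (e : R[i]) : 0 < e -> exists2 r : R, 0 < r & e = r%:C.
Proof.
move=> e0; exists (complex.Re e); last by rewrite RRe_real // gtr0_real.
by move: e0; rewrite ltcE /= => /andP[].
Qed.

Lemma closed_tends (S : set V) u x : closed S -> (forall n, S (u n)) ->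
  tends u x -> S x.
Proof.
move=> cS Su ux; apply: cS => B /nbhs_ballP[e /= /pos_complex[r r0 ->]] hB.
have [N hN] := ux (r / 2) ltac:(lra).
exists (u N); split=> //; apply: hB; apply/ball_nrm.
by rewrite nrmB; have := hN N (leqnn _); lra.
Qed.

(* The index [n] of an approximating sequence gives the precision [1/(n+1)]. *)
Lemma exists_inv_le (e : R) : 0 < e -> exists N, forall n, (N <= n)%N ->
  n.+1%:R^-1 <= e.
Proof.
move=> e0; have [N hN] := ltr_add_invr (y := 0) (x := e) ltac:(lra).
exists N => n Nn; apply: (le_trans (y := N.+1%:R^-1)); last first.
  by move: hN; rewrite add0r => /ltW.
by rewrite lef_pV2 ?posrE ?ltr0n // ler_nat.
Qed.

Lemma tends_closed (S : set V) :
  (forall u x, (forall n, S (u n)) -> tends u x -> S x) -> closed S.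
Proof.
move=> hS x hx.
have ex n : exists y, S y /\ nrm (x - y) < n.+1%:R^-1.
  have [|y [Sy /ball_nrm yx]] := hx (ball x (n.+1%:R^-1 : R)%:C).
    by apply: nbhsx_ballx; rewrite ltcR invr_gt0.
  by exists y.
have [u hu] := choice ex.
apply: (hS u) => [n|e e0]; first by case: (hu n).
have [N hN] := exists_inv_le e0.
exists N => n /hN; rewrite nrmB; apply: le_trans; apply: ltW.
by case: (hu n).
Qed.

End RealNorm.

Lemma cauchy_tends {R : realType} (V : completeNormedModType R[i])
  (u : nat -> V) : is_cauchy u -> exists x, tends u x.
Proof.
move=> cu; have : cauchy (u @ \oo).
  apply/cauchy_exP => e /pos_complex[r r0 ->].
  have [N hN] := cu (r / 2) ltac:(lra).
  exists (u N); exists N => //= n Nn; apply/ball_nrm.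
  by have := hN _ _ (leqnn N) Nn; lra.
move/cauchy_cvg => /cvg_ex[x ux]; exists x => e e0.
have [|N _ hN] := ux (ball x e%:C); first by apply: nbhsx_ballx; rewrite ltcR.
exists N => n Nn; rewrite nrmB ltW //; apply/ball_nrm; exact: hN.
Qed.

Section Lipschitz.
Context {R : realType} {V W : normedModType R[i]}.

Lemma tends_lip (f : V -> W) (c : R) u x :
  (forall x y, nrm (f x - f y) <= c * nrm (x - y)) ->
  tends u x -> tends (fun n => f (u n)) (f x).
Proof.
move=> fc ux e e0.
have c1 : 0 < `|c| + 1 by have := normr_ge0 c; lra.
have [N hN] := ux (e / (`|c| + 1)) ltac:(exact: divr_gt0).
exists N => n /hN hn; apply: (le_trans (fc _ _)).
apply: (@le_trans _ _ ((`|c| + 1) * nrm (u n - x))).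
  by apply: ler_wpM2r; [exact: nrm_ge0|have := ler_norm c; lra].
by rewrite mulrC -ler_pdivlMr.
Qed.

Lemma lip_continuous (f : V -> W) (c : R) :
  (forall x y, nrm (f x - f y) <= c * nrm (x - y)) -> continuous f.
Proof.
move=> fc x; apply/cvgrPdist_le => e /pos_complex[r r0 ->].
have c1 : 0 < `|c| + 1 by have := normr_ge0 c; lra.
have d0 : 0 < (r / (`|c| + 1))%:C :> R[i] by rewrite ltcR divr_gt0.
have := nbhsx_ballx x _ d0.
apply: filterS => y /ball_nrm hy; rewrite nrmE lecR.
apply: (le_trans (fc _ _)).
apply: (@le_trans _ _ ((`|c| + 1) * nrm (x - y))).
  by apply: ler_wpM2r; [exact: nrm_ge0|have := ler_norm c; lra].
by rewrite mulrC -ler_pdivlMr // ltW.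
Qed.

End Lipschitz.

(** * Banach spaces of vectors with a finite norm *)

(** A subspace [bs_set] of a complex vector space with a norm [bs_nrm] for
    which every Cauchy sequence converges. The spaces of adjointable operators
    and of square summable sequences, and the imprimitivity bimodule, are all
    presented in this way. *)
Record banach_subspace (R : realType) := BanachSubspace {
  bs_space : lmodType R[i];
  bs_set : set bs_space;
  bs_nrm : bs_space -> R;
  bs_set0 : bs_set 0;
  bs_setD : forall x y, bs_set x -> bs_set y -> bs_set (x + y);
  bs_setZ : forall (a : R[i]) x, bs_set x -> bs_set (a *: x);
  bs_nrmD : forall x y, bs_set x -> bs_set y ->
    bs_nrm (x + y) <= bs_nrm x + bs_nrm y;
  bs_nrmZ : forall (a : R[i]) x, bs_set x ->
    bs_nrm (a *: x) = mag a * bs_nrm x;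
  bs_nrm_eq0 : forall x, bs_set x -> bs_nrm x = 0 -> x = 0;
  bs_complete : forall u : nat -> bs_space, (forall n, bs_set (u n)) ->
    (forall e, 0 < e -> exists N, forall m n, (N <= m)%N -> (N <= n)%N ->
       bs_nrm (u m - u n) <= e) ->
    exists2 x, bs_set x & forall e, 0 < e -> exists N, forall n, (N <= n)%N ->
       bs_nrm (u n - x) <= e
}.

Section BanachSubspace.
Context {R : realType} (D : banach_subspace R).

Definition bs_pred : {pred bs_space D} := fun x => `[< bs_set x >].

Lemma bs_submod_closed : submod_closed bs_pred.
Proof.
split; first exact/asboolP/bs_set0.
move=> a x y /asboolP Sx /asboolP Sy; apply/asboolP.
by apply: bs_setD => //; apply: bs_setZ.
Qed.

HB.instance Definition _ := GRing.isSubmodClosed.Build _ _ bs_pred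
  bs_submod_closed.

Record banach := Banach { bval : bs_space D; bvalP : bval \in bs_pred }.
HB.instance Definition _ := [isSub for bval].
HB.instance Definition _ := [Choice of banach by <:].
HB.instance Definition _ := [SubChoice_isSubLmodule of banach by <:].

Lemma bset (x : banach) : bs_set (bval x).
Proof. exact/asboolP/(bvalP x). Qed.

Definition bmk x (Sx : bs_set x) : banach := Banach (asboolT Sx).

Lemma bvalZ (a : R[i]) (x : banach) : bval (a *: x) = a *: bval x.
Proof. by []. Qed.
Lemma bvalB (x y : banach) : bval (x - y) = bval x - bval y. Proof. by []. Qed.

Definition bnorm (x : banach) : R[i] := (bs_nrm (bval x))%:C.

Lemma bnormD x y : bnorm (x + y) <= bnorm x + bnorm y.
Proof. by rewrite /bnorm -rmorphD lecR bs_nrmD //; exact: bset. Qed.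

Lemma bnormZ (a : R[i]) x : bnorm (a *: x) = `|a| * bnorm x.
Proof.
rewrite /bnorm bvalZ bs_nrmZ; last exact: bset.
by rewrite rmorphM /= magE.
Qed.

Lemma bnorm_eq0 x : bnorm x = 0 -> x = 0.
Proof.
by move/complexI => x0; apply: val_inj; apply: bs_nrm_eq0 => //; exact: bset.
Qed.

HB.instance Definition _ := Lmodule_isNormed.Build R[i] banach
  bnormD bnormZ bnorm_eq0.

Lemma bnrmE (x : banach) : nrm x = bs_nrm (bval x).
Proof. by []. Qed.

(* A Cauchy filter is approximated by the centres of balls of radius
   [1/(n+1)] that belong to it. *)
Lemma banach_complete (F : set_system banach) :
  ProperFilter F -> cauchy F -> cvg F.
Proof.
move=> PF /cauchyP cF.
have ex n : exists x, F (ball x (n.+1%:R^-1 : R)%:C).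
  by apply: cF; rewrite ltcR invr_gt0.
have [u hu] := choice ex.
have close m n : nrm (u m - u n) <= m.+1%:R^-1 + n.+1%:R^-1.
  have [z [/ball_nrm h1 /ball_nrm h2]] := filter_ex (filterI (hu m) (hu n)).
  by apply: (le_trans (nrm_split z _ _)); rewrite (nrmB z) lerD // ltW.
have cu e : 0 < e -> exists N, forall m n, (N <= m)%N -> (N <= n)%N ->
    bs_nrm (bval (u m) - bval (u n)) <= e.
  move=> e0; have [N hN] := @exists_inv_le R (e / 2) ltac:(lra).
  exists N => m n /hN h1 /hN h2; have := close m n.
  by rewrite bnrmE bvalB => /le_trans; apply; rewrite (splitr e) lerD.
have [x Sx ux] := bs_complete (fun n => bset (u n)) cu.
apply/cvg_ex; exists (bmk Sx); apply/cvgrPdist_le => e /pos_complex[r r0 ->].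
have [N1 h1] := ux (r / 2) ltac:(lra).
have [N2 h2] := @exists_inv_le R (r / 2) ltac:(lra).
apply: filterS (hu (maxn N1 N2)) => y /ball_nrm hy.
rewrite nrmE lecR (le_trans (nrm_split (u (maxn N1 N2)) _ _)) //.
have k1 := h1 _ (leq_maxl N1 N2); have k2 := h2 _ (leq_maxr N1 N2).
rewrite (splitr r) lerD //; last by rewrite (le_trans (ltW hy)).
by rewrite nrmB bnrmE bvalB.
Qed.

HB.instance Definition _ := Uniform_isComplete.Build banach banach_complete.

End BanachSubspace.

(** * Elementary identities in C*-algebras *)

Section CStarBasics.
Context {R : realType} {A : cstarAlgType R}.
Implicit Types x y z : A.

Lemma amul0x x : 0 ⋅ x = 0.
Proof. by apply: (addrI (0 ⋅ x)); rewrite -amulDl !addr0. Qed.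

Lemma amulx0 x : x ⋅ 0 = 0.
Proof. by apply: (addrI (x ⋅ 0)); rewrite -amulDr !addr0. Qed.

Lemma amulNl x y : (- x) ⋅ y = - (x ⋅ y).
Proof. by apply/eqP; rewrite -addr_eq0 -amulDl addNr amul0x. Qed.

Lemma amulNr x y : x ⋅ (- y) = - (x ⋅ y).
Proof. by apply/eqP; rewrite -addr_eq0 -amulDr addNr amulx0. Qed.

Lemma amulBl x y z : (x - y) ⋅ z = x ⋅ z - y ⋅ z.
Proof. by rewrite amulDl amulNl. Qed.

Lemma amulBr x y z : x ⋅ (y - z) = x ⋅ y - x ⋅ z.
Proof. by rewrite amulDr amulNr. Qed.

Lemma astar0 : (0 : A)^☆ = 0.
Proof. by apply: (addrI (0^☆)); rewrite -astarD !addr0. Qed.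

Lemma astarN x : (- x)^☆ = - x^☆.
Proof. by apply/eqP; rewrite -addr_eq0 -astarD addNr astar0. Qed.

Lemma astarB x y : (x - y)^☆ = x^☆ - y^☆.
Proof. by rewrite astarD astarN. Qed.

Lemma astarZr (r : R) x : (r%:C *: x)^☆ = r%:C *: x^☆.
Proof. by rewrite astarZ conj_Creal // complex_real. Qed.

Lemma amul_sumr (I : Type) (s : seq I) (P : pred I) (F : I -> A) x :
  x ⋅ (\sum_(i <- s | P i) F i) = \sum_(i <- s | P i) x ⋅ F i.
Proof. by apply: (big_morph (amul x)); [exact: amulDr|exact: amulx0]. Qed.

Lemma amul_suml (I : Type) (s : seq I) (P : pred I) (F : I -> A) x :
  (\sum_(i <- s | P i) F i) ⋅ x = \sum_(i <- s | P i) F i ⋅ x.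
Proof.
apply: (big_morph (fun y => y ⋅ x)); last exact: amul0x.
by move=> y z; rewrite amulDl.
Qed.

Lemma astar_sum (I : Type) (s : seq I) (P : pred I) (F : I -> A) :
  (\sum_(i <- s | P i) F i)^☆ = \sum_(i <- s | P i) (F i)^☆.
Proof. by apply: (big_morph astar); [exact: astarD|exact: astar0]. Qed.

Lemma nrmM x y : nrm (x ⋅ y) <= nrm x * nrm y.
Proof. by rewrite -lecR rmorphM /= -!nrmE ler_norm_amul. Qed.

Lemma nrmCC x : nrm (x^☆ ⋅ x) = nrm x ^+ 2.
Proof. by apply: complexI; rewrite -nrmE norm_astar_amul nrmE -rmorphXn. Qed.

Lemma nrm_astar x : nrm (x^☆) = nrm x.
Proof.
have le y : nrm y <= nrm (y^☆).
  have [->|y0] := eqVneq y 0; first by rewrite astar0.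
  have n0 : 0 < nrm y.
    by rewrite lt_neqAle nrm_ge0 eq_sym andbT; apply: contra_neq y0 => /nrm_eq0.
  by rewrite -(ler_pM2r n0) -expr2 -nrmCC nrmM.
by apply/eqP; rewrite eq_le le andbT -{2}(astarK x) le.
Qed.

Lemma nrmCCr x : nrm (x ⋅ x^☆) = nrm x ^+ 2.
Proof. by rewrite -{1}(astarK x) nrmCC nrm_astar. Qed.

Lemma nrm_sa x : x^☆ = x -> nrm (x ⋅ x) = nrm x ^+ 2.
Proof. by move=> xs; rewrite -nrmCC xs. Qed.

Lemma astar_mul_eq0 x : x^☆ ⋅ x = 0 -> x = 0.
Proof.
move=> h; apply: nrm_eq0; apply/eqP; rewrite -sqrf_eq0 -nrmCC h.
by rewrite nrm0.
Qed.

Lemma nrm_mulB_l x y z : nrm (x ⋅ y - x ⋅ z) <= nrm x * nrm (y - z).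
Proof. by rewrite -amulBr nrmM. Qed.

Lemma nrm_mulB_r x y z : nrm (y ⋅ x - z ⋅ x) <= nrm x * nrm (y - z).
Proof. by rewrite -amulBl mulrC nrmM. Qed.

Lemma tendsMl x u y : tends u y -> tends (fun n => x ⋅ u n) (x ⋅ y).
Proof. exact: tends_lip (nrm_mulB_l x). Qed.

Lemma tendsMr x u y : tends u y -> tends (fun n => u n ⋅ x) (y ⋅ x).
Proof. exact: (tends_lip (f := fun y => y ⋅ x) (nrm_mulB_r x)). Qed.

Lemma tends_astar u x : tends u x -> tends (fun n => (u n)^☆) (x^☆).
Proof.
by apply: (tends_lip (c := 1)) => y z; rewrite -astarB nrm_astar mul1r.
Qed.

Lemma tendsM u v x y : tends u x -> tends v y ->
  tends (fun n => u n ⋅ v n) (x ⋅ y).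
Proof.
move=> ux vy d d0; set c := nrm x + nrm y + 1.
have c0 : 0 < c by rewrite /c; have := nrm_ge0 x; have := nrm_ge0 y; lra.
have [N1 h1] := vy 1 ltr01.
have [N2 h2] := ux (d / 2 / c) ltac:(by rewrite !divr_gt0).
have [N3 h3] := vy (d / 2 / c) ltac:(by rewrite !divr_gt0).
exists (maxn N1 (maxn N2 N3)) => n.
rewrite !geq_max => /and3P[/h1 k1 /h2 k2 /h3 k3].
rewrite -(subrK (x ⋅ v n) (u n ⋅ v n)) -addrA -amulBl -amulBr.
apply: (le_trans (nrm_triangle _ _)); rewrite [leRHS]splitr.
have vn : nrm (v n) <= c.
  by have := nrm_triangle (v n - y) y; rewrite subrK /c; have := nrm_ge0 x; lra.
have cn0 : c != 0 by rewrite gt_eqF.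
have xc : nrm x <= c by rewrite /c; have := nrm_ge0 y; lra.
rewrite lerD // (le_trans (nrmM _ _)) //.
  rewrite -[leRHS](divfK cn0).
  by apply: ler_pM => //; exact: nrm_ge0.
rewrite mulrC -[leRHS](divfK cn0).
by apply: ler_pM => //; exact: nrm_ge0.
Qed.

End CStarBasics.

(** * Linear identities in modules *)

(** Identities between linear combinations are decided by comparing the
    coefficient of each atom; in a C*-algebra the atoms are the monomials that
    remain once the products are expanded. *)
Section LinearExpressions.
Context {K : pzRingType} {V : lmodType K}.

Inductive lexp := LZero | LAtom of nat | LAdd of lexp & lexp | LOpp of lexp
  | LScale of K & lexp.

Fixpoint leval (env : seq V) (x : lexp) : V :=
  match x with
  | LZero => 0
  | LAtom n => nth 0 env n
  | LAdd x y => leval env x + leval env y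
  | LOpp x => - leval env x
  | LScale a x => a *: leval env x
  end.

Fixpoint lcoef (x : lexp) (i : nat) : K :=
  match x with
  | LZero => 0
  | LAtom n => if eqn n i then 1 else 0
  | LAdd x y => lcoef x i + lcoef y i
  | LOpp x => - lcoef x i
  | LScale a x => a * lcoef x i
  end.

Fixpoint forall_below n (P : nat -> Prop) :=
  if n is m.+1 then P m /\ forall_below m P else True.

Lemma lcoef_atom n i : lcoef (LAtom n) i = (n == i)%:R.
Proof. by rewrite /lcoef eqnE; case: eqP. Qed.

Lemma levalE env x :
  leval env x = \sum_(i < size env) lcoef x i *: nth 0 env i.
Proof.
elim: x => [|n|x IHx y IHy|x IH|a x IH]; rewrite ?[leval _ _]/=.
- by rewrite big1 // => i _; rewrite scale0r.
- have [n_lt|n_ge] := ltnP n (size env).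
    rewrite (bigD1 (Ordinal n_lt)) // lcoef_atom eqxx scale1r.
    rewrite big1 => [|i ni]; first by rewrite /= addr0.
    rewrite lcoef_atom; case: eqP => [nE|_]; last exact: scale0r.
    by case/eqP: ni; apply: val_inj.
  rewrite nth_default // big1 // => i _; rewrite lcoef_atom.
  case: eqP => [nE|_]; last exact: scale0r.
  by move: (ltn_ord i); rewrite -nE ltnNge n_ge.
- by rewrite IHx IHy -big_split; apply: eq_bigr => i _; rewrite scalerDl.
- by rewrite IH -sumrN; apply: eq_bigr => i _; rewrite scaleNr.
- by rewrite IH scaler_sumr; apply: eq_bigr => i _; rewrite scalerA.
Qed.

Lemma leval_eq env x y :
  forall_below (size env) (fun i => lcoef x i = lcoef y i) ->
  leval env x = leval env y.
Proof.
rewrite !levalE => h; apply: eq_bigr => i _; congr (_ *: _).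
have := ltn_ord i; move: (val i) => {i} i; elim: (size env) h => // n IH [hn h].
by rewrite ltnS leq_eqVlt => /predU1P[->//|/IH]; exact.
Qed.

End LinearExpressions.

(* Reification: [lenv] collects the atoms, [lquote] rebuilds the expression. *)
Ltac lindex x env :=
  lazymatch env with
  | ?y :: ?env' =>
    match constr:(Set) with
    | _ => let _ := match constr:(Set) with _ => unify x y end in constr:(0%N)
    | _ => let n := lindex x env' in constr:(S n)
    end
  end.

Ltac lenv x env :=
  lazymatch x with
  | @Algebra.add _ ?a ?b => let env := lenv a env in lenv b env
  | @Algebra.opp _ ?a => lenv a env
  | @GRing.scale _ _ _ ?a => lenv a env
  | @Algebra.zero _ => constr:(env)
  | _ => match constr:(Set) with
         | _ => let _ := lindex x env in constr:(env)
         | _ => constr:(x :: env)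
         end
  end.

Ltac lquote K x env :=
  lazymatch x with
  | @Algebra.add _ ?a ?b =>
    let a := lquote K a env in let b := lquote K b env in
    constr:(@LAdd K a b)
  | @Algebra.opp _ ?a => let a := lquote K a env in constr:(@LOpp K a)
  | @GRing.scale _ _ ?c ?a => let a := lquote K a env in constr:(@LScale K c a)
  | @Algebra.zero _ => constr:(@LZero K)
  | _ => let n := lindex x env in constr:(@LAtom K n)
  end.

Ltac linear_eq :=
  match goal with
  | R : Real.type |- @eq ?T ?x ?y =>
    let K := constr:(GRing.PzRing.clone R[i] _) in
    let env := lenv x (@nil T) in let env := lenv y env in
    let qx := lquote K x env in let qy := lquote K y env in
    refine (@leval_eq K _ env qx qy _);
    cbv [forall_below lcoef size eqn]; repeat split
  end.

(* The products are expanded before the coefficients are compared. *)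
Ltac cstar_expand :=
  rewrite ?(amulDl, amulDr, amulBl, amulBr, amulNl, amulNr, amulZl, amulZr,
    amulA, astarD, astarB, astarN, astarM, astarK, astarZr).

Ltac cstar_eq := cstar_expand; linear_eq; first [by ring | by field].

(** * Hilbert modules and the C*-algebra of adjointable operators *)

(** The Cauchy-Schwarz inequality is part of the structure: it is what yields the
    C*-identity for operators, and its proof depends on the module. *)
Record hilbert (R : realType) (A : cstarAlgType R) := Hilbert {
  hspace :> completeNormedModType R[i];
  hip : hspace -> hspace -> A;
  hipD : forall x y z, hip x (y + z) = hip x y + hip x z;
  hipZ : forall (a : R[i]) x y, hip x (a *: y) = a *: hip x y;
  hipC : forall x y, (hip x y)^☆ = hip y x;
  hip_nrm : forall x, nrm (hip x x) = nrm x ^+ 2;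
  hip_cs : forall x y, nrm (hip x y) <= nrm x * nrm y
}.

Section Adjointable.
Context {R : realType} {A : cstarAlgType R} (H : hilbert A).
Implicit Types (x y z : H) (f g h : H -> H) (c : R).

Lemma hipDl x y z : hip (x + y) z = hip x z + hip y z.
Proof. by rewrite -hipC hipD astarD !hipC. Qed.

Lemma hipZl (a : R[i]) x y : hip (a *: x) y = a^* *: hip x y.
Proof. by rewrite -hipC hipZ astarZ hipC. Qed.

Lemma hipBl x y z : hip (x - y) z = hip x z - hip y z.
Proof.
by rewrite hipDl -scaleN1r hipZl [(-1)^*](_ : _ = -1) ?scaleN1r ?rmorphN ?rmorph1.
Qed.

Lemma hipBr x y z : hip x (y - z) = hip x y - hip x z.
Proof. by rewrite hipD -scaleN1r hipZ scaleN1r. Qed.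

Lemma hip_inj x y : (forall z, hip x z = hip y z) -> x = y.
Proof.
move=> h; apply/eqP; rewrite -subr_eq0; apply/eqP/nrm_eq0/eqP.
by rewrite -sqrf_eq0 -hip_nrm hipBl h subrr nrm0.
Qed.

Lemma hip_injr x y : (forall z, hip z x = hip z y) -> x = y.
Proof. by move=> h; apply: hip_inj => z; rewrite -hipC h hipC. Qed.

Definition adjoint f g := forall x y, hip (f x) y = hip x (g y).

Definition opbound f c := 0 <= c /\ forall x, nrm (f x) <= c * nrm x.

Definition adjointable f := (exists g, adjoint f g) /\ exists c, opbound f c.

Definition opnrm f : R := inf [set c | opbound f c].

Lemma adjoint_sym f g : adjoint f g -> adjoint g f.
Proof. by move=> fg x y; rewrite -hipC -fg hipC. Qed.

Lemma adjoint_linear f g (a : R[i]) x y : adjoint f g ->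
  f (a *: x + y) = a *: f x + f y.
Proof.
move=> fg; apply: hip_inj => z.
by rewrite fg !hipDl !hipZl !fg.
Qed.

Lemma opnrm_le f c : opbound f c -> opnrm f <= c.
Proof. by move=> fc; apply: ge_inf => //; exists 0 => d []. Qed.

Lemma opnrm_bound f : (exists c, opbound f c) -> opbound f (opnrm f).
Proof.
move=> [c fc]; split; first by apply: lb_le_inf; [exists c|move=> d []].
move=> x; have [->|x0] := eqVneq x 0.
  by rewrite nrm0 mulr0; case: fc => _ /(_ 0); rewrite nrm0 mulr0.
have n0 : 0 < nrm x.
  by rewrite lt_neqAle nrm_ge0 eq_sym andbT; apply: contra_neq x0 => /nrm_eq0.
rewrite -ler_pdivrMr //; apply: lb_le_inf; first by exists c.
by move=> d [_ fd]; rewrite ler_pdivrMr.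
Qed.

Lemma adjoint_bound f g c : adjoint f g -> opbound f c -> opbound g c.
Proof.
move=> fg [c0 fc]; split=> // y.
have [->|y0] := eqVneq (nrm (g y)) 0; first by rewrite mulr_ge0 ?nrm_ge0.
have n0 : 0 < nrm (g y) by rewrite lt_neqAle nrm_ge0 eq_sym y0.
rewrite -(ler_pM2r n0) -expr2 -hip_nrm -fg.
apply: (le_trans (hip_cs _ _)); rewrite mulrAC.
by apply: ler_wpM2r; rewrite ?nrm_ge0.
Qed.

Lemma adjoint_nrm f g : adjoint f g -> opnrm f = opnrm g.
Proof.
move=> fg; congr inf; apply/seteqP; split=> c /=; first exact: adjoint_bound.
exact/adjoint_bound/adjoint_sym.
Qed.

Lemma adjoint_comp f f' g g' : adjoint f f' -> adjoint g g' ->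
  adjoint (f \o g) (g' \o f').
Proof. by move=> ff gg x y /=; rewrite ff gg. Qed.

Lemma opbound_comp f g c d : opbound f c -> opbound g d ->
  opbound (f \o g) (c * d).
Proof.
move=> [c0 fc] [d0 gd]; split; first exact: mulr_ge0.
by move=> x /=; rewrite (le_trans (fc _)) // -mulrA ler_wpM2l.
Qed.

Lemma opboundD f g c d : opbound f c -> opbound g d -> opbound (f + g) (c + d).
Proof.
move=> [c0 fc] [d0 gd]; split; first exact: addr_ge0.
by move=> x /=; rewrite (le_trans (nrm_triangle _ _)) // mulrDl lerD.
Qed.

Lemma opboundZ (a : R[i]) f c : opbound f c ->
  opbound (a *: f) (mag a * c).
Proof.
have a0 := mag_ge0 a.
move=> [c0 fc]; split; first exact: mulr_ge0.
by move=> x /=; rewrite nrmZ -mulrA ler_wpM2l.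
Qed.

Lemma adjoint0 : adjoint 0 0.
Proof.
move=> x y; rewrite -[0 x]/(0 : H) -[0 y]/(0 : H).
have -> : (0 : H) = 0 *: (0 : H) by rewrite scale0r.
by rewrite hipZ hipZl rmorph0 !scale0r.
Qed.

Lemma adjointableD f g : adjointable f -> adjointable g -> adjointable (f + g).
Proof.
move=> [[f' ff] [c fc]] [[g' gg] [d gd]]; split; last first.
  by exists (c + d); apply: opboundD.
by exists (f' + g') => x y; rewrite hipDl hipD ff gg.
Qed.

Lemma adjointableZ (a : R[i]) f : adjointable f -> adjointable (a *: f).
Proof.
move=> [[f' ff] [c fc]]; split; last first.
  by exists (mag a * c); apply: opboundZ.
by exists (a^* *: f') => x y; rewrite hipZl hipZ ff.
Qed.

Lemma adjointable0 : adjointable 0.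
Proof.
split; first by exists 0; exact: adjoint0.
by exists 0; split=> // x; rewrite nrm0 mul0r.
Qed.

Lemma opnrmD f g : adjointable f -> adjointable g ->
  opnrm (f + g) <= opnrm f + opnrm g.
Proof.
by move=> [_ fb] [_ gb]; apply: opnrm_le; apply: opboundD; exact: opnrm_bound.
Qed.

Lemma opnrmZ (a : R[i]) f : adjointable f ->
  opnrm (a *: f) = mag a * opnrm f.
Proof.
move=> [_ fb]; apply/eqP; rewrite eq_le (opnrm_le (opboundZ a (opnrm_bound fb))) /=.
have [->|a0] := eqVneq a 0.
  rewrite mag0 mul0r; apply: lb_le_inf => [|c []//].
  by exists 0; split=> // x; rewrite /= scale0r nrm0 mul0r.
have n0 := mag_gt0 a0.
rewrite mulrC -ler_pdivlMr //; apply: opnrm_le.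
have [c0 ac] : opbound (a *: f) (opnrm (a *: f)).
  by apply: opnrm_bound; case: fb => c fc; exists (mag a * c); exact: opboundZ.
split=> [|x]; first by rewrite divr_ge0 // ltW.
rewrite mulrAC ler_pdivlMr // mulrC -nrmZ; exact: ac.
Qed.

Lemma opnrm_eq0 f : adjointable f -> opnrm f = 0 -> f = 0.
Proof.
move=> [_ /opnrm_bound[_ fb]] f0; apply/funext => x; apply: nrm_eq0.
by apply/eqP; rewrite eq_le nrm_ge0 andbT (le_trans (fb x)) // f0 mul0r.
Qed.

(* Both a Cauchy sequence of operators and the sequence of its adjoints
   converge pointwise, because an operator and its adjoint have equal norms. *)
Lemma op_complete (u : nat -> (H -> H)) : (forall n, adjointable (u n)) ->
  (forall e : R, 0 < e -> exists N, forall m n, (N <= m)%N -> (N <= n)%N ->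
     opnrm (u m - u n) <= e) ->
  exists2 f, adjointable f & forall e : R, 0 < e ->
    exists N, forall n, (N <= n)%N -> opnrm (u n - f) <= e.
Proof.
move=> au cu.
have [v uv] := choice (fun n => (au n).1).
have adjB m n : adjoint (u m - u n) (v m - v n).
  by move=> x y; rewrite hipBl hipBr !uv.
have bndB m n : exists c, opbound (u m - u n) c.
  have [_ [c hc]] := au m; have [_ [d hd]] := au n.
  exists (c + d); rewrite -scaleN1r; apply: opboundD => //.
  have := opboundZ (-1) hd; by rewrite magN1 mul1r.
have ptw (w : nat -> H -> H) : (forall e : R, 0 < e -> exists N, forall m n,
    (N <= m)%N -> (N <= n)%N -> opbound (w m - w n) e) ->
    exists f, forall x, tends (w ^~ x) (f x).
  move=> hw; suff ex x : exists y, tends (w ^~ x) y by have [f hf] := choice ex; exists f.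
  apply: cauchy_tends => e e0.
  have n0 : 0 < nrm x + 1 by have := nrm_ge0 x; lra.
  have [N hN] := hw (e / (nrm x + 1)) ltac:(exact: divr_gt0).
  exists N => m n Nm Nn; have [c0 /(_ x)] := hN m n Nm Nn.
  move/le_trans; apply; rewrite mulrAC ler_pdivrMr //.
  by apply: ler_wpM2l; [exact: ltW|lra].
have hu e : 0 < e -> exists N, forall m n, (N <= m)%N -> (N <= n)%N ->
    opbound (u m - u n) e.
  move=> e0; have [N hN] := cu e e0; exists N => m n Nm Nn.
  have [_ ub] := opnrm_bound (bndB m n); split; first exact: ltW.
  move=> x; apply: (le_trans (ub x)); apply: ler_wpM2r; first exact: nrm_ge0.
  exact: hN.
have [f hf] := ptw u hu.
have [g hg] : exists g, forall x, tends (v ^~ x) (g x).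
  apply: ptw => e e0; have [N hN] := hu e e0; exists N => m n Nm Nn.
  by apply: (adjoint_bound (adjB m n)); exact: hN.
have limf e : 0 < e -> exists N, forall n, (N <= n)%N -> opbound (u n - f) e.
  move=> e0; have [N hN] := hu e e0; exists N => n Nn; split; first exact: ltW.
  move=> x; apply: (tends_le (N := N) (tendsB (tends_cst (u n x)) (hf x))).
  by move=> m Nm; apply: (hN n m Nn Nm).2.
exists f; last first.
  by move=> e /limf[N hN]; exists N => n /hN; exact: opnrm_le.
split.
  exists g => x y.
  apply: (tends_uniq (u := fun n => hip (u n x) y)).
    refine (tends_lip (f := fun z : H => hip z y) (c := nrm y) (u := u^~ x) _ (hf x)) => a b.
    by rewrite -hipBl mulrC hip_cs.
  apply: (tends_ext (fun n => esym (uv n x y))).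
  refine (tends_lip (f := hip x) (c := nrm x) (u := v^~ y) _ (hg y)) => a b.
  by rewrite -hipBr hip_cs.
have [N hN] := limf 1 ltr01.
have [_ [c uc]] := au N; exists (c + 1).
have -> : f = u N - (u N - f) by rewrite opprB addrC subrK.
rewrite -scaleN1r; apply: opboundD => //.
have := opboundZ (-1) (hN N (leqnn _)); by rewrite magN1 mul1r.
Qed.

Definition op_data : banach_subspace R :=
  BanachSubspace adjointable0 adjointableD adjointableZ opnrmD opnrmZ opnrm_eq0
    op_complete.

Definition adjop : Type := banach op_data.
HB.instance Definition _ := CompleteNormedModule.copy adjop (banach op_data).

End Adjointable.

Section AdjointableCStar.
Context {R : realType} {A : cstarAlgType R} (H : hilbert A).
Local Notation L := (adjop H).
Implicit Types (S T U : L) (x y : H).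

Definition opval T : H -> H := bval T.

Lemma opvalP T : adjointable (opval T). Proof. exact: (bset (D := op_data H)). Qed.

Definition mkop (f : H -> H) (Sf : adjointable f) : L := bmk (D := op_data H) Sf.

Lemma opval_inj S T : opval S =1 opval T -> S = T.
Proof. by move=> /funext h; exact: val_inj. Qed.

Lemma opvalD S T x : opval (S + T) x = opval S x + opval T x. Proof. by []. Qed.
Lemma opvalZ (a : R[i]) T x : opval (a *: T) x = a *: opval T x. Proof. by []. Qed.

Lemma op_nrmP T x : nrm (opval T x) <= nrm T * nrm x.
Proof. by have [_ /opnrm_bound[_]] := opvalP T; exact. Qed.

Lemma op_nrm_le T c : 0 <= c -> (forall x, nrm (opval T x) <= c * nrm x) ->
  nrm T <= c.
Proof. by move=> c0 h; apply: opnrm_le. Qed.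

Lemma opmul_subproof S T : adjointable (opval S \o opval T).
Proof.
have [[s ss] [c sc]] := opvalP S; have [[t tt] [d td]] := opvalP T.
split; first by exists (t \o s); exact: adjoint_comp.
by exists (c * d); exact: opbound_comp.
Qed.

Definition opmul S T : L := mkop (opmul_subproof S T).

Definition opadj T : H -> H := sval (cid (opvalP T).1).

Lemma opadjP T : adjoint (opval T) (opadj T).
Proof. exact: svalP (cid (opvalP T).1). Qed.

Lemma opstar_subproof T : adjointable (opadj T).
Proof.
split; first by exists (opval T); apply: adjoint_sym; exact: opadjP.
have [_ [c tc]] := opvalP T.
by exists c; apply: (adjoint_bound (opadjP T)).
Qed.

Definition opstar T : L := mkop (opstar_subproof T).

Lemma opstarP T x y : hip (opval T x) y = hip x (opval (opstar T) y).
Proof. exact: opadjP. Qed.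

Lemma opstar_eq S T : (forall x y, hip (opval T x) y = hip x (opval S y)) ->
  opstar T = S.
Proof.
move=> h; apply: opval_inj => y; apply: hip_injr => x.
by rewrite -opstarP h.
Qed.

Lemma op_linear T (a : R[i]) x y :
  opval T (a *: x + y) = a *: opval T x + opval T y.
Proof. exact: (adjoint_linear _ _ _ (opadjP T)). Qed.

Lemma opD T x y : opval T (x + y) = opval T x + opval T y.
Proof. by have := op_linear T 1 x y; rewrite !scale1r. Qed.

Lemma op0 T : opval T 0 = 0.
Proof. by apply: (addrI (opval T 0)); rewrite -opD !addr0. Qed.

Lemma opZ T (a : R[i]) x : opval T (a *: x) = a *: opval T x.
Proof. by have := op_linear T a x 0; rewrite !addr0 op0 addr0. Qed.

Lemma opmulA : associative opmul. Proof. by move=> S T U; exact: opval_inj. Qed.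
Lemma opmulDl : left_distributive opmul +%R.
Proof. by move=> S T U; exact: opval_inj. Qed.
Lemma opmulDr : right_distributive opmul +%R.
Proof. by move=> S T U; apply: opval_inj => x; rewrite /= opD. Qed.
Lemma opmulZl (a : R[i]) S T : opmul (a *: S) T = a *: opmul S T.
Proof. exact: opval_inj. Qed.
Lemma opmulZr (a : R[i]) S T : opmul S (a *: T) = a *: opmul S T.
Proof. by apply: opval_inj => x; rewrite /= opZ. Qed.

Lemma opstarK : involutive opstar.
Proof. by move=> T; apply: opstar_eq => x y; rewrite -hipC -opstarP hipC. Qed.
Lemma opstarD : {morph opstar : S T / S + T}.
Proof.
by move=> S T; apply: opstar_eq => x y; rewrite !opvalD hipDl hipD !opstarP.
Qed.
Lemma opstarZ (a : R[i]) T : opstar (a *: T) = a^* *: opstar T.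
Proof.
by apply: opstar_eq => x y; rewrite !opvalZ hipZl hipZ !opstarP.
Qed.
Lemma opstarM S T : opstar (opmul S T) = opmul (opstar T) (opstar S).
Proof. by apply: opstar_eq => x y; rewrite /= !opstarP. Qed.

Lemma nrm_opmul S T : nrm (opmul S T) <= nrm S * nrm T.
Proof.
apply: op_nrm_le => [|x]; first by rewrite mulr_ge0 ?nrm_ge0.
rewrite (le_trans (op_nrmP S _)) // -mulrA ler_wpM2l ?nrm_ge0 //.
exact: op_nrmP.
Qed.

Lemma nrm_opstar T : nrm (opstar T) = nrm T.
Proof. exact/esym/(adjoint_nrm (opadjP T)). Qed.

(* The inequality is the Cauchy-Schwarz inequality for [x] and [T^* T x]. *)
Lemma nrm_op_CC T : nrm (opmul (opstar T) T) = nrm T ^+ 2.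
Proof.
apply/eqP; rewrite eq_le (le_trans (nrm_opmul _ _)) ?nrm_opstar ?expr2 //=.
rewrite -expr2 -[leRHS]sqr_sqrtr ?nrm_ge0 //.
rewrite ler_sqr ?nnegrE ?sqrtr_ge0 ?nrm_ge0 //.
apply: op_nrm_le => [|x]; first exact: sqrtr_ge0.
rewrite -ler_sqr ?nnegrE ?mulr_ge0 ?sqrtr_ge0 ?nrm_ge0 //.
rewrite exprMn sqr_sqrtr ?nrm_ge0 // -hip_nrm opstarP.
apply: (le_trans (hip_cs _ _)); rewrite mulrC expr2 mulrA ler_wpM2r ?nrm_ge0 //.
exact: (op_nrmP (opmul (opstar T) T)).
Qed.

Lemma ler_norm_opmul S T : `|opmul S T| <= `|S| * `|T|.
Proof. by rewrite !nrmE -rmorphM lecR nrm_opmul. Qed.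

Lemma norm_op_CC T : `|opmul (opstar T) T| = `|T| ^+ 2.
Proof. by rewrite !nrmE nrm_op_CC rmorphXn. Qed.

HB.instance Definition _ := CompleteNormedModule_isCStarAlgebra.Build R L
  opmulA opmulDl opmulDr opmulZl opmulZr opstarK opstarD opstarZ opstarM
  ler_norm_opmul norm_op_CC.

Lemma opid_subproof : adjointable (@id H).
Proof. by split; [exists id|exists 1; split=> // x; rewrite mul1r]. Qed.

Definition opid : L := mkop opid_subproof.

End AdjointableCStar.

(** * Square roots *)

Section SquareRootIteration.
Context {R : realType}.

(** The iteration for [1 - sqrt (1 - u)], which is the solution [f] of
    [2 f = u + f ^ 2] in the unit ball. The scalar iterates for [u = 1]
    increase to [1] and dominate the iterates of every [u] of norm at most
    [1]. *)
Fixpoint sqrt_iter {A : cstarAlgType R} (u : A) n : A :=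
  if n is m.+1 then (2^-1 : R)%:C *: (u + sqrt_iter u m ⋅ sqrt_iter u m) else 0.

Fixpoint sqrt_maj n : R := if n is m.+1 then (1 + sqrt_maj m ^+ 2) / 2 else 0.

Lemma sqrt_majS n : sqrt_maj n.+1 = (1 + sqrt_maj n ^+ 2) / 2.
Proof. by []. Qed.

Lemma sqrt_maj_bounds n : 0 <= sqrt_maj n <= 1.
Proof. by elim: n => [|n /andP[h0 h1]] /=; apply/andP; split; nra. Qed.

(* With [d = 1 - sqrt_maj n], the next difference is [d - d ^ 2 / 2]. *)
Lemma sqrt_maj_rate n : (1 - sqrt_maj n) * n.+1%:R <= 2.
Proof.
elim: n => [|n IH]; first by rewrite /=; lra.
have /andP[h0 h1] := sqrt_maj_bounds n.
rewrite sqrt_majS -(natr1 n.+1); move: IH h0 h1.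
move: (sqrt_maj n) (n.+1%:R) => g k IH h0 h1.
have -> : (1 - (1 + g ^+ 2) / 2) * (k + 1) =
  2 - ((1 + g) * (1 - (1 - g) * k / 2) + (1 - g) ^+ 2 / 2) by field.
rewrite gerBl addr_ge0 //; last by rewrite divr_ge0 // sqr_ge0.
by apply: mulr_ge0; lra.
Qed.

Lemma sqrt_maj_lim (e : R) : 0 < e ->
  exists N, forall n, (N <= n)%N -> 1 - sqrt_maj n <= e.
Proof.
move=> e0; have [N hN] := @exists_inv_le R (e / 2) ltac:(lra).
exists N => n /hN; have := sqrt_maj_rate n.
rewrite -ler_pdivlMr ?ltr0n // => h1 h2; apply: (le_trans h1).
by rewrite -ler_pdivlMl ?ltr0n // mulrC.
Qed.

Context {A : cstarAlgType R}.
Implicit Types u f x y : A.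

Lemma nrm_half x : nrm ((2^-1 : R)%:C *: x) = nrm x / 2.
Proof. by rewrite nrmZr ger0_norm ?invr_ge0 // mulrC. Qed.

Lemma sqrt_iter_bound u : nrm u <= 1 -> forall n,
  nrm (sqrt_iter u n) <= sqrt_maj n.
Proof.
move=> u1; elim=> [|n IH] /=; first by rewrite nrm0.
rewrite nrm_half ler_pM2r ?invr_gt0 // (le_trans (nrm_triangle _ _)) // lerD //.
by rewrite (le_trans (nrmM _ _)) // expr2 ler_pM ?nrm_ge0.
Qed.

(** The increments are differences of squares, hence bounded by those of the
    scalar iteration, which telescope. *)
Lemma sqrt_iter_step u : nrm u <= 1 -> forall n,
  nrm (sqrt_iter u n.+1 - sqrt_iter u n) <= sqrt_maj n.+1 - sqrt_maj n.
Proof.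
move=> u1; elim=> [|n IH].
  by rewrite /= subr0 amulx0 addr0 nrm_half; lra.
set w := sqrt_iter u; rewrite -/w in IH.
have -> : w n.+2 - w n.+1 = (2^-1 : R)%:C *: (w n.+1 ⋅ w n.+1 - w n ⋅ w n).
  by rewrite [w n.+2]/= {2}/w [sqrt_iter u n.+1]/= -scalerBr opprD addrACA subrr add0r.
rewrite nrm_half.
have b1 := sqrt_iter_bound u1 n.+1; have b0 := sqrt_iter_bound u1 n.
rewrite -/w in b0 b1; have -> : sqrt_maj n.+2 - sqrt_maj n.+1 =
  (sqrt_maj n.+1 + sqrt_maj n) * (sqrt_maj n.+1 - sqrt_maj n) / 2.
  by rewrite (sqrt_majS n.+1) [in - sqrt_maj _]sqrt_majS; field.
rewrite ler_pM2r ?invr_gt0 // -(subrK (w n ⋅ w n.+1) (w n.+1 ⋅ w n.+1)).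
rewrite -addrA -amulBl -amulBr (le_trans (nrm_triangle _ _)) //.
have := nrmM (w n.+1 - w n) (w n.+1); have := nrmM (w n) (w n.+1 - w n).
have := nrm_ge0 (w n.+1 - w n); have := nrm_ge0 (w n); have := nrm_ge0 (w n.+1).
nra.
Qed.

Lemma sqrt_iter_dist u : nrm u <= 1 -> forall n k,
  nrm (sqrt_iter u (n + k) - sqrt_iter u n) <= 1 - sqrt_maj n.
Proof.
move=> u1 n k; apply: (@le_trans _ _ (sqrt_maj (n + k) - sqrt_maj n)); last first.
  by have /andP[_] := sqrt_maj_bounds (n + k); lra.
elim: k => [|k IH]; first by rewrite addn0 !subrr nrm0.
rewrite addnS (le_trans (nrm_split (sqrt_iter u (n + k)) _ _)) //.
by have := sqrt_iter_step u1 (n + k); lra.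
Qed.

Lemma sqrt_iter_cvg u : nrm u <= 1 -> exists2 f,
  tends (sqrt_iter u) f & nrm f <= 1 /\ f + f = u + f ⋅ f.
Proof.
move=> u1; have [|f uf] := @cauchy_tends R A (sqrt_iter u).
  move=> e e0; have [N hN] := @sqrt_maj_lim (e / 2) ltac:(lra).
  exists N => m n Nm Nn; rewrite (le_trans (nrm_split (sqrt_iter u N) _ _)) //.
  have h1 := sqrt_iter_dist u1 N (m - N); rewrite subnKC // in h1.
  have h2 := sqrt_iter_dist u1 N (n - N); rewrite subnKC // nrmB in h2.
  by have := hN N (leqnn _); lra.
exists f => //; split.
  apply: (tends_le (N := 0) uf) => n _; apply: (le_trans (sqrt_iter_bound u1 n)).
  by have /andP[] := sqrt_maj_bounds n.
have h1 : tends (fun n => sqrt_iter u n.+1) f.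
  move=> e /uf[N hN]; exists N => n Nn; apply: hN; exact: leqW.
have h2 := tendsZ ((2^-1 : R)%:C) (tendsD (tends_cst u) (tendsM uf uf)).
rewrite [in LHS](tends_uniq h1 h2) -scalerDl -rmorphD /=.
by rewrite (_ : 2^-1 + 2^-1 = 1 :> R) ?scale1r //; field.
Qed.

Lemma sqrt_iter_sa u : u^☆ = u -> forall n, (sqrt_iter u n)^☆ = sqrt_iter u n.
Proof.
move=> us; elim=> [|n IH] /=; first exact: astar0.
by rewrite astarZr astarD astarM us IH.
Qed.

Lemma sqrt_iter_comm u y : u ⋅ y = y ⋅ u -> forall n,
  sqrt_iter u n ⋅ y = y ⋅ sqrt_iter u n.
Proof.
move=> uy; elim=> [|n IH] /=; first by rewrite amul0x amulx0.
by rewrite amulZl amulZr amulDl amulDr uy -amulA IH !amulA IH.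
Qed.

Lemma sqrt_one_sub u : u^☆ = u -> nrm u <= 1 -> exists f,
  [/\ f^☆ = f, nrm f <= 1, f + f = u + f ⋅ f,
    forall y, u ⋅ y = y ⋅ u -> f ⋅ y = y ⋅ f & tends (sqrt_iter u) f].
Proof.
move=> us u1; have [f uf [f1 fE]] := sqrt_iter_cvg u1; exists f; split=> //.
  apply: (tends_uniq (tends_astar uf)).
  exact: tends_ext (fun n => esym (sqrt_iter_sa us n)) uf.
move=> y uy; apply: (tends_uniq (tendsMr y uf)).
exact: tends_ext (fun n => esym (sqrt_iter_comm uy n)) (tendsMl y uf).
Qed.

End SquareRootIteration.

(** * Positivity in unital C*-algebras *)

Section Unital.
Context {R : realType} {U : cstarAlgType R} (e : U).
Hypotheses (e1x : forall x, e ⋅ x = x) (ex1 : forall x, x ⋅ e = x).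
Implicit Types (x y z a b k : U) (r t T : R).

Lemma unit_star : e^☆ = e.
Proof.
have h : e^☆ = e^☆^☆ by rewrite -[in RHS](ex1 (e^☆)) astarM astarK ex1.
by rewrite h astarK.
Qed.

Lemma nrm_unit : nrm e <= 1.
Proof.
have h : nrm e = nrm e ^+ 2 by rewrite -nrm_sa ?unit_star ?e1x.
by have := nrm_ge0 e; nra.
Qed.

Local Ltac unital_eq := cstar_expand; rewrite ?(e1x, ex1); linear_eq;
  first [by ring | by field].

Definition sc r : U := r%:C *: e.

Lemma scD r t : sc (r + t) = sc r + sc t.
Proof. by rewrite /sc rmorphD scalerDl. Qed.
Lemma scB r t : sc (r - t) = sc r - sc t.
Proof. by rewrite /sc rmorphB scalerBl. Qed.
Lemma scMl r x : sc r ⋅ x = r%:C *: x. Proof. by rewrite amulZl e1x. Qed.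
Lemma scMr r x : x ⋅ sc r = r%:C *: x. Proof. by rewrite amulZr ex1. Qed.
Lemma sc_star r : (sc r)^☆ = sc r. Proof. by rewrite astarZr unit_star. Qed.
Lemma nrm_sc r : 0 <= r -> nrm (sc r) <= r.
Proof. by move=> r0; rewrite nrmZr ger0_norm // ler_piMr // nrm_unit. Qed.
Lemma sc_comm r x : sc r ⋅ x = x ⋅ sc r. Proof. by rewrite scMl scMr. Qed.

(** Positivity is measured by the norm: the spectrum of a self-adjoint [x] is
    contained in [[0, 2 t]] when [|t - x| <= t]. This avoids spectra
    altogether. *)
Definition pos x := x^☆ = x /\ exists2 t, 0 <= t & nrm (sc t - x) <= t.

Lemma pos0 : pos 0.
Proof. by split; [exact: astar0|exists 0; rewrite // subr0 nrm_sc]. Qed.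

Lemma posD x y : pos x -> pos y -> pos (x + y).
Proof.
move=> [xs [t t0 xt]] [ys [r r0 yr]]; split; first by rewrite astarD xs ys.
exists (t + r); first exact: addr_ge0.
by rewrite scD opprD addrACA (le_trans (nrm_triangle _ _)) // lerD.
Qed.

Lemma posZ r x : 0 <= r -> pos x -> pos (r%:C *: x).
Proof.
move=> r0 [xs [t t0 xt]]; split; first by rewrite astarZr xs.
exists (r * t); first exact: mulr_ge0.
by rewrite /sc rmorphM -scalerA -scalerBr nrmZr ger0_norm // ler_wpM2l.
Qed.

Lemma pos_subr T x : x^☆ = x -> nrm x <= T -> pos (sc T - x).
Proof.
move=> xs xT; split; first by rewrite astarB sc_star xs.
by exists T; rewrite ?(le_trans (nrm_ge0 x)) // opprB addrC subrK.
Qed.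

(** The square root of a positive element lies in every closed ideal
    containing that element, since the iterates for [1 - x] differ from the
    scalar iterates by elements of the ideal. *)
Lemma pos_sqrt x : pos x -> exists k, [/\ pos k, k ⋅ k = x,
  forall y, x ⋅ y = y ⋅ x -> k ⋅ y = y ⋅ k &
  forall I : set U, closed_ideal I -> I x -> I k].
Proof.
move=> [xs [t]]; rewrite le_eqVlt => /predU1P[<-|t0] xt.
  have -> : x = 0.
    apply: nrm_eq0; apply/eqP; rewrite eq_le nrm_ge0 andbT (le_trans _ xt) //.
    by rewrite /sc scale0r sub0r nrmN.
  exists 0; split; [exact: pos0|exact: amul0x| |by []].
  by move=> y _; rewrite amul0x amulx0.
set u := e - (t^-1)%:C *: x.
have tC : t%:C != 0 :> R[i] by rewrite eq_complex /= negb_and gt_eqF.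
have us : u^☆ = u by rewrite astarB unit_star astarZr xs.
have xE : x = t%:C *: (e - u).
  by rewrite opprB addrC subrK scalerA -rmorphM mulfV ?gt_eqF // scale1r.
have u1 : nrm u <= 1.
  have -> : u = (t^-1)%:C *: (sc t - x).
    by rewrite scalerBr scalerA -rmorphM mulVf ?gt_eqF // scale1r.
  by rewrite nrmZr gtr0_norm ?invr_gt0 // mulrC ler_pdivrMr // mul1r.
have [f [fs f1 fE fcomm flim]] := sqrt_one_sub us u1.
have st0 := sqrtr_ge0 t.
have ef2 : (e - f) ⋅ (e - f) = e - u.
  have -> : u = f + f - f ⋅ f by rewrite fE addrK.
  by unital_eq.
exists ((Num.sqrt t)%:C *: (e - f)); split.
- split; first by rewrite astarZr astarB unit_star fs.
  exists (Num.sqrt t) => //.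
  rewrite -scalerBr opprB addrC subrK nrmZr ger0_norm //.
  by rewrite ler_piMr.
- by rewrite amulZl amulZr scalerA -rmorphM -expr2 sqr_sqrtr ?ltW // ef2 xE.
- move=> y xy; rewrite amulZl amulZr amulBl amulBr e1x ex1 fcomm //.
  by rewrite amulBl amulBr e1x ex1 amulZl amulZr xy.
- move=> I [[cI I0 ID IZ] IM] Ix; apply: (IZ).
  have IB y z : I y -> I z -> I (y - z).
    by move=> Iy Iz; rewrite -scaleN1r; apply: ID => //; exact: IZ.
  have Iu : I (e - u) by rewrite opprB addrC subrK; exact: IZ.
  have Iit n : I (sc (sqrt_maj n) - sqrt_iter u n).
    elim: n => [|n IH]; first by rewrite /= subr0 /sc scale0r.
    set g := sqrt_maj n in IH *; set w := sqrt_iter u n in IH *.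
    have -> : sc (sqrt_maj n.+1) - sqrt_iter u n.+1 = (2^-1 : R)%:C *:
        ((e - u) + (sc g - w) ⋅ (sc g + w)).
      rewrite [sqrt_maj n.+1]/= [sqrt_iter u n.+1]/= -/g -/w.
      by rewrite /sc; unital_eq.
    by apply: IZ; apply: ID => //; case: (IM _ (sc g + w) IH).
  apply: (closed_tends cI Iit); apply: tendsB flim.
  move=> d d0; have [N hN] := sqrt_maj_lim d0; exists N => n /hN.
  apply: le_trans; rewrite -nrmN opprB.
  have -> : e - sc (sqrt_maj n) = sc (1 - sqrt_maj n) by rewrite scB /sc scale1r.
  by have /andP[_ g1] := @sqrt_maj_bounds R n; apply: nrm_sc; rewrite subr_ge0.
Qed.

Definition im : R[i] := 'i.

Lemma im_mul : im * im = -1. Proof. by rewrite -expr2 sqrCi. Qed.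

(** Two commuting self-adjoint elements with [a ^ 2 + b ^ 2 = T] are the real
    and imaginary parts of a multiple of a unitary, whence the bound. *)
Lemma nrm_le_of_sum_sq T a b : 0 <= T -> a^☆ = a -> b^☆ = b -> a ⋅ b = b ⋅ a ->
  a ⋅ a + b ⋅ b = sc T -> nrm a ^+ 2 <= T.
Proof.
move=> T0 sa sb ab abT.
set u := a + im *: b.
have us : u^☆ = a - im *: b by rewrite astarD astarZ conjCi scaleNr sa sb.
have uu : u^☆ ⋅ u = sc T.
  by rewrite us -abT; cstar_expand; rewrite ab !scalerA im_mul; linear_eq; ring.
have un : nrm u <= Num.sqrt T.
  rewrite -ler_sqr ?nnegrE ?nrm_ge0 ?sqrtr_ge0 // sqr_sqrtr // -nrmCC uu.
  exact: nrm_sc.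
have aE : a = (2^-1 : R)%:C *: (u + u^☆).
  by rewrite us /u; cstar_eq.
have an : nrm a <= Num.sqrt T.
  rewrite aE nrm_half ler_pdivrMr // (le_trans (nrm_triangle _ _)) //.
  by rewrite nrm_astar; lra.
by rewrite -[leRHS]sqr_sqrtr // ler_sqr ?nnegrE ?nrm_ge0 ?sqrtr_ge0.
Qed.

(** For self-adjoint [a] of norm at most [1], the elements [a] and
    [sqrt (1 - a ^ 2)] satisfy the hypothesis of [nrm_le_of_sum_sq]. *)
Lemma sq_bound a : a^☆ = a -> nrm (sc (nrm a ^+ 2) - a ⋅ a) <= nrm a ^+ 2.
Proof.
move=> sa; set T := nrm a ^+ 2; have T0 : 0 <= T by exact: sqr_ge0.
have aas : (a ⋅ a)^☆ = a ⋅ a by rewrite astarM sa.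
have aaT : nrm (a ⋅ a) <= T by rewrite nrm_sa.
have [k [[ks _] kk kc _]] := pos_sqrt (pos_subr aas aaT).
rewrite -kk nrm_sa // (nrm_le_of_sum_sq (b := a)) //.
  by apply: kc; rewrite amulBl amulBr sc_comm amulA.
by rewrite kk subrK.
Qed.

Lemma pos_sq a : a^☆ = a -> pos (a ⋅ a).
Proof.
move=> sa; split; first by rewrite astarM sa.
by exists (nrm a ^+ 2); [exact: sqr_ge0|exact: sq_bound].
Qed.

(** The square roots of [x] and [T - x] commute and their squares sum to [T]. *)
Lemma pos_le_nrm T x : 0 <= T -> pos x -> pos (sc T - x) -> nrm x <= T.
Proof.
move=> T0 px pTx; have [m [[ms _] mm mc _]] := pos_sqrt px.
have [k [[ks _] kk kc _]] := pos_sqrt pTx.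
rewrite -mm nrm_sa // (nrm_le_of_sum_sq (b := k)) //; last first.
  by rewrite mm kk addrC subrK.
have xm : x ⋅ m = m ⋅ x by rewrite -mm amulA.
by apply/esym/kc; rewrite amulBl amulBr sc_comm xm.
Qed.

(** [x] lies between [0] and [T = |x + y|], as [T - x = (T - (x + y)) + y]. *)
Lemma nrm_le_add x y : pos x -> pos y -> nrm x <= nrm (x + y).
Proof.
move=> px py; apply: pos_le_nrm => //; first exact: nrm_ge0.
have -> : sc (nrm (x + y)) - x = (sc (nrm (x + y)) - (x + y)) + y.
  by linear_eq; ring.
by apply: posD => //; apply: pos_subr => //; case: (posD px py).
Qed.

Lemma pos_anti x : pos x -> pos (- x) -> x = 0.
Proof.
move=> px pNx; apply: nrm_eq0; apply/eqP; rewrite eq_le nrm_ge0 andbT.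
by rewrite (le_trans (nrm_le_add px pNx)) // subrr nrm0.
Qed.

(** Let [N = z z^*] and [M = |z| ^ 2]. Then [(M + N) ^ 2 N] equals
    [z (M - k ^ 2) ^ 2 z^*], of norm at most [M ^ 3], but it dominates
    [2 M N ^ 2], of norm [2 M ^ 3]. *)
Lemma star_sq_neg z k : k^☆ = k -> z^☆ ⋅ z = - (k ⋅ k) -> z = 0.
Proof.
move=> ks zz; set M := nrm z ^+ 2; have M0 : 0 <= M by exact: sqr_ge0.
set N := z ⋅ z^☆.
have Ns : N^☆ = N by rewrite astarM astarK.
have NM : nrm N = M by exact: nrmCCr.
have kM : nrm k ^+ 2 = M by rewrite -nrm_sa // -nrmN -zz nrmCC.
have pN : pos N.
  set x := (2^-1 : R)%:C *: (z + z^☆).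
  set y := (2^-1 : R)%:C *: (im *: (z - z^☆)).
  have xs : x^☆ = x by rewrite astarZr astarD astarK addrC.
  have ys : y^☆ = y.
    rewrite astarZr; congr (_ *: _).
    by rewrite astarZ astarB astarK conjCi scaleNr -scalerN opprB.
  have yy : y ⋅ y = (- (2^-1 * 2^-1 : R))%:C *: ((z - z^☆) ⋅ (z - z^☆)).
    rewrite /y !(amulZl, amulZr) !scalerA; congr (_ *: _).
    transitivity ((2^-1)%:C * (2^-1)%:C * (im * im)); first by ring.
    by rewrite im_mul; field.
  have -> : N = (2 : R)%:C *: (x ⋅ x) + (2 : R)%:C *: (y ⋅ y) + k ⋅ k.
    by rewrite -[k ⋅ k]opprK -zz yy /N /x; cstar_eq.
  apply: posD; last exact: pos_sq.
  by apply: posD; apply: posZ => //; exact: pos_sq.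
have [n [[ns _] nn nc _]] := pos_sqrt pN.
have pN2 := pos_sq Ns.
have pN3 : pos (N ⋅ N ⋅ N).
  have -> : N ⋅ N ⋅ N = (n ⋅ N) ⋅ (n ⋅ N).
    by rewrite amulA -[n ⋅ N ⋅ n]amulA -[N ⋅ n]nc ?amulA ?nn // -nn amulA.
  by apply: pos_sq; rewrite astarM ns Ns nc.
set W := (M ^+ 2)%:C *: N + (2 * M)%:C *: (N ⋅ N) + N ⋅ N ⋅ N.
have WE : W = z ⋅ ((sc M - k ⋅ k) ⋅ (sc M - k ⋅ k)) ⋅ z^☆.
  have -> : - (k ⋅ k) = z^☆ ⋅ z by [].
  by rewrite /W /N /sc; unital_eq.
have W1 : nrm W <= M ^+ 3.
  rewrite WE (le_trans (nrmM _ _)) // nrm_astar.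
  have h1 : nrm (sc M - k ⋅ k) <= M by rewrite -kM sq_bound.
  have h2 := nrmM z ((sc M - k ⋅ k) ⋅ (sc M - k ⋅ k)).
  have h3 : nrm ((sc M - k ⋅ k) ⋅ (sc M - k ⋅ k)) <= M * M.
    by rewrite (le_trans (nrmM _ _)) // ler_pM ?nrm_ge0.
  have -> : M ^+ 3 = nrm z * (M * M) * nrm z by rewrite /M; ring.
  apply: ler_wpM2r; first exact: nrm_ge0.
  by apply: (le_trans h2); apply: ler_wpM2l => //; exact: nrm_ge0.
have W2 : 2 * M ^+ 3 <= nrm W.
  have -> : 2 * M ^+ 3 = nrm ((2 * M)%:C *: (N ⋅ N)).
    have M2 : 0 <= 2 * M by exact: mulr_ge0.
    by rewrite nrmZr nrm_sa // NM (ger0_norm M2); ring.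
  have -> : W = (2 * M)%:C *: (N ⋅ N) + ((M ^+ 2)%:C *: N + N ⋅ N ⋅ N).
    by rewrite /W; linear_eq; ring.
  apply: nrm_le_add; first by apply: posZ => //; exact: mulr_ge0.
  by apply: posD => //; apply: posZ => //; exact: sqr_ge0.
have M3 : M ^+ 3 <= 0 by lra.
have : M ^+ 3 == 0 by rewrite eq_le M3 exprn_ge0.
rewrite expf_eq0 /= sqrf_eq0 => /eqP; exact: nrm_eq0.
Qed.

(** Let [h = z^* z], [m = |h|] and [c = m - h]. Then [h c = - m c], so [z c]
    falls under [star_sq_neg], which forces [c = 0]. *)
Lemma pos_star_mul z : pos (z^☆ ⋅ z).
Proof.
set h := z^☆ ⋅ z; have hs : h^☆ = h by rewrite astarM astarK.
have [m [pm mm mc _]] := pos_sqrt (pos_sq hs); have [ms _] := pm.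
have [l [[ls _] ll lc _]] := pos_sqrt pm.
have mh : m ⋅ h = h ⋅ m by apply: mc; rewrite amulA.
set c := m - h; have cs : c^☆ = c by rewrite astarB ms hs.
have mcc : m ⋅ c = c ⋅ m by rewrite amulBl amulBr mh.
have lcc : l ⋅ c = c ⋅ l by exact: lc.
have hc : h ⋅ c = - (m ⋅ c) by rewrite !amulBr mm mh; linear_eq; ring.
have zc : z ⋅ c = 0.
  apply: (star_sq_neg (k := l ⋅ c)); first by rewrite astarM cs ls lcc.
  rewrite astarM cs amulA -[c ⋅ _ ⋅ z]amulA -amulA -/h hc amulNr; congr (- _).
  by rewrite -ll {1}lcc !amulA.
have mc0 : m ⋅ c = 0.
  by apply/eqP; rewrite -oppr_eq0 -hc -amulA zc amulx0.
have c0 : c = 0.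
  apply: astar_mul_eq0; rewrite cs {1}/c amulBl mc0 -amulA zc amulx0 subrr //.
by have -> : h = m by apply/eqP; rewrite eq_sym -subr_eq0 -/c c0.
Qed.

Lemma pos_conj x z : pos x -> pos (z^☆ ⋅ x ⋅ z).
Proof.
move=> /pos_sqrt[k [[ks _] <- _ _]].
have -> : z^☆ ⋅ (k ⋅ k) ⋅ z = (k ⋅ z)^☆ ⋅ (k ⋅ z).
  by rewrite astarM ks !amulA.
exact: pos_star_mul.
Qed.

(** With [c = 1 - p], the element [- (q c)^* (q c) = c (p - q) c] is positive
    together with its opposite. *)
Lemma projection_le_mul (p q : U) : projection p -> projection q -> cstar_le q p ->
  p ⋅ q = q.
Proof.
move=> [pp ps] [qq qs] [y pqy].
set c := e - p; have cs : c^☆ = c by rewrite astarB unit_star ps.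
have pc : p ⋅ c = 0 by rewrite amulBr ex1 pp subrr.
have cp : c ⋅ p = 0 by rewrite amulBl e1x pp subrr.
have qc : q ⋅ c = 0.
  apply: astar_mul_eq0; apply: pos_anti; first exact: pos_star_mul.
  have -> : - ((q ⋅ c)^☆ ⋅ (q ⋅ c)) = (y ⋅ c)^☆ ⋅ (y ⋅ c).
    rewrite !astarM cs qs !amulA -[c ⋅ _ ⋅ y]amulA -pqy amulBr amulBl cp.
    by rewrite amul0x sub0r -(amulA c q q) qq.
  exact: pos_star_mul.
have := congr1 astar qc; rewrite astarM cs qs astar0 amulBl e1x.
by move/eqP; rewrite subr_eq0 => /eqP.
Qed.

Section FiniteSums.
Variables (I : Type) (s : seq I).
Implicit Types F G : I -> U.

Lemma pos_sum F : (forall i, pos (F i)) -> pos (\sum_(i <- s) F i).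
Proof. by move=> pF; apply: big_ind => //; [exact: pos0|exact: posD]. Qed.

(** With [c = sum F^* G], positivity of [sum (F c - t G)^* (F c - t G)] for
    [t] the norm of [sum F^* F] gives [t c^* c <= t ^ 2 sum G^* G]. *)
Lemma cauchy_schwarz F G :
  nrm (\sum_(i <- s) (F i)^☆ ⋅ G i) ^+ 2 <=
  nrm (\sum_(i <- s) (F i)^☆ ⋅ F i) * nrm (\sum_(i <- s) (G i)^☆ ⋅ G i).
Proof.
set a := \sum_(i <- s) (F i)^☆ ⋅ F i; set b := \sum_(i <- s) (G i)^☆ ⋅ G i.
set c := \sum_(i <- s) (F i)^☆ ⋅ G i.
have pa : pos a by apply: pos_sum => i; exact: pos_star_mul.
have pb : pos b by apply: pos_sum => i; exact: pos_star_mul.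
set t := nrm a; have t0 : 0 <= t by exact: nrm_ge0.
have key r : 0 < r -> t <= r -> nrm c ^+ 2 <= r * nrm b.
  move=> r0 tr.
  have : nrm (r%:C *: (c^☆ ⋅ c)) <= nrm ((r * r)%:C *: b).
      have -> : (r * r)%:C *: b = r%:C *: (c^☆ ⋅ c) +
          (c^☆ ⋅ (sc r - a) ⋅ c + \sum_(i <- s)
            (F i ⋅ c - r%:C *: G i)^☆ ⋅ (F i ⋅ c - r%:C *: G i)).
        have -> : \sum_(i <- s)
            (F i ⋅ c - r%:C *: G i)^☆ ⋅ (F i ⋅ c - r%:C *: G i) =
            c^☆ ⋅ a ⋅ c - r%:C *: (c^☆ ⋅ c) - r%:C *: (c^☆ ⋅ c)
            + (r * r)%:C *: b.
          have cE : c^☆ = \sum_(i <- s) (G i)^☆ ⋅ F i.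
            rewrite astar_sum; apply: eq_bigr => i _.
            by rewrite astarM astarK.
          have h1 : c^☆ ⋅ c = \sum_(i <- s) c^☆ ⋅ ((F i)^☆ ⋅ G i).
            by rewrite -amul_sumr.
          have h2 : c^☆ ⋅ c = \sum_(i <- s) ((G i)^☆ ⋅ F i) ⋅ c.
            by rewrite -amul_suml -cE.
          rewrite {1}h1 h2 /a /b amul_sumr amul_suml !scaler_sumr -!sumrN.
          by rewrite -!big_split /=; apply: eq_bigr => i _; cstar_eq.
        by rewrite /sc; unital_eq.
      apply: nrm_le_add; first by apply: posZ; [exact: ltW|exact: pos_star_mul].
      apply: posD.
        by apply: pos_conj; apply: pos_subr => //; case: pa.
      by apply: pos_sum => i; exact: pos_star_mul.
    rewrite !nrmZr nrmCC normrM (ger0_norm (ltW r0)) -mulrA.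
    by rewrite ler_pM2l.
apply/ler_addgt0Pr => d d0; have b0 := nrm_ge0 b.
have d1 : 0 < d / (nrm b + 1) by apply: divr_gt0 => //; lra.
apply: (le_trans (key (t + d / (nrm b + 1)) _ _)); rewrite ?lerDl; try lra.
rewrite mulrDl lerD2l mulrAC ler_pdivrMr; last by lra.
by rewrite ler_pM2l //; lra.
Qed.

End FiniteSums.

End Unital.

(** * Homomorphisms, the multiplier algebra and positivity without unit *)

Section StarHom.
Context {R : realType} {A B : cstarAlgType R} {phi : A -> B}.
Hypothesis hphi : star_hom phi.

Lemma star_homL (a : R[i]) x y : phi (a *: x + y) = a *: phi x + phi y.
Proof. by case: hphi => ->. Qed.

Lemma star_homM x y : phi (x ⋅ y) = phi x ⋅ phi y.
Proof. by case: hphi. Qed.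

Lemma star_homS x : phi (x^☆) = (phi x)^☆.
Proof. by case: hphi. Qed.

Lemma star_homD x y : phi (x + y) = phi x + phi y.
Proof. by rewrite -[x]scale1r star_homL !scale1r. Qed.

Lemma star_hom0 : phi 0 = 0.
Proof. by apply: (addrI (phi 0)); rewrite -star_homD !addr0. Qed.

Lemma star_homZ (a : R[i]) x : phi (a *: x) = a *: phi x.
Proof. by rewrite -[a *: x]addr0 star_homL star_hom0 addr0. Qed.

Lemma star_homB x y : phi (x - y) = phi x - phi y.
Proof. by rewrite star_homD -scaleN1r star_homZ scaleN1r. Qed.

End StarHom.

Section MultiplierAlgebra.
Context {R : realType} (A : cstarAlgType R).

(** A C*-algebra is a Hilbert module over itself; its adjointable operators
    form a unital C*-algebra that contains it as a closed ideal. *)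
Program Definition self_hilbert : hilbert A :=
  @Hilbert R A A (fun x y => x^☆ ⋅ y) _ _ _ _ _.
Next Obligation. by move=> x y z /=; rewrite amulDr. Qed.
Next Obligation. by move=> a x y /=; rewrite amulZr. Qed.
Next Obligation. by move=> x y /=; rewrite astarM astarK. Qed.
Next Obligation. by move=> x /=; rewrite nrmCC. Qed.
Next Obligation. by move=> x y /=; rewrite (le_trans (nrmM _ _)) // nrm_astar. Qed.

Definition multalg : cstarAlgType R := adjop self_hilbert.

Lemma lmul_adjoint (a : A) :
  adjoint (H := self_hilbert) (amul a) (amul (a^☆)).
Proof. by move=> x y; rewrite /= astarM amulA. Qed.

Lemma lmul_adjointable (a : A) : adjointable (H := self_hilbert) (amul a).
Proof.
split; first by exists (amul (a^☆)); exact: lmul_adjoint.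
by exists (nrm a); split=> [|x]; [exact: nrm_ge0|exact: nrmM].
Qed.

Definition lmul (a : A) : multalg := mkop (lmul_adjointable a).

Lemma lmul_hom : star_hom lmul.
Proof.
split.
- by move=> c x y; apply: opval_inj => z /=; rewrite amulDl amulZl.
- by move=> x y; apply: opval_inj => z /=; rewrite amulA.
- by move=> x; apply/esym/opstar_eq => y z /=; rewrite astarM amulA.
Qed.

Lemma nrm_lmul a : nrm (lmul a) = nrm a.
Proof.
apply/eqP; rewrite eq_le op_nrm_le ?nrm_ge0 //=; last exact: nrmM.
have [a0|a0] := eqVneq (nrm a) 0; first by rewrite a0 nrm_ge0.
have n0 : 0 < nrm a by rewrite lt_neqAle nrm_ge0 eq_sym a0.
rewrite -(ler_pM2r n0) -expr2 -nrmCCr -[in leRHS](nrm_astar a).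
exact: (op_nrmP (lmul a) (a^☆)).
Qed.

Lemma opid_mul (T : multalg) : (opid self_hilbert : multalg) ⋅ T = T.
Proof. exact: opval_inj. Qed.

Lemma mul_opid (T : multalg) : T ⋅ (opid self_hilbert : multalg) = T.
Proof. exact: opval_inj. Qed.

Lemma mul_lmul (T : multalg) a : T ⋅ lmul a = lmul (opval T a).
Proof.
apply: opval_inj => x; apply: (@hip_injr _ _ self_hilbert) => y.
have E z : y^☆ ⋅ opval T z = (opval (opstar T) y)^☆ ⋅ z.
  by have := opstarP (opstar T) y z; rewrite opstarK => /= ->.
by rewrite /= E amulA -E amulA.
Qed.

Lemma lmul_mul (T : multalg) a : lmul a ⋅ T = lmul ((opval (T^☆) (a^☆))^☆).
Proof.
by rewrite -[LHS]astarK astarM -(star_homS lmul_hom) mul_lmul -(star_homS lmul_hom).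
Qed.

Lemma lmul_inj : injective lmul.
Proof.
move=> a b ab; apply/eqP; rewrite -subr_eq0; apply/eqP/nrm_eq0.
by rewrite -nrm_lmul (star_homB lmul_hom) ab subrr nrm0.
Qed.

(** The range is closed because left multiplication is isometric. *)
Lemma lmul_ideal : closed_ideal (range lmul).
Proof.
split; last first.
  by move=> _ T [a _ <-]; rewrite lmul_mul mul_lmul; split; eexists.
split.
- apply: tends_closed => u T ru uT.
  have {}ru n : exists a, lmul a = u n by case: (ru n) => a _ <-; exists a.
  have [a ua] := choice ru.
  have [x ax] : exists x, tends a x.
    apply: cauchy_tends => d /(tends_cauchy uT)[N hN]; exists N => m n Nm Nn.
    rewrite -nrm_lmul (star_homB lmul_hom) !ua; exact: hN.
  exists x => //; apply: tends_uniq uT; apply: (tends_ext ua).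
  apply: (tends_lip (c := 1)) ax => y z.
  by rewrite mul1r -(star_homB lmul_hom) nrm_lmul.
- by exists 0; rewrite ?(star_hom0 lmul_hom).
- by move=> _ _ [a _ <-] [b _ <-]; exists (a + b); rewrite ?(star_homD lmul_hom).
- by move=> c _ [a _ <-]; exists (c *: a); rewrite ?(star_homZ lmul_hom).
Qed.

End MultiplierAlgebra.

Section NonUnital.
Context {R : realType}.
Implicit Types A B : cstarAlgType R.

Local Notation one A := (opid (self_hilbert A) : multalg A).

Lemma projection_absorb A (p q : A) : projection p -> projection q ->
  cstar_le q p -> p ⋅ q = q.
Proof.
move=> [pp ps] [qq qs] [y py]; have [_ lM lS] := lmul_hom A.
apply: lmul_inj; rewrite lM; apply: (projection_le_mul (e := one A)).
- exact: opid_mul.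
- exact: mul_opid.
- by split; rewrite -?lM -?lS ?pp ?ps.
- by split; rewrite -?lM -?lS ?qq ?qs.
- by exists (lmul y); rewrite -lS -lM -(star_homB (lmul_hom A)) py.
Qed.

(** If [f] solves [2 f = a ^ 2 + f ^ 2], then so does [phi f] for [phi a]; hence
    [phi a] and [1 - phi f] are commuting self-adjoint elements whose squares
    sum to [1]. *)
Lemma star_hom_contractive A B (phi : A -> B) : star_hom phi ->
  forall x, nrm (phi x) <= nrm x.
Proof.
move=> hphi; have [_ pM pS] := hphi.
have sa1 a : a^☆ = a -> nrm a <= 1 -> nrm (phi a) <= 1.
  move=> sa a1; have aas : (a ⋅ a)^☆ = a ⋅ a by rewrite astarM sa.
  have aa1 : nrm (a ⋅ a) <= 1.
    by rewrite nrm_sa // expr_le1 // nrm_ge0.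
  have [f [fs _ fE fa _]] := sqrt_one_sub aas aa1.
  have [lL lM lS] := lmul_hom B.
  set b := lmul (phi a); set c := lmul (phi f).
  have bs : b^☆ = b by rewrite -lS -pS sa.
  have cs : c^☆ = c by rewrite -lS -pS fs.
  have cE : c + c = b ⋅ b + c ⋅ c by rewrite -!lM -!(star_homD (lmul_hom B)) -!pM -!(star_homD hphi) fE.
  have bc : b ⋅ c = c ⋅ b by rewrite -!lM -!pM fa // amulA.
  rewrite -nrm_lmul -(ler_sqr (nrm_ge0 _)) ?nnegrE ?ler01 // expr1n.
  apply: (@nrm_le_of_sum_sq _ _ (one B) _ _ _ b (one B - c)) => //.
  - exact: opid_mul.
  - exact: mul_opid.
  - rewrite astarB cs (unit_star (e := one B)) //; exact: mul_opid.
  - by rewrite amulBr amulBl opid_mul mul_opid bc.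
  - rewrite amulBl !amulBr !opid_mul !mul_opid /sc scale1r.
    have -> : b ⋅ b = c + c - c ⋅ c by rewrite cE addrK.
    by linear_eq; ring.
have sa a : a^☆ = a -> nrm (phi a) <= nrm a.
  move=> sa; have [a0|a0] := eqVneq (nrm a) 0.
    by rewrite (nrm_eq0 a0) (star_hom0 hphi) !nrm0.
  have n0 : 0 < nrm a by rewrite lt_neqAle nrm_ge0 eq_sym a0.
  have i0 : 0 < (nrm a)^-1 by rewrite invr_gt0.
  have := sa1 ((nrm a)^-1%:C *: a); rewrite astarZr sa (star_homZ hphi) !nrmZr gtr0_norm //.
  by rewrite mulVf // mulrC ler_pdivrMr // mul1r; apply.
move=> x; rewrite -(ler_sqr (nrm_ge0 _)) ?nnegrE ?nrm_ge0 // -!nrmCC -pS -pM.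
by apply: sa; rewrite astarM astarK.
Qed.

(** Positivity of [h] in the multiplier algebra yields a square root in [A],
    since [A] is a closed ideal there. *)
Lemma pos_positive A (h : A) : pos (one A) (lmul h) -> positive h.
Proof.
move=> ph; have [lL lM lS] := lmul_hom A.
have [k [[ks _] kk _ kI]] := pos_sqrt (@opid_mul R A) (@mul_opid R A) ph.
have [y _ yk] := kI _ (lmul_ideal A) (ex_intro2 _ _ h I erefl).
exists y; apply: lmul_inj; rewrite lM lS yk ks kk //.
Qed.

(** Positivity is a condition on norms, so an isometric homomorphism reflects
    it; the root is then found in the smaller algebra by [pos_positive]. *)
Lemma positive_reflect A B (phi : A -> B) (h : A) : star_hom phi ->
  (forall x, nrm (phi x) = nrm x) -> positive (phi h) -> h^☆ = h -> positive h.
Proof.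
move=> hphi pn [y py] hs; have [_ pM pS] := hphi; apply: pos_positive.
have [lL lM lS] := lmul_hom A; have [lL' lM' lS'] := lmul_hom B.
split; first by rewrite -lS hs.
have [_ [t t0 ht]] := pos_star_mul (@opid_mul R B) (@mul_opid R B) (lmul y).
exists t => //; apply: op_nrm_le => // x.
rewrite -[nrm x]pn -pn.
have /= -> : opval (sc (one A) t - lmul h) x = t%:C *: x - h ⋅ x by [].
rewrite (star_homB hphi) (star_homZ hphi) pM py.
have := op_nrmP (sc (one B) t - (lmul y)^☆ ⋅ lmul y) (phi x).
rewrite -lS' -lM' /=.
move/le_trans; apply; apply: ler_wpM2r; first exact: nrm_ge0.
by rewrite lM' lS'.
Qed.

End NonUnital.

Section StarHomLimits.
Context {R : realType} {A B : cstarAlgType R} {phi : A -> B}.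
Hypothesis hphi : star_hom phi.

Lemma star_hom_tends u x : tends u x -> tends (fun n => phi (u n)) (phi x).
Proof.
apply: (tends_lip (c := 1)) => y z.
by rewrite mul1r -(star_homB hphi) star_hom_contractive.
Qed.

End StarHomLimits.

(** The equalizer of two homomorphisms is closed since both are contractive. *)
Lemma star_hom_eq {R : realType} {A B : cstarAlgType R} (phi psi : A -> B)
    (G : set A) : star_hom phi -> star_hom psi -> generates G ->
  (forall x, G x -> phi x = psi x) -> phi =1 psi.
Proof.
move=> hphi hpsi gG h x.
suff S : [set y | phi y = psi y] = setT.
  by have : [set y | phi y = psi y] x by rewrite S.
apply: (gG _ _ h); split.
- split.
  + apply: tends_closed => u y Su uy /=.
    apply: (tends_uniq (star_hom_tends hphi uy)).
    exact: tends_ext (fun n => esym (Su n)) (star_hom_tends hpsi uy).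
  + by rewrite /= (star_hom0 hphi) (star_hom0 hpsi).
  + by move=> y z /= hy hz; rewrite (star_homD hphi) (star_homD hpsi) hy hz.
  + by move=> a y /= hy; rewrite (star_homZ hphi) (star_homZ hpsi) hy.
- by move=> y z /= hy hz; rewrite (star_homM hphi) (star_homM hpsi) hy hz.
- by move=> y /= hy; rewrite (star_homS hphi) (star_homS hpsi) hy.
Qed.

(** * Square summable sequences and matrix units *)

Section SquareSummable.
Context {R : realType} {U : cstarAlgType R} (e : U).
Hypotheses (e1x : forall x, e ⋅ x = x) (ex1 : forall x, x ⋅ e = x).
Implicit Types (x y z : nat -> U) (m n k : nat).

Definition gram x y m n : U := \sum_(m <= i < n) (x i)^☆ ⋅ y i.

Definition sec_nrm x m n : R := Num.sqrt (nrm (gram x x m n)).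

Lemma sec_nrm_ge0 x m n : 0 <= sec_nrm x m n. Proof. exact: sqrtr_ge0. Qed.

Lemma sec_nrm_sq x m n : sec_nrm x m n ^+ 2 = nrm (gram x x m n).
Proof. by rewrite sqr_sqrtr // nrm_ge0. Qed.

Lemma sec_nrm_le x m n (c : R) : 0 <= c -> nrm (gram x x m n) <= c ^+ 2 ->
  sec_nrm x m n <= c.
Proof.
by move=> c0 h; rewrite -ler_sqr ?nnegrE ?sec_nrm_ge0 // sec_nrm_sq.
Qed.

Lemma gram_cs x y m n : nrm (gram x y m n) <= sec_nrm x m n * sec_nrm y m n.
Proof.
rewrite -ler_sqr ?nnegrE ?mulr_ge0 ?sec_nrm_ge0 ?nrm_ge0 // exprMn !sec_nrm_sq.
exact: (cauchy_schwarz e1x ex1).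
Qed.

Lemma gramD x y z m n : gram x (y + z) m n = gram x y m n + gram x z m n.
Proof. by rewrite -big_split; apply: eq_bigr => i _; rewrite amulDr. Qed.

Lemma gramZ (a : R[i]) x y m n : gram x (a *: y) m n = a *: gram x y m n.
Proof. by rewrite scaler_sumr; apply: eq_bigr => i _; rewrite amulZr. Qed.

Lemma gram_star x y m n : (gram x y m n)^☆ = gram y x m n.
Proof. by rewrite astar_sum; apply: eq_bigr => i _; rewrite astarM astarK. Qed.

Lemma gramDl x y z m n : gram (x + y) z m n = gram x z m n + gram y z m n.
Proof. by rewrite -gram_star gramD astarD !gram_star. Qed.

Lemma gramZl (a : R[i]) x y m n : gram (a *: x) y m n = a^* *: gram x y m n.
Proof. by rewrite -gram_star gramZ astarZ gram_star. Qed.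

Lemma pos_gram x m n : pos e (gram x x m n).
Proof. by apply: pos_sum => // i; exact: pos_star_mul. Qed.

Lemma gram_cat x y m n k : (m <= n)%N -> (n <= k)%N ->
  gram x y m k = gram x y m n + gram x y n k.
Proof. by move=> mn nk; rewrite /gram (big_cat_nat mn nk). Qed.

Lemma gram_geq x y m n : (n <= m)%N -> gram x y m n = 0.
Proof. by move=> nm; rewrite /gram big_geq. Qed.

Lemma sec_nrm_mono x m n m' n' : (m' <= m)%N -> (n <= n')%N ->
  sec_nrm x m n <= sec_nrm x m' n'.
Proof.
move=> mm nn; have [nm|mn] := leqP n m.
  by rewrite /sec_nrm gram_geq // nrm0 sqrtr0 sec_nrm_ge0.
rewrite ler_wsqrtr // (gram_cat _ _ mm (leq_trans (ltnW mn) nn)).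
rewrite (gram_cat _ _ (ltnW mn) nn) addrCA.
apply: (nrm_le_add e1x ex1); first exact: pos_gram.
by apply: posD => //; exact: pos_gram.
Qed.

Lemma sec_nrmD x y m n : sec_nrm (x + y) m n <= sec_nrm x m n + sec_nrm y m n.
Proof.
apply: sec_nrm_le; first by rewrite addr_ge0 ?sec_nrm_ge0.
have -> : (sec_nrm x m n + sec_nrm y m n) ^+ 2 =
  (sec_nrm x m n ^+ 2 + sec_nrm x m n * sec_nrm y m n) +
  (sec_nrm y m n * sec_nrm x m n + sec_nrm y m n ^+ 2) by ring.
rewrite gramD !gramDl addrACA !sec_nrm_sq.
apply: (le_trans (nrm_triangle _ _)); apply: lerD;
  apply: (le_trans (nrm_triangle _ _)); apply: lerD => //; exact: gram_cs.
Qed.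

Lemma sec_nrmZ (a : R[i]) x m n : sec_nrm (a *: x) m n = mag a * sec_nrm x m n.
Proof.
rewrite /sec_nrm gramZ gramZl !nrmZ.
have -> : mag a^* = mag a by rewrite /mag norm_conjC.
by rewrite mulrA -expr2 sqrtrM ?sqr_ge0 // sqrtr_sqr ger0_norm ?mag_ge0.
Qed.

Lemma sec_nrm1 x n : sec_nrm x n n.+1 = nrm (x n).
Proof.
by rewrite /sec_nrm /gram big_nat1 nrmCC sqrtr_sqr ger0_norm ?nrm_ge0.
Qed.

(** Norm convergence of the sum of the [(x i)^* x i], in Cauchy form: bounded
    partial sums would not give a norm convergent inner product. *)
Definition sq_summable x := forall d : R, 0 < d ->
  exists N, forall m, (N <= m)%N -> forall n, sec_nrm x m n <= d.

Definition l2_nrm x : R := sup [set sec_nrm x 0 n | n in setT].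

Lemma sq_summable_bound x : sq_summable x -> exists c, forall n, sec_nrm x 0 n <= c.
Proof.
move=> /(_ 1 ltr01)[N hN]; exists (Num.sqrt (nrm (gram x x 0 N) + 1)) => n.
rewrite ler_wsqrtr //; have [nN|Nn] := leqP n N.
  have := sec_nrm_mono x (leqnn 0) nN; rewrite -ler_sqr ?nnegrE ?sec_nrm_ge0 //.
  by rewrite !sec_nrm_sq; lra.
rewrite (gram_cat _ _ (leq0n N) (ltnW Nn)).
apply: (le_trans (nrm_triangle _ _)); rewrite lerD2l -sec_nrm_sq.
by rewrite expr_le1 ?sec_nrm_ge0 // hN.
Qed.

Lemma l2_nrm_ub x n : sq_summable x -> sec_nrm x 0 n <= l2_nrm x.
Proof.
move=> /sq_summable_bound[c hc]; apply: ub_le_sup; last by exists n.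
by exists c => _ [k _ <-].
Qed.

Lemma l2_nrm_le x c : (forall n, sec_nrm x 0 n <= c) -> l2_nrm x <= c.
Proof.
move=> h; apply: ge_sup; first by exists (sec_nrm x 0 0); exists 0%N.
by move=> _ [n _ <-].
Qed.

Lemma l2_nrm_ge0 x : sq_summable x -> 0 <= l2_nrm x.
Proof. by move=> /(l2_nrm_ub 0); apply: le_trans; exact: sec_nrm_ge0. Qed.

Lemma nrm_le_l2 x n : sq_summable x -> nrm (x n) <= l2_nrm x.
Proof.
move=> sx; rewrite -sec_nrm1; apply: le_trans (l2_nrm_ub n.+1 sx).
exact: sec_nrm_mono.
Qed.

Lemma sq_summable0 : sq_summable 0.
Proof.
move=> d d0; exists 0%N => m _ n; rewrite /sec_nrm /gram big1 ?nrm0 ?sqrtr0 ?ltW //.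
by move=> i _; rewrite amulx0.
Qed.

Lemma sq_summableD x y : sq_summable x -> sq_summable y -> sq_summable (x + y).
Proof.
move=> sx sy d d0; have [N hN] := sx (d / 2) ltac:(lra).
have [M hM] := sy (d / 2) ltac:(lra); exists (maxn N M) => m.
rewrite geq_max => /andP[/hN h1 /hM h2] n; move: (h1 n) (h2 n) => {}h1 {}h2.
by apply: (le_trans (sec_nrmD _ _ _ _)); lra.
Qed.

Lemma sq_summableZ (a : R[i]) x : sq_summable x -> sq_summable (a *: x).
Proof.
move=> sx d d0; have a0 := mag_ge0 a.
have [N hN] := sx (d / (mag a + 1)) ltac:(apply: divr_gt0 => //; lra).
exists N => m /hN h n; rewrite sec_nrmZ; move: (h n) => {}h.
apply: (le_trans (ler_wpM2l a0 h)); rewrite mulrCA ger_pMr //.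
by rewrite ler_pdivrMr; lra.
Qed.

Lemma l2_nrmD x y : sq_summable x -> sq_summable y ->
  l2_nrm (x + y) <= l2_nrm x + l2_nrm y.
Proof.
move=> sx sy; apply: l2_nrm_le => n; apply: (le_trans (sec_nrmD _ _ _ _)).
by apply: lerD; exact: l2_nrm_ub.
Qed.

Lemma l2_nrmZ (a : R[i]) x : sq_summable x -> l2_nrm (a *: x) = mag a * l2_nrm x.
Proof.
move=> sx; have a0 := mag_ge0 a; apply/eqP; rewrite eq_le l2_nrm_le /=; last first.
  by move=> n; rewrite sec_nrmZ ler_wpM2l // l2_nrm_ub.
have [->|an0] := eqVneq a 0.
  by rewrite mag0 mul0r l2_nrm_ge0 // scale0r; exact: sq_summable0.
rewrite mulrC -ler_pdivlMr ?mag_gt0 //; apply: l2_nrm_le => n.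
rewrite ler_pdivlMr ?mag_gt0 // mulrC -sec_nrmZ; apply: l2_nrm_ub.
exact: sq_summableZ.
Qed.

Lemma l2_nrm_eq0 x : sq_summable x -> l2_nrm x = 0 -> x = 0.
Proof.
move=> sx x0; apply/funext => n; apply/nrm_eq0/eqP.
by rewrite eq_le nrm_ge0 andbT -x0 nrm_le_l2.
Qed.

Lemma gram_tends (u v : nat -> nat -> U) x y m n :
  (forall i, tends (u ^~ i) (x i)) -> (forall i, tends (v ^~ i) (y i)) ->
  tends (fun k => gram (u k) (v k) m n) (gram x y m n).
Proof.
move=> ux vy; apply: tends_sum => i.
by apply: tendsM; [exact: tends_astar|exact: vy].
Qed.

Lemma sq_summableB x y : sq_summable x -> sq_summable y -> sq_summable (x - y).
Proof.
by move=> sx sy; rewrite -scaleN1r; apply: sq_summableD => //; exact: sq_summableZ.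
Qed.

(** The limit is taken entrywise; estimates on finite sections pass to it. *)
Lemma l2_complete (u : nat -> nat -> U) : (forall n, sq_summable (u n)) ->
  (forall d : R, 0 < d -> exists N, forall m n, (N <= m)%N -> (N <= n)%N ->
     l2_nrm (u m - u n) <= d) ->
  exists2 x, sq_summable x & forall d : R, 0 < d ->
    exists N, forall n, (N <= n)%N -> l2_nrm (u n - x) <= d.
Proof.
move=> su cu.
have ex i : exists xi, tends (u ^~ i) xi.
  apply: cauchy_tends => d /cu[N hN]; exists N => m n Nm Nn.
  apply: le_trans (hN m n Nm Nn).
  exact: (nrm_le_l2 i (sq_summableB (su m) (su n))).
have [x ux] := choice ex.
have lim d : 0 < d -> exists N, forall k, (N <= k)%N -> forall m n,
    sec_nrm (u k - x) m n <= d.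
  move=> d0; have [N hN] := cu d d0; exists N => k Nk m n.
  apply: sec_nrm_le; first exact: ltW.
  have sub i : tends (fun l => (u k - u l) i) ((u k - x) i).
    by apply: tendsB; [exact: tends_cst|exact: ux].
  apply: (tends_le (N := N) (gram_tends m n sub sub)) => l Nl.
  rewrite -sec_nrm_sq ler_sqr ?nnegrE ?sec_nrm_ge0 ?(ltW d0) //.
  apply: (le_trans (sec_nrm_mono _ (leq0n m) (leqnn n))).
  apply: le_trans (hN k l Nk Nl); exact: l2_nrm_ub (sq_summableB (su k) (su l)).
exists x; last first.
  by move=> d /lim[N hN]; exists N => n Nn; apply: l2_nrm_le => k; exact: hN.
move=> d d0; have [K hK] := lim (d / 2) ltac:(lra).
have [N hN] := su K (d / 2) ltac:(lra); exists N => m Nm n.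
have -> : x = u K - (u K - x) by rewrite opprB addrC subrK.
apply: (le_trans (sec_nrmD _ _ _ _)).
have -> : sec_nrm (- (u K - x)) m n = sec_nrm (u K - x) m n.
  by rewrite -scaleN1r sec_nrmZ magN1 mul1r.
by have := hK K (leqnn _) m n; have := hN m Nm n; lra.
Qed.

Definition l2_data : banach_subspace R :=
  BanachSubspace sq_summable0 sq_summableD sq_summableZ l2_nrmD l2_nrmZ
    l2_nrm_eq0 l2_complete.

Definition l2 : completeNormedModType R[i] := banach l2_data.

Definition seq_of (x : l2) : nat -> U := bval x.
Lemma seq_ofP (x : l2) : sq_summable (seq_of x).
Proof. exact: (bset (D := l2_data)). Qed.

Lemma l2_sec (x : l2) m n : sec_nrm (seq_of x) m n <= nrm x.
Proof.
apply: (le_trans (sec_nrm_mono _ (leq0n m) (leqnn n))).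
exact: (l2_nrm_ub n (seq_ofP x)).
Qed.

Lemma l2_ip_cvg (x y : l2) :
  exists a : U, tends (fun n => gram (seq_of x) (seq_of y) 0 n) a.
Proof.
apply: cauchy_tends => d d0; have c0 : 0 < nrm y + 1 by have := nrm_ge0 y; lra.
have [N hN] := seq_ofP x ltac:(exact: (divr_gt0 d0 c0)).
have main m n : (N <= m)%N -> (m <= n)%N ->
    nrm (gram (seq_of x) (seq_of y) 0 n - gram (seq_of x) (seq_of y) 0 m) <= d.
  move=> Nm mn; rewrite (gram_cat _ _ (leq0n m) mn) addrC addKr.
  apply: (le_trans (gram_cs _ _ _ _)).
  apply: (@le_trans _ _ (d / (nrm y + 1) * nrm y)).
    by apply: ler_pM; rewrite ?sec_nrm_ge0 ?hN ?l2_sec.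
  rewrite mulrAC ler_pdivrMr // ler_pM2l //; lra.
exists N => m n Nm Nn; have [mn|nm] := leqP m n.
  by rewrite nrmB; exact: main.
by apply: main => //; exact: ltnW.
Qed.

Definition l2_ip (x y : l2) : U := sval (cid (l2_ip_cvg x y)).

Lemma l2_ipP (x y : l2) : tends (fun n => gram (seq_of x) (seq_of y) 0 n) (l2_ip x y).
Proof. exact: svalP (cid (l2_ip_cvg x y)). Qed.

Lemma l2_ip_eq (x y : l2) (a : U) :
  tends (fun n => gram (seq_of x) (seq_of y) 0 n) a -> l2_ip x y = a.
Proof. exact: tends_uniq (l2_ipP x y). Qed.

Lemma l2_ipD (x y z : l2) : l2_ip x (y + z) = l2_ip x y + l2_ip x z.
Proof.
apply: l2_ip_eq; apply: tends_ext (tendsD (l2_ipP x y) (l2_ipP x z)) => n.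
by rewrite -gramD.
Qed.

Lemma l2_ipZ (a : R[i]) (x y : l2) : l2_ip x (a *: y) = a *: l2_ip x y.
Proof.
apply: l2_ip_eq; apply: tends_ext (tendsZ a (l2_ipP x y)) => n.
by rewrite -gramZ.
Qed.

Lemma l2_ipC (x y : l2) : (l2_ip x y)^☆ = l2_ip y x.
Proof.
apply/esym/l2_ip_eq; apply: tends_ext (tends_astar (l2_ipP x y)) => n.
by rewrite gram_star.
Qed.

Lemma l2_ip_cs (x y : l2) : nrm (l2_ip x y) <= nrm x * nrm y.
Proof.
apply: (tends_le (N := 0) (l2_ipP x y)) => n _.
by apply: (le_trans (gram_cs _ _ _ _)); apply: ler_pM; rewrite ?sec_nrm_ge0 ?l2_sec.
Qed.

Lemma l2_ip_nrm (x : l2) : nrm (l2_ip x x) = nrm x ^+ 2.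
Proof.
apply/eqP; rewrite eq_le {1}expr2 l2_ip_cs /=.
rewrite -[leRHS]sqr_sqrtr ?nrm_ge0 //.
rewrite ler_sqr ?nnegrE ?sqrtr_ge0 ?nrm_ge0 //.
apply: l2_nrm_le => n; rewrite ler_wsqrtr //.
apply/ler_addgt0Pr => d d0; have [N hN] := l2_ipP x x d0.
have h1 := hN (maxn n N) (leq_maxr _ _).
have h2 : nrm (gram (seq_of x) (seq_of x) 0 n) <=
  nrm (gram (seq_of x) (seq_of x) 0 (maxn n N)).
  rewrite -!sec_nrm_sq ler_sqr ?nnegrE ?sec_nrm_ge0 //.
  by apply: sec_nrm_mono => //; exact: leq_maxl.
apply: (le_trans h2); rewrite -[gram _ _ _ _](subrK (l2_ip x x)).
by apply: (le_trans (nrm_triangle _ _)); rewrite addrC lerD2l.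
Qed.

Definition l2_hilbert : hilbert U :=
  Hilbert l2_ipD l2_ipZ l2_ipC l2_ip_nrm l2_ip_cs.

Definition stable : cstarAlgType R := adjop l2_hilbert.

(** ** Matrix units *)

Definition delta n (a : U) : nat -> U := fun k => if k == n then a else 0.

Lemma gram_delta n a y k : gram (delta n a) y 0 k =
  if (n < k)%N then a^☆ ⋅ y n else 0.
Proof.
rewrite /gram; have [nk|kn] := ltnP n k; last first.
  rewrite big_nat big1 // => i /andP[_ ik]; rewrite /delta ltn_eqF ?(leq_trans ik) //.
  by rewrite astar0 amul0x.
rewrite (bigD1_seq n) ?iota_uniq ?mem_index_iota //= /delta eqxx big1 ?addr0 //.
by move=> i /negPf ->; rewrite astar0 amul0x.
Qed.

Lemma sec_delta n a k : sec_nrm (delta n a) 0 k = if (n < k)%N then nrm a else 0.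
Proof.
rewrite /sec_nrm gram_delta; case: ifP => _; last by rewrite nrm0 sqrtr0.
by rewrite /delta eqxx nrmCC sqrtr_sqr ger0_norm ?nrm_ge0.
Qed.

Lemma delta_summable n a : sq_summable (delta n a).
Proof.
move=> d d0; exists n.+1 => m nm k; rewrite /sec_nrm /gram big_nat big1 ?nrm0 ?sqrtr0 ?ltW //.
move=> i /andP[mi _]; rewrite /delta gtn_eqF ?astar0 ?amul0x //.
exact: leq_trans mi.
Qed.

Definition single n a : l2 := bmk (D := l2_data) (delta_summable n a).

Lemma nrm_single n a : nrm (single n a) = nrm a.
Proof.
apply/eqP; rewrite eq_le; apply/andP; split.
  by apply: l2_nrm_le => k; rewrite sec_delta; case: ifP => //; rewrite nrm_ge0.
by have := l2_sec (single n a) 0 n.+1; rewrite sec_delta ltnSn.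
Qed.

Lemma ip_single n a (y : l2) : l2_ip (single n a) y = a^☆ ⋅ seq_of y n.
Proof.
apply: l2_ip_eq; apply: (tends_ev (N := n.+1)) => k nk.
by rewrite gram_delta nk.
Qed.

Definition mu_fun i j (a : U) (x : l2) : l2 := single i (a ⋅ seq_of x j).

Lemma mu_adjoint i j a :
  adjoint (H := l2_hilbert) (mu_fun i j a) (mu_fun j i (a^☆)).
Proof.
move=> x y; rewrite /= ip_single astarM -amulA.
by rewrite -[RHS]l2_ipC /mu_fun ip_single !astarM !astarK -?amulA.
Qed.

Lemma mu_adjointable i j a : adjointable (H := l2_hilbert) (mu_fun i j a).
Proof.
split; first by exists (mu_fun j i (a^☆)); exact: mu_adjoint.
exists (nrm a); split=> [|x]; first exact: nrm_ge0.
rewrite nrm_single (le_trans (nrmM _ _)) // ler_wpM2l ?nrm_ge0 //.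
exact: (nrm_le_l2 j (seq_ofP x)).
Qed.

(** The infinite matrix over [U] with the single entry [a], in position
    [(i, j)]. *)
Definition mu i j a : stable := mkop (mu_adjointable i j a).

Lemma single_ext n a b : a = b -> single n a = single n b.
Proof. by move=> ->. Qed.

Lemma mu_mul i j k l a b :
  mu i j a ⋅ mu k l b = if j == k then mu i l (a ⋅ b) else 0.
Proof.
apply: opval_inj => x; have [<-|jk] := eqVneq j k.
  by apply: single_ext; rewrite /= /seq_of /= /delta eqxx amulA.
apply: val_inj; apply/funext => n.
rewrite /= /seq_of /= /delta (negPf jk) amulx0; by case: ifP.
Qed.

Lemma mu_star i j a : (mu i j a)^☆ = mu j i (a^☆).
Proof. by apply: opstar_eq; exact: mu_adjoint. Qed.

Lemma muL i j (c : R[i]) a b : mu i j (c *: a + b) = c *: mu i j a + mu i j b.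
Proof.
apply: opval_inj => x; apply: val_inj; apply/funext => n.
rewrite /= /delta amulDl amulZl.
rewrite -[RHS]/(c *: (delta i (a ⋅ seq_of x j) n) + delta i (b ⋅ seq_of x j) n).
by rewrite /delta; case: ifP; rewrite // scaler0 addr0.
Qed.

Lemma muD i j a b : mu i j (a + b) = mu i j a + mu i j b.
Proof. by rewrite -[a]scale1r muL !scale1r. Qed.

Lemma mu0 i j : mu i j 0 = 0.
Proof. by apply: (addrI (mu i j 0)); rewrite -muD !addr0. Qed.

(* The vector with the single entry [a^*] is mapped to one with entry
   [a a^*]. *)
Lemma nrm_mu_ge i j a : nrm a <= nrm (mu i j a).
Proof.
have [a0|a0] := eqVneq (nrm a) 0; first by rewrite a0 nrm_ge0.
have n0 : 0 < nrm a by rewrite lt_neqAle nrm_ge0 eq_sym a0.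
rewrite -(ler_pM2r n0) -expr2 -nrmCCr -[in leRHS](nrm_astar a).
rewrite -[in leRHS](nrm_single j) -[leLHS](nrm_single i).
have := op_nrmP (mu i j a) (single j (a^☆)); congr (nrm _ <= _).
by apply: single_ext; rewrite /seq_of /= /delta eqxx.
Qed.

Lemma mu_hom n : star_hom (mu n n).
Proof.
split; first by move=> c a b; exact: muL.
  by move=> a b; rewrite mu_mul eqxx.
by move=> a; rewrite mu_star.
Qed.

End SquareSummable.

(** * Cuntz-Krieger families *)

Section CuntzKrieger.
Context {R : realType} {G : graph} {A : cstarAlgType R}.
Context {p : vertex G -> A} {s : edge G -> A}.

(** The algebraic relations equivalent to those of a Cuntz-Krieger family; the
    order relation becomes absorption by the source projection. *)
Record ck_relations : Prop := CKRelations {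
  ck_idem : forall v, p v ⋅ p v = p v;
  ck_proj_star : forall v, (p v)^☆ = p v;
  ck_proj_orth : forall v w, v <> w -> p v ⋅ p w = 0;
  ck_range : forall e, (s e)^☆ ⋅ s e = p (rng e);
  ck_source : forall e, p (src e) ⋅ s e = s e;
  ck_edge_orth : forall e f, e <> f -> (s e)^☆ ⋅ s f = 0;
  ck_sum : forall v, ~~ singular v ->
    p v = \sum_(e \in out_edges v) (s e ⋅ (s e)^☆)
}.

(** [(x - x q)^* (x - x q)] vanishes. *)
Lemma partial_isometry_mul (x q : A) : q ⋅ q = q -> q^☆ = q -> x^☆ ⋅ x = q ->
  x ⋅ q = x.
Proof.
move=> qq qs xq; apply/eqP; rewrite eq_sym -subr_eq0; apply/eqP/astar_mul_eq0.
rewrite astarB astarM qs amulBl !amulBr amulA xq -(amulA q) xq -amulA.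
by rewrite [x^☆ ⋅ _]amulA xq !qq !subrr.
Qed.

Lemma ck_relationsP : cuntz_krieger_family p s <-> ck_relations.
Proof.
split=> [[[pp po] [si so] sr ss sums]|[pp ps po sr ss so sums]].
  have sq e : projection (s e ⋅ (s e)^☆).
    by split; rewrite ?astarM ?astarK // !amulA (si e).
  split=> //.
  - by move=> v; case: (pp v).
  - by move=> v; case: (pp v).
  - move=> e; rewrite -{1}(si e) !amulA -(amulA (p _)).
    by rewrite (projection_absorb (pp _) (sq e) (ss e)); exact: si.
  - move=> e f ef.
    have h : (s e)^☆ = (s e)^☆ ⋅ (s e ⋅ (s e)^☆).
      by rewrite -{1}(si e) !astarM astarK.
    rewrite h -{1}(si f).
    transitivity ((s e)^☆ ⋅ ((s e ⋅ (s e)^☆) ⋅ (s f ⋅ (s f)^☆)) ⋅ s f).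
      by rewrite !amulA.
    by rewrite so // amulx0 amul0x.
have sr' e : s e ⋅ p (rng e) = s e by exact: partial_isometry_mul.
split=> //.
- split=> e; first by rewrite /partial_isometry -amulA sr sr'.
  by move=> f ef; rewrite -amulA [(s e)^☆ ⋅ _]amulA so // amul0x amulx0.
- move=> e; exists (p (src e) - s e ⋅ (s e)^☆).
  have h : (s e)^☆ ⋅ p (src e) = (s e)^☆.
    by rewrite -[LHS]astarK astarM astarK ps ss.
  rewrite astarB astarM astarK ps amulBl !amulBr pp -amulA h.
  rewrite [p (src e) ⋅ _]amulA ss -amulA [(s e)^☆ ⋅ (s e ⋅ _)]amulA sr.
  have {}h : p (rng e) ⋅ (s e)^☆ = (s e)^☆.
    by rewrite -[LHS]astarK astarM astarK ps sr'.
  by rewrite h subrr subr0.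
Qed.

Hypothesis CK : ck_relations.

Lemma ck_mul_range e : s e ⋅ p (rng e) = s e.
Proof. by apply: partial_isometry_mul; rewrite ?ck_idem ?ck_proj_star ?ck_range. Qed.

Lemma ck_proj_edge v e : p v ⋅ s e = if v == src e then s e else 0.
Proof.
have [->|/eqP ne] := eqVneq v (src e); first exact: ck_source.
by rewrite -(ck_source CK) amulA ck_proj_orth // amul0x.
Qed.

Lemma ck_star_proj v e : (s e)^☆ ⋅ p v = if v == src e then (s e)^☆ else 0.
Proof.
rewrite -[LHS]astarK astarM astarK ck_proj_star // ck_proj_edge.
by case: ifP => _; rewrite ?astar0.
Qed.

Lemma ck_edge_proj v e : s e ⋅ p v = if v == rng e then s e else 0.
Proof.
have [->|/eqP ne] := eqVneq v (rng e); first exact: ck_mul_range.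
by rewrite -(ck_mul_range e) -amulA ck_proj_orth ?amulx0 // => /esym.
Qed.

End CuntzKrieger.
Arguments ck_relations {R G A} p s.

Lemma nonsingular_finite (G : graph) (v : vertex G) :
  ~~ singular v -> finite_set (out_edges v).
Proof. by rewrite negb_or => /andP[_ /asboolPn /contrapT]. Qed.

Lemma ck_hom (R : realType) (G : graph) (A B : cstarAlgType R)
    (p : vertex G -> A) (s : edge G -> A) (phi : A -> B) : star_hom phi ->
  ck_relations p s -> ck_relations (phi \o p) (phi \o s).
Proof.
move=> hphi [pp ps po sr ss so sums].
have [_ pM pS] := hphi.
split=> /= [v|v|v w vw|e|e|e f ef|v sv]; rewrite -?pS -?pM ?pp ?ps ?sr ?ss //.
- by rewrite po // (star_hom0 hphi).
- by rewrite so // (star_hom0 hphi).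
- have fv := nonsingular_finite sv.
  rewrite sums // !fsbig_finite //=.
  rewrite (big_morph phi (star_homD hphi) (star_hom0 hphi)).
  by apply: eq_bigr => e _; rewrite pM pS.
Qed.

(** * Isomorphic graphs *)

Section GraphIsomorphism.
Context {G H : graph} {fv : vertex G -> vertex H} {fe : edge G -> edge H}.
Hypotheses (bv : bijective fv) (be : bijective fe).
Hypotheses (fr : forall e, rng (fe e) = fv (rng e)).
Hypotheses (fs : forall e, src (fe e) = fv (src e)).

Lemma iso_out_edges v : out_edges (fv v) = fe @` out_edges v.
Proof.
apply/seteqP; split=> [f /= sf|_ [e /= <- <-]]; last by rewrite /out_edges /= fs.
have [ge _ geK] := be; exists (ge f); last exact: geK.
by apply: (bij_inj bv); rewrite -fs geK.
Qed.

Lemma iso_singular v : singular (fv v) = singular v.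
Proof.
have ii : {in out_edges v &, injective fe} by move=> e f _ _; exact: bij_inj.
rewrite /singular /sink /infinite_emitter iso_out_edges; congr (_ || _).
  by apply: asbool_equiv_eq; split; [exact: image_set0_set0|move=> ->; rewrite image_set0].
apply: asbool_equiv_eq; split=> h fin; apply: h; first exact: finite_image.
apply: sub_finite_set (finite_preimage _ fin) => [e ev|e f _ _]; first by exists e.
exact: bij_inj.
Qed.

Lemma iso_ck (R : realType) (A : cstarAlgType R) (p : vertex H -> A)
    (s : edge H -> A) : ck_relations p s -> ck_relations (p \o fv) (s \o fe).
Proof.
move=> [pp ps po sr ss so sums]; split=> /= [v|v|v w vw|e|e|e f ef|v sv] //.
- by apply: po => /(bij_inj bv).
- by rewrite sr fr.
- by rewrite -fs ss.
- by apply: so => /(bij_inj be).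
- rewrite sums ?iso_singular // iso_out_edges fsbig_image // => e f _ _.
  exact: bij_inj.
Qed.

End GraphIsomorphism.

Lemma iso_graph_algebra (R : realType) (G H : graph) (A : cstarAlgType R)
    (p : vertex H -> A) (s : edge H -> A) (fv : vertex G -> vertex H)
    (fe : edge G -> edge H) : bijective fv -> bijective fe ->
  (forall e, rng (fe e) = fv (rng e)) -> (forall e, src (fe e) = fv (src e)) ->
  is_graph_algebra p s -> is_graph_algebra (p \o fv) (s \o fe).
Proof.
move=> bv be fr fs [/ck_relationsP CK gen univ].
have [gv fvK gvK] := bv; have [ge feK geK] := be.
split; first exact/ck_relationsP/iso_ck.
  move=> S hS sub; apply: gen => // x [[v _ <-]|[e _ <-]]; apply: sub.
    by left; exists (gv v); rewrite //= gvK.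
  by right; exists (ge e); rewrite //= geK.
move=> B q t /ck_relationsP ckq.
have /univ[phi [hphi pv pe]] : cuntz_krieger_family (q \o gv) (t \o ge).
  apply/ck_relationsP; apply: iso_ck => //.
  - by exists fv.
  - by exists fe.
  - by move=> e; apply: (can_inj fvK); rewrite gvK -fr geK.
  - by move=> e; apply: (can_inj fvK); rewrite gvK -fs geK.
exists phi; split=> // [v|e]; first by rewrite /= pv /= fvK.
by rewrite /= pe /= feK.
Qed.

(** * The shape of a desingularization *)

Section DesingularizationShape.
Context {E : graph} (g : listing E).
Local Notation D := (desingularization g).
Local Notation sing := {v : vertex E | singular v}.
Local Notation emit := {v : vertex E | infinite_emitter v}.
Local Notation kept := {e : edge E | ~~ infinite_emitter (src e)}.

Definition old (v : vertex E) : vertex D := inl v.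
Definition tail (v : sing) n : vertex D := tail_vertex v n.
Definition kept_edge (e : kept) : edge D := inl e.
Definition tail_edge (v : sing) n : edge D := inr (inl (v, n)).
Definition new_edge (w : emit) n : edge D := inr (inr (w, n)).

Lemma src_listed (w : emit) n : src (g w n) = val w.
Proof. by have [/(_ n I)] := nth_edge_bij g w. Qed.

Lemma listed_inj (w w' : emit) n n' : g w n = g w' n' -> w = w' /\ n = n'.
Proof.
move=> h; have ww : w = w'.
  by apply: val_inj; rewrite -(src_listed w n) h src_listed.
split=> //; rewrite -ww in h; have [_ inj _] := nth_edge_bij g w.
by apply: inj => //; exact: in_setT.
Qed.

Lemma edge_cases (e : edge E) :
  (exists k : kept, e = val k) \/ (exists (w : emit) n, e = g w n).
Proof.
case: (boolP (infinite_emitter (src e))) => he; last first.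
  by left; exists (Sub e he).
right; exists (Sub (src e) he).
have [_ _ /(_ e)] := nth_edge_bij g (Sub (src e) he).
by case=> // n _ gn; exists n; rewrite gn.
Qed.

Lemma vertex_cases (u : vertex D) :
  (exists (v : sing) n, u = tail v n) \/ (exists2 v, ~~ singular v & u = old v).
Proof.
case: u => [v|[v n]]; last by left; exists v, n.+1.
case: (boolP (singular v)) => sv; last by right; exists v.
by left; exists (Sub v sv), 0%N.
Qed.

Lemma vertex_old_tail (u : vertex D) :
  (exists v, u = old v) \/ (exists (v : sing) n, u = tail v n.+1).
Proof. by case: u => [v|[v n]]; [left; exists v|right; exists v, n]. Qed.

Lemma emitter_cases (v : sing) :
  (exists2 w : emit, v = singular_of_emitter w & insub (val v) = Some w)
  \/ (~~ infinite_emitter (val v) /\ insub (val v) = None :> option emit).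
Proof.
case: insubP => [w hw wv|h]; last by right.
by left; exists w => //; apply: val_inj; rewrite -wv.
Qed.

Lemma tail_src_kept (k : kept) (v : sing) : src (val k) <> val v.
Proof.
move=> kv; have := valP v; rewrite -kv /singular (negPf (valP k)) orbF.
move/asboolP => h; have : out_edges (src (val k)) (val k) by [].
by rewrite h.
Qed.

(** Sinks and infinite emitters are treated alike: at a sink the second part
    is empty. *)
Lemma tail_out_edges (v : sing) n : out_edges (tail v n) =
  [set tail_edge v n] `|`
  (if insub (val v) is Some w then [set new_edge w n] else set0).
Proof.
have tail_inj (v' : sing) n' : tail v' n' = tail v n -> v' = v /\ n' = n.
  by case: n n' => [|n] [|n'] //= [] => [/val_inj ->|-> ->].
apply/seteqP; split=> [|e].
  case=> [k|[[v' n']|[w n']]] /= sE.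
  - by case: n {tail_inj} sE => // -[] /tail_src_kept.
  - by have [vv nn] := tail_inj _ _ sE; left; rewrite /= vv nn.
  - by have [vv nn] := tail_inj _ _ sE; right; rewrite -vv /= valK /= nn.
case=> [->//|]; case: (emitter_cases v) => [[w vw]|[_]] -> //= ->.
by rewrite vw.
Qed.

Lemma sum_tail_out_edges (V : nmodType) (F : edge D -> V) (v : sing) n :
  \sum_(e \in out_edges (tail v n)) F e =
  F (tail_edge v n) + (if insub (val v) is Some w then F (new_edge w n) else 0).
Proof.
rewrite tail_out_edges; case: insub => [w|]; last first.
  by rewrite setU0 fsbig_set1 addr0.
rewrite fsbigU0; try exact: finite_set1; first by rewrite !fsbig_set1.
by move=> e [] /= ->.
Qed.

Lemma tail_nonsingular (v : sing) n : ~~ singular (tail v n).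
Proof.
rewrite negb_or; apply/andP; split; apply/asboolPn.
  by move=> h; have : out_edges (tail v n) (tail_edge v n) by []; rewrite h.
case; rewrite tail_out_edges finite_setU; split; first exact: finite_set1.
by case: insub => [w|]; [exact: finite_set1|exact: finite_set0].
Qed.

Lemma old_out_edges v : ~~ singular v ->
  out_edges (old v) = kept_edge @` [set k | src (val k) = v].
Proof.
move=> sv; apply/seteqP; split=> [|_ [k /= <- <-]//].
case=> [k|[[v' n]|[w n]]] /=; first by case=> kv; exists k.
  case: n => // -[] vv; have := valP v'.
  by rewrite (vv : val v' = v) (negPf sv).
case: n => // -[] vv; have := valP (singular_of_emitter w).
by rewrite (vv : val (singular_of_emitter w) = v) (negPf sv).
Qed.

Lemma kept_out_edges v : ~~ singular v ->
  out_edges v = val @` [set k : kept | src (val k) = v].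
Proof.
move=> sv; apply/seteqP; split=> [e /= ev|_ [k /= <- <-]//].
have he : ~~ infinite_emitter (src e).
  by move: sv; rewrite ev negb_or => /andP[].
by exists (Sub e he).
Qed.

Lemma sum_old_out_edges (V : nmodType) (F : edge D -> V) (F' : edge E -> V) v :
  (forall k, F (kept_edge k) = F' (val k)) -> ~~ singular v ->
  \sum_(e \in out_edges (old v)) F e = \sum_(e \in out_edges v) F' e.
Proof.
move=> FF sv; rewrite old_out_edges // kept_out_edges // !fsbig_image.
- by apply: eq_fsbigr => k _; rewrite FF.
- by move=> k k' _ _ /val_inj.
- by move=> k k' _ _ [].
Qed.

Lemma old_nonsingular v : ~~ singular v -> ~~ singular (old v).
Proof.
move=> sv; rewrite negb_or; apply/andP; split; apply/asboolPn.
  rewrite old_out_edges // => /image_set0_set0 h.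
  move: (sv); rewrite negb_or => /andP[/asboolPn + _]; apply.
  by rewrite kept_out_edges ?h ?image_set0.
case; rewrite old_out_edges //; apply: finite_image.
have := nonsingular_finite sv; rewrite kept_out_edges // => fin.
apply: sub_finite_set (finite_preimage _ fin) => [k kv|k k' _ _]; first by exists k.
exact: val_inj.
Qed.

End DesingularizationShape.

(** * From the graph to its desingularization *)

Section TailProjections.
Context {R : realType} {E : graph} (g : listing E) {A : cstarAlgType R}.
Context {p : vertex E -> A} {s : edge E -> A} (CK : ck_relations p s).
Local Notation sing := {v : vertex E | singular v}.
Local Notation emit := {v : vertex E | infinite_emitter v}.

(** The value [0] at a sink allows both kinds of singular vertices to be
    treated alike. *)
Definition listed (v : sing) n : A :=
  if insub (val v) is Some w then s (g w n) else 0.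

(** The projection that the [n]-th vertex of the tail at [v] receives. *)
Definition tail_proj (v : sing) n : A :=
  p (val v) - \sum_(i < n) listed v i ⋅ (listed v i)^☆.

Lemma listed_emitter (w : emit) n : listed (singular_of_emitter w) n = s (g w n).
Proof. by rewrite /listed valK. Qed.

Lemma listed_source (v : sing) n : p (val v) ⋅ listed v n = listed v n.
Proof.
rewrite /listed; case: insubP => [w hw wv|_]; last exact: amulx0.
by rewrite (ck_proj_edge CK) src_listed -wv eqxx.
Qed.

Lemma listed_orth (v w : sing) n m : v <> w \/ n <> m ->
  (listed v n)^☆ ⋅ listed w m = 0.
Proof.
move=> vw; rewrite /listed; case: insubP => [v' _ vv|_]; last first.
  by rewrite astar0 amul0x.
case: insubP => [w' _ ww|_]; last exact: amulx0.
apply: (ck_edge_orth CK) => /listed_inj[vw' nm]; case: vw; last by [].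
by apply; apply: val_inj; rewrite -vv -ww vw'.
Qed.

Lemma proj_listed (v w : sing) n : v <> w -> p (val v) ⋅ listed w n = 0.
Proof.
move=> vw; rewrite -(listed_source w) amulA (ck_proj_orth CK) ?amul0x //.
by move/val_inj.
Qed.

Lemma tail_proj0 v : tail_proj v 0 = p (val v).
Proof. by rewrite /tail_proj big_ord0 subr0. Qed.

Lemma tail_projS v n :
  tail_proj v n = tail_proj v n.+1 + listed v n ⋅ (listed v n)^☆.
Proof. by rewrite /tail_proj big_ord_recr /= opprD addrA subrK. Qed.

Lemma tail_proj_star v n : (tail_proj v n)^☆ = tail_proj v n.
Proof.
rewrite /tail_proj astarB (ck_proj_star CK) astar_sum; congr (_ - _).
by apply: eq_bigr => i _; rewrite astarM astarK.
Qed.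

Lemma tail_proj_listed v n k :
  tail_proj v n ⋅ listed v k = if (k < n)%N then 0 else listed v k.
Proof.
elim: n => [|n IH]; first by rewrite tail_proj0 listed_source.
have -> : tail_proj v n.+1 = tail_proj v n - listed v n ⋅ (listed v n)^☆.
  by rewrite [tail_proj v n]tail_projS addrK.
rewrite amulBl IH -amulA; have [->|nk] := eqVneq k n.
  rewrite ltnn ltnSn /listed; case: insub => [w|]; last by rewrite amul0x subr0.
  rewrite (ck_range CK) (ck_edge_proj CK) eqxx subrr //.
rewrite listed_orth ?amulx0 ?subr0; last by right; move/esym/eqP; rewrite (negPf nk).
by rewrite [in RHS]ltnS [in RHS]leq_eqVlt (negPf nk).
Qed.

Lemma tail_proj_listed_orth v w n k : v <> w -> tail_proj v n ⋅ listed w k = 0.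
Proof.
move=> vw; rewrite amulBl proj_listed // amul_suml big1 ?subr0 // => i _.
by rewrite -amulA listed_orth ?amulx0 //; left.
Qed.

Lemma proj_tail_proj v n : p (val v) ⋅ tail_proj v n = tail_proj v n.
Proof.
rewrite amulBr (ck_idem CK) amul_sumr; congr (_ - _); apply: eq_bigr => i _.
by rewrite amulA listed_source.
Qed.

Lemma tail_proj_proj v n : tail_proj v n ⋅ p (val v) = tail_proj v n.
Proof.
by rewrite -[LHS]astarK astarM tail_proj_star (ck_proj_star CK) proj_tail_proj
  tail_proj_star.
Qed.

Lemma tail_proj_le v n k : (n <= k)%N -> tail_proj v n ⋅ tail_proj v k = tail_proj v k.
Proof.
move=> nk; have step m : (m < k)%N -> (listed v m)^☆ ⋅ tail_proj v k = 0.
  move=> mk; rewrite -[LHS]astarK astarM astarK tail_proj_star.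
  by rewrite tail_proj_listed mk astar0.
rewrite {1}/tail_proj amulBl proj_tail_proj amul_suml big1 ?subr0 // => i _.
by rewrite -amulA step ?amulx0 // (leq_trans (ltn_ord i)).
Qed.

Lemma tail_proj_orth v w n m : v <> w -> tail_proj v n ⋅ tail_proj w m = 0.
Proof.
move=> vw; rewrite -(tail_proj_proj v n) -(proj_tail_proj w m) -amulA.
by rewrite (amulA (p _)) (ck_proj_orth CK) ?amul0x ?amulx0 // => /val_inj.
Qed.

End TailProjections.

Section DesingularizedFamily.
Context {R : realType} {E : graph} (g : listing E) {U : cstarAlgType R} {e : U}.
Context {p : vertex E -> U} {s : edge E -> U} (CK : ck_relations p s).
Hypotheses (e1x : forall x, e ⋅ x = x) (ex1 : forall x, x ⋅ e = x).
Local Notation D := (desingularization g).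
Local Notation sing := {v : vertex E | singular v}.
Local Notation emit := {v : vertex E | infinite_emitter v}.
Local Notation B := (stable e1x ex1).
Local Notation mu := (mu e1x ex1).
Local Notation P := (tail_proj g (p := p) (s := s)).

(** The vertex at position [n] of the tail at [v] is represented by the
    remaining projection [tail_proj v n] in position [(n, n)] of an infinite
    matrix. Tails at distinct vertices may share the same matrix positions,
    since their projections are orthogonal. *)
Definition desing_proj (u : vertex D) : B :=
  match u with
  | inl v => mu 0 0 (p v)
  | inr (v, n) => mu n.+1 n.+1 (P v n.+1)
  end.

Definition desing_iso (f : edge D) : B :=
  match f with
  | inl k => mu 0 0 (s (val k))
  | inr (inl (v, n)) => mu n n.+1 (P v n.+1)
  | inr (inr (w, n)) => mu n 0 (s (g w n))
  end.

Lemma desing_proj_tail v n : desing_proj (tail g v n) = mu n n (P v n).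
Proof. by case: n => [|n] //=; rewrite tail_proj0. Qed.

Lemma tail_kept_orth (k : {e : edge E | ~~ infinite_emitter (src e)}) v n :
  (s (val k))^☆ ⋅ P v n = 0.
Proof.
rewrite -(proj_tail_proj g CK) amulA (ck_star_proj CK).
by case: eqP => [/esym/tail_src_kept //|_]; rewrite amul0x.
Qed.

Lemma desing_edge_orth (f f' : edge D) : f <> f' ->
  (desing_iso f)^☆ ⋅ desing_iso f' = 0.
Proof.
have sym (x y : B) : x^☆ ⋅ y = 0 -> y^☆ ⋅ x = 0.
  by move=> h; rewrite -[LHS]astarK astarM astarK h astar0.
have kt (k : {e : edge E | ~~ infinite_emitter (src e)}) v n :
    (mu 0 0 (s (val k)))^☆ ⋅ mu n n.+1 (P v n.+1) = 0.
  rewrite mu_star mu_mul; case: eqP => // <-.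
  by rewrite tail_kept_orth mu0.
have kn (k : {e : edge E | ~~ infinite_emitter (src e)}) w n :
    (mu 0 0 (s (val k)))^☆ ⋅ mu n 0 (s (g w n)) = 0.
  rewrite mu_star mu_mul; case: eqP => // _; rewrite (ck_edge_orth CK) ?mu0 //.
  move=> kE; have := valP k; rewrite kE src_listed.
  by rewrite (valP w).
have tn v n w m : (mu n n.+1 (P v n.+1))^☆ ⋅ mu m 0 (s (g w m)) = 0.
  rewrite mu_star mu_mul tail_proj_star //; case: eqP => // <-.
  rewrite -(listed_emitter g (s := s)).
  have [->|/eqP vw] := eqVneq v (singular_of_emitter w).
    by rewrite (tail_proj_listed g CK) ltnSn mu0.
  by rewrite (tail_proj_listed_orth g CK) // mu0.
case: f f' => [k|[[v n]|[w n]]] [k'|[[v' n']|[w' n']]] //= ff.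
- rewrite mu_star mu_mul /= (ck_edge_orth CK) ?mu0 // => /val_inj kk.
  by apply: ff; rewrite kk.
- exact: kt.
- exact: kn.
- exact/sym/kt.
- rewrite mu_star mu_mul (tail_proj_star g CK); case: eqP => // nn.
  rewrite (tail_proj_orth g CK) ?mu0 // => vv.
  by apply: ff; rewrite nn vv.
- exact/sym/kn.
- exact/sym/tn.
- rewrite mu_star mu_mul; case: eqP => // nn.
  rewrite (ck_edge_orth CK) ?mu0 // => /listed_inj[ww _].
  by apply: ff; rewrite nn ww.
Qed.

Lemma desing_family : ck_relations desing_proj desing_iso.
Proof.
split.
- case=> [v|[v n]] /=; rewrite mu_mul eqxx; first by rewrite (ck_idem CK).
  by rewrite (tail_proj_le g CK).
- case=> [v|[v n]] /=; rewrite mu_star; first by rewrite (ck_proj_star CK).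
  by rewrite tail_proj_star.
- case=> [v|[v n]] [w|[w m]] //= vw; rewrite mu_mul //=.
    by rewrite (ck_proj_orth CK) ?mu0 // => vE; apply: vw; rewrite vE.
  rewrite eqSS; case: eqP => // nm; rewrite (tail_proj_orth g CK) ?mu0 // => vE.
  by apply: vw; rewrite vE nm.
- case=> [k|[[v n]|[w n]]] /=; rewrite mu_star mu_mul eqxx ?(ck_range CK) //.
  by rewrite tail_proj_star // (tail_proj_le g CK).
- case=> [k|[[v n]|[w n]]] /=.
  + by rewrite mu_mul /= (ck_source CK).
  + have := desing_proj_tail v n; rewrite /tail /= => ->.
    by rewrite mu_mul eqxx (tail_proj_le g CK).
  + have := desing_proj_tail (singular_of_emitter w) n; rewrite /tail /= => ->.
    rewrite mu_mul eqxx -(listed_emitter g (s := s)) (tail_proj_listed g CK).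
    by rewrite ltnn.
- exact: desing_edge_orth.
- move=> u _; case: (vertex_cases u) => [[v [n ->]]|[v sv ->]].
    rewrite sum_tail_out_edges desing_proj_tail tail_projS muD; congr (_ + _).
      by rewrite /= mu_star mu_mul eqxx tail_proj_star // (tail_proj_le g CK).
    rewrite /listed; case: insub => [w|] /=; last by rewrite amul0x mu0.
    by rewrite mu_star mu_mul eqxx.
  have hom := mu_hom e1x ex1 0.
  rewrite (sum_old_out_edges (F' := fun f => mu 0 0 (s f ⋅ (s f)^☆))) //.
    have fin := nonsingular_finite sv.
    rewrite /= (ck_sum CK sv) !fsbig_finite //.
    exact: (big_morph _ (star_homD hom) (star_hom0 hom)).
  by move=> k /=; rewrite mu_star mu_mul.
Qed.

End DesingularizedFamily.

(** * From the desingularization to the graph *)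

Section ContractedFamily.
Context {R : realType} {E : graph} (g : listing E) {A : cstarAlgType R}.
Local Notation D := (desingularization g).
Local Notation sing := {v : vertex E | singular v}.
Local Notation emit := {v : vertex E | infinite_emitter v}.
Context {q : vertex D -> A} {t : edge D -> A} (CK : ck_relations q t).

(** The partial isometry of the path that follows the tail at [v] up to its
    [n]-th vertex. *)
Fixpoint tail_path (v : sing) n : A :=
  if n is m.+1 then tail_path v m ⋅ t (tail_edge g v m) else q (old g (val v)).

Definition contracted_iso (e : edge E) : A :=
  if insub e is Some k then t (kept_edge g k) else
  if pselect (exists w : emit * nat, g w.1 w.2 = e) is left h then
    let w := sval (cid h) in
    tail_path (singular_of_emitter w.1) w.2 ⋅ t (new_edge g w.1 w.2)
  else 0.

Definition contracted_proj (v : vertex E) : A := q (old g v).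

Lemma contracted_kept k : contracted_iso (val k) = t (kept_edge g k).
Proof. by rewrite /contracted_iso valK. Qed.

Lemma contracted_listed (w : emit) n : contracted_iso (g w n) =
  tail_path (singular_of_emitter w) n ⋅ t (new_edge g w n).
Proof.
rewrite /contracted_iso; case: insubP => [k|_].
  by rewrite src_listed (valP w).
case: pselect => [h|[]]; last by exists (w, n).
case: (cid h) => -[w' n'] /= /listed_inj[-> ->] //.
Qed.

Lemma tail_path_source v n : q (old g (val v)) ⋅ tail_path v n = tail_path v n.
Proof.
elim: n => [|n IH] /=; first exact: (ck_idem CK).
by rewrite amulA IH.
Qed.

Lemma tail_path_star_mul v n : (tail_path v n)^☆ ⋅ tail_path v n = q (tail g v n).
Proof.
elim: n => [|n IH] /=; first by rewrite (ck_proj_star CK) (ck_idem CK).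
rewrite astarM amulA -(amulA (t _)^☆) IH -amulA.
have := ck_source CK (tail_edge g v n); rewrite /= -/(tail g v n) => ->.
by rewrite (ck_range CK).
Qed.

Lemma tail_path_range v n : tail_path v n ⋅ q (tail g v n) = tail_path v n.
Proof.
by apply: partial_isometry_mul;
  rewrite ?(ck_idem CK) ?(ck_proj_star CK) ?tail_path_star_mul.
Qed.

Lemma tail_path_orth v w n m : v <> w -> (tail_path v n)^☆ ⋅ tail_path w m = 0.
Proof.
move=> vw; rewrite -(tail_path_source v) -(tail_path_source w) astarM.
rewrite (ck_proj_star CK) !amulA -(amulA _ (q (old g (val v)))).
rewrite (ck_proj_orth CK).
  by rewrite amulx0 amul0x.
by case=> /val_inj.
Qed.

(** Both paths run along the tail to its [n]-th vertex and continue from there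
    with different edges, whose ranges are orthogonal. *)
Lemma new_tail_path (w : emit) n m : (n < m)%N ->
  (tail_path (singular_of_emitter w) n ⋅ t (new_edge g w n))^☆ ⋅
    tail_path (singular_of_emitter w) m = 0.
Proof.
set v := singular_of_emitter w; elim: m => // m IH; rewrite ltnS leq_eqVlt.
case/predU1P=> [<-|/IH h] /=; last by rewrite amulA h amul0x.
rewrite astarM amulA -(amulA (t _)^☆) tail_path_star_mul.
rewrite (ck_star_proj CK) /= eqxx; exact: (ck_edge_orth CK).
Qed.

Lemma listed_listed_orth (w : emit) n m : n <> m ->
  (tail_path (singular_of_emitter w) n ⋅ t (new_edge g w n))^☆ ⋅
  (tail_path (singular_of_emitter w) m ⋅ t (new_edge g w m)) = 0.
Proof.
move=> nm; have [lt|gt|//] := ltngtP n m.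
  by rewrite amulA new_tail_path // amul0x.
rewrite -[LHS]astarK astarM astarK amulA new_tail_path // amul0x astar0 //.
Qed.

Lemma contracted_family : ck_relations contracted_proj contracted_iso.
Proof.
split.
- by move=> v; exact: (ck_idem CK).
- by move=> v; exact: (ck_proj_star CK).
- by move=> v w vw; apply: (ck_proj_orth CK) => -[].
- move=> e; case: (edge_cases g e) => [[k ->]|[w [n ->]]].
    by rewrite contracted_kept (ck_range CK).
  rewrite contracted_listed astarM amulA -(amulA (t _)^☆) tail_path_star_mul.
  by rewrite (ck_star_proj CK) /= eqxx (ck_range CK).
- move=> e; case: (edge_cases g e) => [[k ->]|[w [n ->]]].
    by rewrite contracted_kept (ck_source CK (kept_edge g k)).
  by rewrite contracted_listed src_listed amulA (tail_path_source (singular_of_emitter w)).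
- have kn (k : {e : edge E | ~~ infinite_emitter (src e)}) w n :
      (contracted_iso (val k))^☆ ⋅ contracted_iso (g w n) = 0.
    rewrite contracted_kept contracted_listed -tail_path_source !amulA.
    rewrite (ck_star_proj CK) /=; case: eqP => [[wk]|_]; last by rewrite !amul0x.
    by have := valP k; rewrite -wk (valP w).
  move=> e f; case: (edge_cases g e) => [[k ->]|[w [n ->]]];
    case: (edge_cases g f) => [[k' ->]|[w' [n' ->]]] ef.
  + rewrite !contracted_kept; apply: (ck_edge_orth CK) => -[kk].
    by apply: ef; rewrite kk.
  + exact: kn.
  + by rewrite -[LHS]astarK astarM astarK kn astar0.
  + rewrite !contracted_listed; have [ww|/eqP ww] := eqVneq w w'.
      rewrite -ww; apply: listed_listed_orth => nn; apply: ef.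
      by rewrite ww nn.
    rewrite astarM -!amulA (amulA (tail_path _ _)^☆) tail_path_orth.
      by rewrite amul0x amulx0.
    by move=> [wE]; apply: ww; exact: val_inj.
- move=> v sv; rewrite /contracted_proj (ck_sum CK) ?old_nonsingular //.
  by apply: sum_old_out_edges => // k; rewrite contracted_kept.
Qed.

(** The Cuntz-Krieger relation at the [n]-th vertex of the tail splits the range
    of the path to it into the range of the path to the next vertex and that of
    the [n]-th listed edge of the graph. *)
Lemma tail_path_mul_star v n : tail_path v n ⋅ (tail_path v n)^☆ =
  tail_proj g (p := contracted_proj) (s := contracted_iso) v n.
Proof.
elim: n => [|n IH].
  by rewrite tail_proj0 /= (ck_proj_star CK) (ck_idem CK).
have := IH; rewrite tail_projS -{1}tail_path_range -amulA.
have qs : q (tail g v n) ⋅ (tail_path v n)^☆ = (tail_path v n)^☆.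
  by rewrite -[LHS]astarK astarM astarK (ck_proj_star CK) tail_path_range.
rewrite (ck_sum CK (tail_nonsingular g v n)) sum_tail_out_edges.
rewrite amulDl amulDr => h.
apply: (addIr (listed g (s := contracted_iso) v n ⋅
  (listed g (s := contracted_iso) v n)^☆)).
rewrite -h /= astarM !amulA; congr (_ + _).
rewrite /listed; case: (emitter_cases v) => [[w vw ->]|[_ ->]]; last first.
  by rewrite amulx0 !amul0x.
by rewrite contracted_listed astarM vw !amulA.
Qed.

End ContractedFamily.

(** * Partial sums of vertex projections *)

Section VertexProjections.
Context {R : realType} {G : graph} {A : cstarAlgType R}.
Context {p : vertex G -> A} {s : edge G -> A}.
Hypothesis GA : is_graph_algebra p s.
Implicit Types (V : {pred vertex G}) (a b x y : A).

Lemma graph_algebra_ck : ck_relations p s.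
Proof. by case: GA => /ck_relationsP. Qed.
Local Notation CK := graph_algebra_ck.

(** Every generator is a multiple of a vertex projection on the left, and so is
    its adjoint. *)
Lemma right_ideal_full (S : set A) : closed_subspace S ->
  (forall x y, S x -> S (x ⋅ y)) -> (forall v, S (p v)) -> forall x, S x.
Proof.
move=> [cS S0 SD SZ] SM Sp.
have St e : S (s e) by rewrite -(ck_source CK); exact: SM.
have Ss e : S ((s e)^☆).
  by rewrite -(ck_mul_range CK) astarM (ck_proj_star CK); exact: SM.
have [_ gen _] := GA.
have T : [set x | S x /\ S (x^☆)] = setT.
  apply: gen; last first.
    move=> _ [[v _ <-]|[e _ <-]]; last by split.
    by split=> //; rewrite (ck_proj_star CK).
  split.
  - split.
    + apply: tends_closed => u x uS ux; split.
        by apply: (closed_tends cS _ ux) => n; case: (uS n).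
      by apply: (closed_tends cS _ (tends_astar ux)) => n; case: (uS n).
    + by split; rewrite ?astar0.
    + by move=> x y [? ?] [? ?]; split; rewrite ?astarD; exact: SD.
    + by move=> c x [? ?]; split; rewrite ?astarZ; exact: SZ.
  - by move=> x y [? ?] [? ?]; split; rewrite ?astarM; exact: SM.
  - by move=> x [? ?]; split; rewrite ?astarK.
by move=> x; have [] : [set x | S x /\ S (x^☆)] x by rewrite T.
Qed.

(** Vertices are enumerated by [pickle]; its sharp partial inverse guarantees
    that each of them occurs only once. *)
Definition vproj_term V i : A :=
  if pickle_inv i is Some v then (if v \in V then p v else 0) else 0.

Definition vproj V n : A := \sum_(i < n) vproj_term V i.

Lemma vproj_proj V n w : vproj V n ⋅ p w =
  if (w \in V) && (pickle w < n)%N then p w else 0.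
Proof.
have term i : vproj_term V i ⋅ p w =
    if (w \in V) && (i == pickle w) then p w else 0.
  rewrite /vproj_term; have [->|ne] := eqVneq i (pickle w).
    rewrite pickleK_inv; case: ifP => /=; last by rewrite amul0x.
    by rewrite (ck_idem CK).
  rewrite andbF; case E : (pickle_inv i) => [v|]; last exact: amul0x.
  case: ifP => _; rewrite ?amul0x // (ck_proj_orth CK) // => vw.
  have := @pickle_invK (vertex G) i; rewrite /oapp E vw => iE.
  by move: ne; rewrite -iE eqxx.
rewrite amul_suml; elim: n => [|n IH]; first by rewrite big_ord0 andbF.
rewrite big_ord_recr /= IH term; case: (w \in V) => /=; last by rewrite addr0.
rewrite [(pickle w < n.+1)%N]ltnS [(pickle w <= n)%N]leq_eqVlt [n == _]eq_sym.
by have [<-|] := eqVneq (pickle w) n; rewrite ?ltnn ?add0r ?addr0.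
Qed.

Lemma vproj_star V n : (vproj V n)^☆ = vproj V n.
Proof.
rewrite astar_sum; apply: eq_bigr => i _; rewrite /vproj_term.
case: pickle_inv => [v|]; last exact: astar0.
by case: ifP => _; rewrite ?astar0 ?(ck_proj_star CK).
Qed.

Lemma vproj_mul V n m : (n <= m)%N -> vproj V n ⋅ vproj V m = vproj V n.
Proof.
move=> nm; rewrite -[LHS]astarK astarM !vproj_star.
rewrite -[RHS]vproj_star astar_sum amul_sumr astar_sum.
apply: eq_bigr => i _; rewrite /vproj_term.
case E : (pickle_inv i) => [v|]; last by rewrite amulx0.
case: ifP => vV; last by rewrite amulx0.
have iE := @pickle_invK (vertex G) i; rewrite /oapp E in iE.
rewrite vproj_proj vV iE.
by rewrite (leq_trans (ltn_ord i)).
Qed.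

Lemma nrm_vproj V n : nrm (vproj V n) <= 1.
Proof.
have h : nrm (vproj V n) = nrm (vproj V n) ^+ 2.
  by rewrite -nrm_sa ?vproj_star // vproj_mul.
by have := nrm_ge0 (vproj V n); nra.
Qed.

Lemma nrm_vproj_mul V n x : nrm (vproj V n ⋅ x) <= nrm x.
Proof.
apply: (le_trans (nrmM _ _)); apply: ler_piMl; first exact: nrm_ge0.
exact: nrm_vproj.
Qed.

Lemma vproj_lip V n x y :
  nrm (vproj V n ⋅ x - vproj V n ⋅ y) <= nrm (x - y).
Proof. by rewrite -amulBr nrm_vproj_mul. Qed.

(** The elements for which the partial sums converge form a closed right ideal,
    because the partial sums are uniformly bounded. *)
Lemma vproj_cvg V x : exists y, tends (fun n => vproj V n ⋅ x) y.
Proof.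
pose S := [set x | is_cauchy (fun n => vproj V n ⋅ x)].
suff: S x by exact: cauchy_tends.
apply: right_ideal_full.
- split.
  + apply: tends_closed => u y Su uy d d0.
    have [K hK] := uy (d / 3) ltac:(lra).
    have [N hN] := Su K (d / 3) ltac:(lra); exists N => m n Nm Nn.
    have h1 := hN m n Nm Nn; have h2 := hK K (leqnn K).
    apply: (le_trans (nrm_split (vproj V m ⋅ u K) _ _)).
    have h3 := nrm_split (vproj V n ⋅ u K) (vproj V m ⋅ u K) (vproj V n ⋅ y).
    have h4 := vproj_lip V m y (u K); rewrite [nrm (y - _)]nrmB in h4.
    have h5 := vproj_lip V n (u K) y.
    by lra.
  + by apply: (tends_cauchy (x := 0)); apply: (tends_ev (N := 0)) => n _;
      rewrite amulx0.
  + move=> y z /cauchy_tends[y' hy] /cauchy_tends[z' hz].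
    apply: (tends_cauchy (x := y' + z')); apply: tends_ext (tendsD hy hz) => n.
    by rewrite amulDr.
  + move=> c y /cauchy_tends[y' hy]; apply: (tends_cauchy (x := c *: y')).
    by apply: tends_ext (tendsZ c hy) => n; rewrite amulZr.
- move=> y z /cauchy_tends[y' hy]; apply: (tends_cauchy (x := y' ⋅ z)).
  by apply: tends_ext (tendsMr z hy) => n; rewrite amulA.
- move=> v; apply: (tends_cauchy (x := if v \in V then p v else 0)).
  apply: (tends_ev (N := (pickle v).+1)) => n nv.
  by rewrite vproj_proj nv andbT.
Qed.

(** Left multiplication by the projection [sum_(v in V) p v] of the multiplier
    algebra. *)
Definition vlim V x : A := sval (cid (vproj_cvg V x)).

Lemma vlimP V x : tends (fun n => vproj V n ⋅ x) (vlim V x).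
Proof. exact: svalP (cid (vproj_cvg V x)). Qed.

Lemma vlim_eq V x y : tends (fun n => vproj V n ⋅ x) y -> vlim V x = y.
Proof. exact: tends_uniq (vlimP V x). Qed.

Lemma vlimD V x y : vlim V (x + y) = vlim V x + vlim V y.
Proof.
apply: vlim_eq; apply: tends_ext (tendsD (vlimP V x) (vlimP V y)) => n.
by rewrite amulDr.
Qed.

Lemma vlimZ V (c : R[i]) x : vlim V (c *: x) = c *: vlim V x.
Proof.
apply: vlim_eq; apply: tends_ext (tendsZ c (vlimP V x)) => n.
by rewrite amulZr.
Qed.

Lemma vlimM V x y : vlim V (x ⋅ y) = vlim V x ⋅ y.
Proof.
apply: vlim_eq; apply: tends_ext (tendsMr y (vlimP V x)) => n.
by rewrite amulA.
Qed.

Lemma vlimB V x y : vlim V (x - y) = vlim V x - vlim V y.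
Proof. by rewrite vlimD -scaleN1r vlimZ scaleN1r. Qed.

Lemma nrm_vlim V x : nrm (vlim V x) <= nrm x.
Proof.
by apply: (tends_le (N := 0) (vlimP V x)) => n _; exact: nrm_vproj_mul.
Qed.

Lemma vlim_lip V x y : nrm (vlim V x - vlim V y) <= 1 * nrm (x - y).
Proof. by rewrite -vlimB mul1r nrm_vlim. Qed.

Lemma vproj_vlim V n x : vproj V n ⋅ vlim V x = vproj V n ⋅ x.
Proof.
apply: (tends_uniq (tendsMl (vproj V n) (vlimP V x))).
by apply: (tends_ev (N := n)) => m nm; rewrite amulA vproj_mul.
Qed.

Lemma vlimK V x : vlim V (vlim V x) = vlim V x.
Proof.
by apply: vlim_eq; apply: tends_ext (vlimP V x) => n; rewrite vproj_vlim.
Qed.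

Lemma vlim_adjoint V x y : (vlim V x^☆)^☆ ⋅ y = x ⋅ vlim V y.
Proof.
apply: (tends_uniq (tendsMr y (tends_astar (vlimP V (x^☆))))).
apply: tends_ext (tendsMl x (vlimP V y)) => n.
by rewrite astarM astarK vproj_star amulA.
Qed.

Lemma vlim_proj V v : vlim V (p v) = if v \in V then p v else 0.
Proof.
apply: vlim_eq; apply: (tends_ev (N := (pickle v).+1)) => n nv.
by rewrite vproj_proj nv andbT.
Qed.

Lemma vlim_fixed_closed V : closed_subspace [set x | vlim V x = x].
Proof.
split.
- apply: tends_closed => u x Su ux /=.
  apply: (tends_uniq (tends_lip (vlim_lip V) ux)).
  exact: tends_ext (fun n => esym (Su n)) ux.
- by rewrite /= -[0 in LHS](scale0r (0 : A)) vlimZ scale0r.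
- by move=> x y /= hx hy; rewrite vlimD hx hy.
- by move=> c x /= hx; rewrite vlimZ hx.
Qed.

(** The partial sums of all vertex projections form an approximate unit, since
    the elements that they approximate form a right ideal containing every
    vertex projection. *)
Lemma vlimT x : vlim predT x = x.
Proof.
apply: (right_ideal_full (vlim_fixed_closed predT)) => /= [y z hy|v].
  by rewrite vlimM hy.
by rewrite vlim_proj.
Qed.

Definition vmult V : (A -> A) * (A -> A) := (vlim V, fun x => (vlim V (x^☆))^☆).

Lemma vmult_projection V : multiplier_projection (vmult V).
Proof.
split.
- split=> /=.
  + split; first by move=> c x y; rewrite vlimD vlimZ.
    exact: (lip_continuous (vlim_lip V)).
  + split.
      move=> c x y; rewrite astarD astarZ vlimD vlimZ astarD astarZ.
      by rewrite conjCK.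
    apply: (lip_continuous (c := 1)) => x y.
    by rewrite -astarB nrm_astar -vlimB -astarB mul1r (le_trans (nrm_vlim _ _)) ?nrm_astar.
  + exact: vlimM.
  + by move=> x y; rewrite astarM vlimM astarM astarK.
  + exact: vlim_adjoint.
- congr (_, _); apply/funext => x /=; first exact: vlimK.
  by rewrite astarK vlimK.
- by congr (_, _); apply/funext => x /=; rewrite !astarK.
Qed.

Lemma corner_vmult V x :
  corner (vmult V) x <-> vlim V x = x /\ vlim V (x^☆) = x^☆.
Proof.
split=> [[a _ <-]|[h1 h2]]; last by exists x; rewrite //= h1 h2 astarK.
rewrite /= astarK vlimK; split=> //.
set b := vlim V a.
apply: (tends_uniq (tends_lip (vlim_lip V) (tends_astar (vlimP V (b^☆))))).
apply: tends_ext (tends_astar (vlimP V (b^☆))) => n.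
by rewrite astarM astarK vlimM vlimK.
Qed.

End VertexProjections.

(** * The graph algebra as a full corner *)

Section FullCorner.
Context {R : realType} {E : graph} (g : listing E).
Local Notation D := (desingularization g).
Local Notation sing := {v : vertex E | singular v}.
Context {CE : cstarAlgType R} {p : vertex E -> CE} {s : edge E -> CE}.
Context {CF : cstarAlgType R} {q : vertex D -> CF} {t : edge D -> CF}.
Hypotheses (GE : is_graph_algebra p s) (GF : is_graph_algebra q t).
Context {phi : CE -> CF} (hphi : star_hom phi).
Hypotheses (phi_p : forall v, phi (p v) = contracted_proj (g := g) (q := q) v).
Hypotheses (phi_s : forall e, phi (s e) = contracted_iso (q := q) (t := t) e).

Local Notation CKE := (graph_algebra_ck GE).
Local Notation CKF := (graph_algebra_ck GF).
Local Notation tpath := (tail_path (q := q) (t := t)).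

(** The homomorphism from [CF] to the matrices over the multiplier algebra of
    [CE] that is determined by the desingularized family carries [phi] to the
    embedding of [CE] in position [(0, 0)], which is isometric. *)
Lemma nrm_phi x : nrm (phi x) = nrm x.
Proof.
apply/eqP; rewrite eq_le star_hom_contractive //=.
set U := multalg CE.
have e1x : forall T : U, (opid (self_hilbert CE) : U) ⋅ T = T := @opid_mul R CE.
have ex1 : forall T : U, T ⋅ (opid (self_hilbert CE) : U) = T := @mul_opid R CE.
have CKU : ck_relations (@lmul R CE \o p) (@lmul R CE \o s).
  exact: ck_hom (lmul_hom CE) CKE.
have [_ _ univ] := GF.
have /univ[psi [hpsi psi_q psi_t]] :=
  (ck_relationsP.2 (desing_family g CKU e1x ex1)).
have psi_path v n : psi (tpath v n) = mu e1x ex1 0 n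
    (tail_proj g (p := @lmul R CE \o p) (s := @lmul R CE \o s) v n).
  elim: n => [|n IH] /=; first by rewrite psi_q /= tail_proj0.
  by rewrite (star_homM hpsi) IH psi_t /= mu_mul eqxx (tail_proj_le g CKU).
have agree : psi \o phi =1 mu e1x ex1 0 0 \o @lmul R CE.
  have [_ gen _] := GE; apply: (star_hom_eq _ _ gen).
  - have [L M S] := hphi; have [L' M' S'] := hpsi; split=> /=.
    + by move=> c a b /=; rewrite L L'.
    + by move=> a b; rewrite M M'.
    + by move=> a; rewrite S S'.
  - have [L M S] := lmul_hom CE; have [L' M' S'] := mu_hom e1x ex1 0; split=> /=.
    + by move=> c a b /=; rewrite L L'.
    + by move=> a b; rewrite M M'.
    + by move=> a; rewrite S S'.
  - move=> _ [[v _ <-]|[e _ <-]] /=; first by rewrite phi_p psi_q.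
    rewrite phi_s; case: (edge_cases g e) => [[k ->]|[w [n ->]]].
      by rewrite contracted_kept psi_t.
    rewrite contracted_listed (star_homM hpsi) psi_path psi_t /= mu_mul eqxx.
    have := tail_proj_listed g CKU (singular_of_emitter w) n n.
    by rewrite listed_emitter ltnn /= => ->.
rewrite -[leLHS]nrm_lmul (le_trans (nrm_mu_ge e1x ex1 0 0 _)) //.
by rewrite -[mu _ _ _ _ _]agree /= star_hom_contractive.
Qed.

Lemma phi_inj : injective phi.
Proof.
move=> x y xy; apply/eqP; rewrite -subr_eq0; apply/eqP/nrm_eq0.
by rewrite -nrm_phi (star_homB hphi) xy subrr nrm0.
Qed.

Lemma range_phi_subalgebra : cstar_subalgebra (range phi).
Proof.
split.
- split.
  + apply: tends_closed => u y Su uy.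
    have {}Su n : exists a, phi a = u n by case: (Su n) => a _ <-; exists a.
    have [a ua] := choice Su.
    have [x ax] : exists x, tends a x.
      apply: cauchy_tends => d /(tends_cauchy uy)[N hN]; exists N => m n Nm Nn.
      by rewrite -nrm_phi (star_homB hphi) !ua; exact: hN.
    exists x => //; apply: tends_uniq uy; apply: (tends_ext ua).
    exact: star_hom_tends.
  + by exists 0; rewrite ?(star_hom0 hphi).
  + by move=> _ _ [a _ <-] [b _ <-]; exists (a + b); rewrite ?(star_homD hphi).
  + by move=> c _ [a _ <-]; exists (c *: a); rewrite ?(star_homZ hphi).
- by move=> _ _ [a _ <-] [b _ <-]; exists (a ⋅ b); rewrite ?(star_homM hphi).
- by move=> _ [a _ <-]; exists (a^☆); rewrite ?(star_homS hphi).
Qed.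

Definition is_old : {pred vertex D} := fun u => if u is inl _ then true else false.

Local Notation L := (vlim GF is_old).

Lemma vlim_old v : L (q (old g v)) = q (old g v).
Proof. by rewrite vlim_proj. Qed.

(** The elements with this property form a closed right ideal of [CE]. *)
Lemma vlim_phi x : L (phi x) = phi x.
Proof.
have [cS S0 SD SZ] := vlim_fixed_closed GF is_old.
apply: (right_ideal_full GE (S := [set x | L (phi x) = phi x])).
- split.
  + apply: tends_closed => u y Su uy; apply: (closed_tends cS Su).
    exact: star_hom_tends.
  + by rewrite /= (star_hom0 hphi); exact: S0.
  + by move=> y z /= hy hz; rewrite (star_homD hphi); exact: SD.
  + by move=> c y /= hy; rewrite (star_homZ hphi); exact: SZ.
- by move=> y z /= hy; rewrite (star_homM hphi) vlimM hy.
- by move=> v /=; rewrite phi_p vlim_old.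
Qed.

(** A partial isometry from the projection of [u] into the corner: the path
    along the tail on which [u] lies. *)
Definition to_corner (u : vertex D) : CF :=
  match u with
  | inl v => q (old g v)
  | inr (v, n) => tpath v n.+1
  end.

Lemma to_corner_tail v n : to_corner (tail g v n) = tpath v n.
Proof. by case: n. Qed.

Lemma to_corner_star_mul u : (to_corner u)^☆ ⋅ to_corner u = q u.
Proof.
case: u => [v|[v n]] /=; first by rewrite (ck_proj_star CKF) (ck_idem CKF).
exact: (tail_path_star_mul CKF v n.+1).
Qed.

Lemma to_corner_proj u w : to_corner u ⋅ q w = if u == w then to_corner u else 0.
Proof.
have h : to_corner u ⋅ q u = to_corner u.
  by apply: partial_isometry_mul;
    rewrite ?(ck_idem CKF) ?(ck_proj_star CKF) ?to_corner_star_mul.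
have [<-//|/eqP uw] := eqVneq u w.
by rewrite -h -amulA (ck_proj_orth CKF) ?amulx0.
Qed.

Lemma proj_to_corner u w : q w ⋅ (to_corner u)^☆ =
  if u == w then (to_corner u)^☆ else 0.
Proof.
rewrite -[LHS]astarK astarM astarK (ck_proj_star CKF) to_corner_proj.
by case: ifP => _; rewrite ?astar0.
Qed.

Lemma vlim_to_corner u x : L (to_corner u ⋅ x) = to_corner u ⋅ x.
Proof.
rewrite vlimM; congr (_ ⋅ _); case: u => [v|[v n]]; first exact: vlim_old.
by rewrite /to_corner -(tail_path_source CKF) vlimM vlim_old.
Qed.

Lemma tail_path_range_phi v n : range phi (tpath v n ⋅ (tpath v n)^☆).
Proof.
rewrite (tail_path_mul_star CKF).
exists (tail_proj g (p := p) (s := s) v n) => //.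
rewrite /tail_proj (star_homB hphi) phi_p; congr (_ - _).
rewrite (big_morph phi (star_homD hphi) (star_hom0 hphi)).
apply: eq_bigr => i _; rewrite (star_homM hphi) (star_homS hphi) /listed.
by case: insub => [w|]; rewrite ?phi_s ?(star_hom0 hphi).
Qed.

(** The elements [a] whose compressions [to_corner u a to_corner u'^*] all lie
    in the range of [phi] form a C*-subalgebra, because the sum of all
    [to_corner w^* to_corner w] is the identity; it contains the generators. *)
Lemma compression_range a u u' :
  range phi (to_corner u ⋅ a ⋅ (to_corner u')^☆).
Proof.
have [[cR R0 RD RZ] RM RS] := range_phi_subalgebra.
pose T := [set a | forall u u', range phi (to_corner u ⋅ a ⋅ (to_corner u')^☆)].
suff TT : T = setT.
  have Ta : T a by rewrite TT.
  exact: Ta.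
have [_ gen _] := GF; apply: gen.
- split.
  + split.
    * apply: tends_closed => x y Tx xy w w'.
      apply: (closed_tends cR (fun n => Tx n w w')).
      by apply: tendsMr; apply: tendsMl.
    * by move=> w w'; rewrite amulx0 amul0x.
    * by move=> x y Tx Ty w w'; rewrite amulDr amulDl; exact: RD.
    * by move=> c x Tx w w'; rewrite amulZr amulZl; exact: RZ.
  + move=> x y Tx Ty w w'.
    have lim := vlimP GF predT y; rewrite vlimT in lim.
    apply: (closed_tends (u := fun n => to_corner w ⋅ (x ⋅ (vproj (p := q) predT n ⋅ y))
        ⋅ (to_corner w')^☆) cR); last first.
      by apply: tendsMr; apply: tendsMl; apply: tendsMl.
    move=> n; rewrite amul_suml !amul_sumr amul_suml.
    apply: (big_ind (range phi)) => // i _; rewrite /vproj_term.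
    case: pickle_inv => [z|]; last by rewrite amul0x !amulx0 amul0x.
    rewrite inE -to_corner_star_mul.
    have -> : to_corner w ⋅ (x ⋅ ((to_corner z)^☆ ⋅ to_corner z ⋅ y)) ⋅ (to_corner w')^☆
      = (to_corner w ⋅ x ⋅ (to_corner z)^☆) ⋅ (to_corner z ⋅ y ⋅ (to_corner w')^☆).
      by rewrite !amulA.
    by apply: RM.
  + move=> x Tx w w'; have := RS _ (Tx w' w).
    by rewrite !astarM astarK amulA.
- move=> _ [[z _ <-]|[f _ <-]] w w'.
    rewrite to_corner_proj; case: eqP => [->|_]; last by rewrite amul0x.
    have [->|zw] := eqVneq z w'; last first.
      have h : q w' ⋅ (to_corner w')^☆ = (to_corner w')^☆.
        by rewrite proj_to_corner eqxx.
      by rewrite -h amulA to_corner_proj (negPf zw) amul0x.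
    have [[v ->]|[v [n ->]]] := vertex_old_tail w'; last first.
      by rewrite to_corner_tail; exact: tail_path_range_phi.
    by rewrite /= (ck_proj_star CKF) (ck_idem CKF); exists (p v); rewrite ?phi_p.
  rewrite -(ck_source CKF) -(ck_mul_range CKF) !amulA to_corner_proj.
  case: eqP => [->|_]; last by rewrite !amul0x.
  rewrite -amulA proj_to_corner; case: eqP => [->|_]; last by rewrite amulx0.
  case: f => [k|[[v n]|[z n]]].
  + have /= -> := ck_source CKF (kept_edge g k).
    rewrite /= (ck_proj_star CKF).
    have /= -> := ck_mul_range CKF (kept_edge g k).
    by exists (s (val k)); rewrite // phi_s contracted_kept.
  + have /= -> := to_corner_tail v n.
    exact: (tail_path_range_phi v n.+1).
  + have /= -> := to_corner_tail (singular_of_emitter z) n.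
    rewrite (ck_proj_star CKF) -amulA.
    have /= -> := ck_mul_range CKF (new_edge g z n).
    by exists (s (g z n)); rewrite // phi_s contracted_listed.
Qed.

(** Such an [x] is the limit of the sums of its compressions [q v x q w] for
    [v] and [w] vertices of [E], where [to_corner] is [q] itself. *)
Lemma corner_range x : L x = x -> L (x^☆) = x^☆ -> range phi x.
Proof.
have [[cR R0 RD RZ] RM RS] := range_phi_subalgebra.
move=> Lx Lxs; have lim := vlimP GF is_old x; rewrite Lx in lim.
apply: (closed_tends cR _ lim) => n.
have lim' := tendsMl (vproj (p := q) is_old n) (tends_astar (vlimP GF is_old (x^☆))).
rewrite Lxs astarK in lim'; apply: (closed_tends cR _ lim') => m.
rewrite astarM astarK (vproj_star GF) amulA amul_suml amul_suml.
apply: (big_ind (range phi)) => // i _; rewrite amul_sumr.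
apply: (big_ind (range phi)) => // j _; rewrite /vproj_term.
case: pickle_inv => [[v|u]|]; rewrite ?inE ?amul0x //=.
case: pickle_inv => [[w|u]|]; rewrite ?inE ?amulx0 //=.
have := compression_range x (old g v) (old g w).
by rewrite /= (ck_proj_star CKF).
Qed.

Lemma phi_corner x : corner (vmult GF is_old) (phi x).
Proof. by apply/corner_vmult; rewrite -(star_homS hphi) !vlim_phi. Qed.

(** Each [q u] factors through the projection of a vertex of [E], namely
    the first vertex of the tail on which [u] lies. *)
Lemma full_corner : full (corner (vmult GF is_old)).
Proof.
move=> I [cI IM] sub; apply/seteqP; split=> // x _.
refine (right_ideal_full GF cI _ _ x) => [y z Iy|u]; first by case: (IM y z Iy).
have Iq v : I (q (old g v)).
  by apply: sub; apply/corner_vmult; rewrite (ck_proj_star CKF) vlim_old.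
have [[v ->]|[v [n ->]]] := vertex_old_tail u; first exact: Iq.
rewrite -(tail_path_star_mul CKF) -(tail_path_source CKF).
have Iqt := (IM _ (tpath v n.+1) (Iq (val v))).1.
exact: (IM _ _ Iqt).2.
Qed.

Lemma full_corner_isomorphism : isomorphic_to_full_corner CE CF.
Proof.
exists (vmult GF is_old); split; [exact: vmult_projection|exact: full_corner|].
exists phi; split=> //; split.
- by move=> x _; exact: phi_corner.
- by move=> x y _ _; exact: phi_inj.
- by move=> y /corner_vmult[]; exact: corner_range.
Qed.

(** ** The imprimitivity bimodule *)

(** The value [0] outside the range of [phi] is a default that the left inner
    product never meets: it takes its values in the corner. *)
Definition phi_inv (y : CF) : CE :=
  if pselect (range phi y) is left h then s2val (cid2 h) else 0.

Lemma phi_invK y : range phi y -> phi (phi_inv y) = y.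
Proof.
by move=> h; rewrite /phi_inv; case: pselect => // h'; case: (cid2 h').
Qed.

Lemma bimodule_complete (u : nat -> CF) : (forall n, L (u n) = u n) ->
  (forall d : R, 0 < d -> exists N, forall m n, (N <= m)%N -> (N <= n)%N ->
     nrm (u m - u n) <= d) ->
  exists2 x, L x = x & forall d : R, 0 < d ->
    exists N, forall n, (N <= n)%N -> nrm (u n - x) <= d.
Proof.
move=> Lu /cauchy_tends[x ux]; exists x => //.
have [cS _ _ _] := vlim_fixed_closed GF is_old.
exact: (closed_tends cS Lu ux).
Qed.

Lemma bimodule0 : L 0 = 0.
Proof. by have [] := vlim_fixed_closed GF is_old. Qed.

Lemma bimoduleD x y : L x = x -> L y = y -> L (x + y) = x + y.
Proof. by have [_ _ SD _] := vlim_fixed_closed GF is_old; exact: SD. Qed.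

Lemma bimoduleZ (a : R[i]) x : L x = x -> L (a *: x) = a *: x.
Proof. by have [_ _ _ SZ] := vlim_fixed_closed GF is_old; exact: SZ. Qed.

Definition bimodule_data : banach_subspace R :=
  @BanachSubspace R CF [set x | L x = x] nrm bimodule0 bimoduleD bimoduleZ
    (fun x y _ _ => nrm_triangle x y) (fun a x _ => nrmZ a x)
    (fun x _ => @nrm_eq0 _ _ x) bimodule_complete.

Definition bimodule : completeNormedModType R[i] := banach bimodule_data.

Definition bimod_val (x : bimodule) : CF := bval x.

Lemma bimod_fix x : L (bimod_val x) = bimod_val x.
Proof. exact: (bset (D := bimodule_data)). Qed.

Lemma bimod_inj : injective bimod_val. Proof. exact: val_inj. Qed.

Definition mkbimod (x : CF) (Lx : L x = x) : bimodule :=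
  bmk (D := bimodule_data) Lx.

Lemma left_act_subproof (a : CE) (x : bimodule) :
  L (phi a ⋅ bimod_val x) = phi a ⋅ bimod_val x.
Proof. by rewrite vlimM vlim_phi. Qed.

Lemma right_act_subproof (x : bimodule) (b : CF) :
  L (bimod_val x ⋅ b) = bimod_val x ⋅ b.
Proof. by rewrite vlimM bimod_fix. Qed.

Definition left_act (a : CE) (x : bimodule) : bimodule :=
  mkbimod (left_act_subproof a x).

Definition right_act (x : bimodule) (b : CF) : bimodule :=
  mkbimod (right_act_subproof x b).

Definition left_ip (x y : bimodule) : CE := phi_inv (bimod_val x ⋅ (bimod_val y)^☆).

Definition right_ip (x y : bimodule) : CF := (bimod_val x)^☆ ⋅ bimod_val y.

Lemma phi_left_ip x y : phi (left_ip x y) = bimod_val x ⋅ (bimod_val y)^☆.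
Proof.
apply: phi_invK; apply: corner_range; first by rewrite vlimM bimod_fix.
by rewrite astarM astarK vlimM bimod_fix.
Qed.

Lemma bimod_val_left a x : bimod_val (left_act a x) = phi a ⋅ bimod_val x.
Proof. by []. Qed.

Lemma bimod_val_right x b : bimod_val (right_act x b) = bimod_val x ⋅ b.
Proof. by []. Qed.

Lemma bimod_valL (c : R[i]) (x y : bimodule) :
  bimod_val (c *: x + y) = c *: bimod_val x + bimod_val y.
Proof. by []. Qed.

Lemma norm_bimod (x : bimodule) : `|x| = (nrm (bimod_val x))%:C.
Proof. by rewrite nrmE. Qed.

Lemma bimodule_left : left_hilbert_module left_act left_ip.
Proof.
split.
- split=> [a c x y|x c a b]; apply: bimod_inj.
    by rewrite bimod_valL !bimod_val_left bimod_valL amulDr amulZr.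
  by rewrite bimod_valL !bimod_val_left (star_homL hphi) amulDl amulZl.
- move=> a b x; apply: bimod_inj.
  by rewrite !bimod_val_left (star_homM hphi) amulA.
- split=> [y c x z|a x y]; apply: phi_inj.
    by rewrite (star_homL hphi) !phi_left_ip bimod_valL amulDl amulZl.
  by rewrite (star_homM hphi) !phi_left_ip bimod_val_left amulA.
- move=> x y; apply: phi_inj.
  by rewrite (star_homS hphi) !phi_left_ip astarM astarK.
- move=> x; split; last first.
    by rewrite norm_bimod nrmE -nrm_phi phi_left_ip nrmCCr rmorphXn.
  apply: (positive_reflect hphi nrm_phi).
    by exists ((bimod_val x)^☆); rewrite phi_left_ip astarK.
  by apply: phi_inj; rewrite (star_homS hphi) !phi_left_ip astarM astarK.
Qed.

Lemma bimodule_right : right_hilbert_module right_act right_ip.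
Proof.
split.
- split=> [b c x y|x c a b]; apply: bimod_inj.
    by rewrite bimod_valL !bimod_val_right bimod_valL amulDl amulZl.
  by rewrite bimod_valL !bimod_val_right amulDr amulZr.
- by move=> x a b; apply: bimod_inj; rewrite !bimod_val_right amulA.
- split=> [x c y z|x y b]; rewrite /right_ip.
    by rewrite bimod_valL amulDr amulZr.
  by rewrite bimod_val_right amulA.
- by move=> x y; rewrite /right_ip astarM astarK.
- move=> x; split; first by exists (bimod_val x).
  by rewrite norm_bimod nrmE nrmCC rmorphXn.
Qed.

(* [p v a] is the left inner product of [p v] and [a^*]. *)
Lemma bimodule_left_full : full_inner_product left_ip.
Proof.
move=> S [cS S0 SD SZ] Sip; apply/seteqP; split=> // a _.
rewrite -(vlimT GE a); apply: (closed_tends cS _ (vlimP GE predT a)) => n.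
rewrite amul_suml; apply: (big_ind S) => // i _; rewrite /vproj_term.
case: pickle_inv => [v|]; last by rewrite amul0x.
rewrite inE.
have -> : p v ⋅ a = left_ip (mkbimod (vlim_phi (p v))) (mkbimod (vlim_phi (a^☆))).
  apply: phi_inj; rewrite phi_left_ip /bimod_val /= (star_homM hphi).
  by rewrite (star_homS hphi) astarK.
exact: Sip.
Qed.

(* [q u a] is the right inner product of [to_corner u] and [to_corner u a]. *)
Lemma bimodule_right_full : full_inner_product right_ip.
Proof.
move=> S [cS S0 SD SZ] Sip; apply/seteqP; split=> // a _.
rewrite -(vlimT GF a); apply: (closed_tends cS _ (vlimP GF predT a)) => n.
rewrite amul_suml; apply: (big_ind S) => // i _; rewrite /vproj_term.
case: pickle_inv => [u|]; last by rewrite amul0x.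
rewrite inE -to_corner_star_mul -amulA.
have Lu : L (to_corner u) = to_corner u.
  have := vlim_to_corner u (q u).
  by rewrite to_corner_proj eqxx.
exact: (Sip (mkbimod Lu) (mkbimod (vlim_to_corner u a))).
Qed.

Lemma corner_morita : morita_equivalent CE CF.
Proof.
constructor.
apply: (@ImprimitivityBimodule R CE CF bimodule left_act right_act left_ip right_ip).
- by move=> a x b; apply: bimod_inj; rewrite !(bimod_val_left, bimod_val_right) amulA.
- exact: bimodule_left.
- exact: bimodule_right.
- exact: bimodule_left_full.
- exact: bimodule_right_full.
- move=> a x y; rewrite /right_ip !bimod_val_left astarM (star_homS hphi).
  by rewrite amulA.
- move=> b x y; apply: phi_inj; rewrite !phi_left_ip !bimod_val_right astarM astarK.
  by rewrite amulA.
- move=> x y z; apply: bimod_inj.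
  by rewrite bimod_val_left bimod_val_right phi_left_ip amulA.
Qed.

End FullCorner.

Theorem theorem2p11 (R : realType) (E F : graph)
    (CE : cstarAlgType R) (p : vertex E -> CE) (s : edge E -> CE)
    (CF : cstarAlgType R) (q : vertex F -> CF) (t : edge F -> CF) :
  is_desingularization E F ->
  is_graph_algebra p s -> is_graph_algebra q t ->
  isomorphic_to_full_corner CE CF /\ morita_equivalent CE CF.
Proof.
move=> [g [fv [fe [bv be fr fs]]]] GE GF.
have GD := iso_graph_algebra bv be fr fs GF.
have [_ _ univ] := GE.
have [phi [hphi phi_p phi_s]] :=
  univ _ _ _ (ck_relationsP.2 (contracted_family (graph_algebra_ck GD))).
split; first exact: (full_corner_isomorphism GE GD hphi phi_p phi_s).
exact: (corner_morita GE GD hphi phi_p phi_s).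
Qed.
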